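(* Let $0<T<\infty$, let $\mathfrak{X}$ be a zero-mean generalized Gaussian field over $L_2((0,T))$, and let $X(t)=\mathfrak{X}(\chi_t)$, $0\le t\le T$. Then the solution of the Itô equation $$u(t)=1+\int_0^t u(s)\,dX(s),\qquad 0\le t\le T,$$ is unique in the class of square integrable $\mathcal{F}^{X}$-measurable processes, and is given by $$u(t)=e^{X(t)-\frac12\mathbb{E}X^2(t)}.$$
   Context: $(\Omega,\mathcal F,\mathbb P)$ is a probability space, assumed rich enough to support all random elements needed. All Hilbert spaces are real. $\chi_t$ is the indicator function of $[0,t]$. A zero-mean generalized Gaussian field over a Hilbert space $\mathbf H$ is a map $f\mapsto\mathfrak X(f)$ from $\mathbf H$ to (possibly degenerate) zero-mean Gaussian random variables that is linear, $\mathfrak X(\alpha f+\beta g)=\alpha\mathfrak X(f)+\beta\mathfrak X(g)$, and continuous: $f_n\to f$ in $\mathbf H$ implies $\mathfrak X(f_n)\to\mathfrak X(f)$ in probability. It is a white noise over $\mathbf H$ if $\mathbb E(\mathfrak X(f)\mathfrak X(g))=(f,g)_{\mathbf H}$ for all $f,g$. Write $\mathcal F^{\mathfrak X}$ for the sigma-algebra generated by $\{\mathfrak X(f): f\in\mathbf H\}$ and $\mathbb H_{\mathfrak X}$ for the Hilbert space of square integrable $\mathcal F^{\mathfrak X}$-measurable random variables. Here $\mathcal F^X=\mathcal F^{\mathfrak X}$, and the class of square integrable $\mathcal F^X$-measurable processes is $L_2((0,T);\mathbb H_{\mathfrak X})$. Chaos basis. Let $\mathfrak B$ be a white noise over a separable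 $\mathbf H$ with orthonormal basis $\{m_k\}_{k\ge1}$ and let $\xi_k=\mathfrak B(m_k)$. Let $\mathcal I$ be the set of multi-indices $\alpha=(\alpha_1,\alpha_2,\dots)$ of non-negative integers with $|\alpha|=\sum_k\alpha_k<\infty$, and $\alpha!=\prod_k\alpha_k!$. Let $H_n(t)=(-1)^ne^{t^2/2}\frac{d^n}{dt^n}e^{-t^2/2}$ be the Hermite polynomials and $\xi_\alpha=\prod_k H_{\alpha_k}(\xi_k)/\sqrt{\alpha_k!}$. Then $\{\xi_\alpha\}_{\alpha\in\mathcal I}$ is an orthonormal basis of $\mathbb H_{\mathfrak B}$. The Wick product $\diamond$ is the bilinear operation determined by $\xi_\alpha\diamond\xi_\beta=\sqrt{(\alpha+\beta)!/(\alpha!\beta!)}\,\xi_{\alpha+\beta}$ (extended to series whenever the resulting series converges in $\mathbb H_{\mathfrak B}$). Itô stochastic integral. An $\mathbf H$-valued random element $\eta$ is $(\mathfrak B,\mathbf H)$-admissible if $\mathbb E\|\eta\|_{\mathbf H}^2<\infty$ and $(\eta,f)_{\mathbf H}$ is $\mathcal F^{\mathfrak B}$-measurable for every $f\in\mathbf H$; then $\eta=\sum_\alpha\eta_\alpha\xi_\alpha$ with $\eta_\alpha=\mathbb E(\eta\xi_\alpha)\in\mathbf H$, and $\mathfrak B^\diamond(\eta)=\sum_{\alpha\in\mathcal I}\mathfrak B(\eta_\alpha)\diamond\xi_\alpha$ (series in $\mathbb H_{\mathfrak B}$). For the field $\mathfrak X$ over $\mathbf H=L_2((0,T))$, choose a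 white noise representation $\mathfrak X(f)=\mathfrak B(\mathcal K^*f)$, where $\mathcal K$ is a bounded linear operator on $\mathbf H$, $\mathcal K^*$ is its adjoint, and $\mathfrak B$ is a white noise over $\mathbf H$ (such a representation exists), and set $\mathfrak X^\diamond(\eta)=\mathfrak B^\diamond(\mathcal K^*\eta)$. The integral in the equation is $\int_0^t u(s)\,dX(s):=\mathfrak X^\diamond(u\chi_t)=\mathfrak B^\diamond(\mathcal K^*(u\chi_t))$. *)

(* Defs.v *)
From HB Require Import structures.
From mathcomp Require Import all_boot all_order all_algebra finmap.
From mathcomp Require Import all_classical all_reals all_analysis.
From mathcomp Require Import measurable_realfun.
From mathcomp Require summability.

Set Implicit Arguments.
Unset Strict Implicit.
Unset Printing Implicit Defensive.

Import Order.TTheory GRing.Theory Num.Theory.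
Import numFieldNormedType.Exports.

Local Open Scope classical_set_scope.
Local Open Scope ring_scope.

(* Elements of L_2(mu) are square integrable functions, not classes: every
   identity between them, and every identity between random variables, is an
   almost everywhere identity. *)
Section L2.
Context {d : measure_display} {S : measurableType d} {R : realType}.
Variable mu : {measure set S -> \bar R}.

Definition L2 := LfunType mu (lee1n 2).

Definition dotL2 (f g : S -> R) : R := \int[mu]_x (f x * g x).

Definition normL2 (f : S -> R) : \bar R := 'N[mu]_2%:E[EFin \o f]%E.

(* Unconditional convergence, along the directed set of finite subsets of I. *)
Definition sumL2 (I : choiceType) (F : I -> S -> R) (s : S -> R) :=
  s \in Lfun mu 2%:E /\
  normL2 (fun x => \sum_(i <- J) F i x - s x)
    @[J --> @summability.totally I] --> 0%E.

Definition orthonormal_basis (m : nat -> L2) :=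
  (forall j k, dotL2 (m j) (m k) = (j == k)%:R) /\
  (forall f : L2, (forall k, dotL2 f (m k) = 0) -> f = cst 0 %[ae mu]).

Definition bounded_operator (K : L2 -> L2) :=
  (forall (a b : R) (f g : L2),
     K (a *: f + b *: g) = a *: K f + b *: K g %[ae mu]) /\
  exists C : R, forall f : L2, (normL2 (K f) <= C%:E * normL2 f)%E.

Definition adjoint_of (K Ks : L2 -> L2) :=
  forall f g : L2, dotL2 (K f) g = dotL2 f (Ks g).

End L2.

Section L2_interval.
Context {R : realType}.
Variable T : R.

Definition leb : {measure set (measurableTypeR R) -> \bar R} :=
  mrestr (@lebesgue_measure R) (measurable_itv `]0, T[).

Lemma Lfun_indic_itv (t : R) : (\1_`[0, t] : _ -> R) \in Lfun leb 2%:E.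
Proof.
rewrite inE; apply/andP; split; first by rewrite inE/=; exact: measurable_indic.
rewrite inE/= /finite_norm unlock poweR_lty//.
rewrite (_ : (fun x => _) = fun x => ((\1_`[0, t] : R -> R) x)%:E).
  rewrite integral_indic// setIT /leb/= /mrestr.
  apply: (@le_lt_trans _ _ (lebesgue_measure `]0, T[)).
    by apply: le_measure; rewrite ?inE//; exact: measurableI.
  by rewrite lebesgue_measure_itv/=; case: ifP => _; rewrite -?EFinB ltry.
apply/funext => x /=; rewrite indicE; case: (x \in _) => /=.
  by rewrite normr1 powR1.
by rewrite normr0 powR0.
Qed.

Definition chi (t : R) : L2 leb := Lfun_Sub (lee1n 2) (Lfun_indic_itv t).

End L2_interval.

Section gaussian_field.
Context {R : realType} {d : measure_display} {Omega : measurableType d}.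
Variable P : probability Omega R.

(* [normal_prob 0 0] is not the Dirac mass at 0, hence the separate case. *)
Definition centered_gaussian (Y : {RV P >-> R}) :=
  Y = cst 0 %[ae P] \/
  exists2 s : R, 0 < s &
    forall A : set (measurableTypeR R), measurable A ->
      distribution P Y A = normal_prob 0 s A.

Context {dS : measure_display} {S : measurableType dS}.
Variable mu : {measure set S -> \bar R}.
Implicit Types X B : L2 mu -> {RV P >-> R}.

Definition gaussian_field X :=
  [/\ forall f, centered_gaussian (X f),
      forall (a b : R) (f g : L2 mu),
        X (a *: f + b *: g) = (fun w => a * X f w + b * X g w) %[ae P] &
      forall (f_ : nat -> L2 mu) (f : L2 mu),
        normL2 mu (f_ n - f) @[n --> \oo] --> 0%E ->
        forall e : R, 0 < e ->
          P [set w | e < `|X (f_ n) w - X f w|] @[n --> \oo] --> 0%E].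

Definition white_noise B :=
  gaussian_field B /\
  forall f g : L2 mu, ('E_P[(fun w => B f w * B g w)%R] = (dotL2 mu f g)%:E)%E.

Definition field_events X : set (set Omega) :=
  \bigcup_f g_sigma_algebra_preimage (X f).

(* Y is a.s. equal to a function measurable for the sigma-algebra of X. *)
Definition field_measurable X (Y : Omega -> R) :=
  exists2 Z : g_sigma_algebraType (field_events X) -> R,
    measurable_fun setT Z & Y = (Z : Omega -> R) %[ae P].

Definition field_L2 X (Y : Omega -> R) :=
  Y \in Lfun P 2%:E /\ field_measurable X Y.

End gaussian_field.

Definition hermite {R : realType} (n : nat) (t : R) : R :=
  (-1) ^+ n * expR (t ^+ 2 / 2) * derive1n n (fun s : R => expR (- s ^+ 2 / 2)) t.

Definition multi_index := {fsfun nat -> nat with 0%N}.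

Definition mi_add (a b : multi_index) : multi_index :=
  [fsfun k in (finsupp a `|` finsupp b)%fset => (a k + b k)%N | 0%N].

Definition mi_fact (a : multi_index) : nat := (\prod_(k <- finsupp a) (a k)`!)%N.

Section chaos.
Context {R : realType} {d : measure_display} {Omega : measurableType d}.
Variable P : probability Omega R.
Context {dS : measure_display} {S : measurableType dS}.
Variable mu : {measure set S -> \bar R}.
Variables (B : L2 mu -> {RV P >-> R}) (m : nat -> L2 mu).

Definition xi (a : multi_index) (w : Omega) : R :=
  \prod_(k <- finsupp a) (hermite (a k) (B (m k) w) / Num.sqrt (a k)`!%:R).

(* W is the Wick product of F and G: the bilinear extension, over the chaos
   expansions of F and G, of the rule for xi a and xi b. *)
Definition wick (F G W : Omega -> R) :=
  [/\ field_L2 B F, field_L2 B G &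
      sumL2 P
        (fun (ab : multi_index * multi_index) (w : Omega) =>
           dotL2 P F (xi ab.1) * dotL2 P G (xi ab.2) *
           (Num.sqrt ((mi_fact (mi_add ab.1 ab.2))%:R /
                      (mi_fact ab.1 * mi_fact ab.2)%:R) *
            xi (mi_add ab.1 ab.2) w))
        W].

Definition admissible (eta : Omega -> L2 mu) :=
  (forall f : L2 mu, field_measurable B (fun w => dotL2 mu (eta w) f)) /\
  (\int[P]_w (dotL2 mu (eta w) (eta w))%:E < +oo)%E.

(* The expectation eta_ a of the L_2(mu)-valued [eta * xi a] is taken in the
   weak sense. *)
Definition wn_integral (eta : Omega -> L2 mu) (I : Omega -> R) :=
  admissible eta /\
  exists (eta_ : multi_index -> L2 mu) (W : multi_index -> Omega -> R),
    [/\ forall a (f : L2 mu),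
          dotL2 mu (eta_ a) f = dotL2 P (fun w => dotL2 mu (eta w) f) (xi a),
        forall a, wick (B (eta_ a)) (xi a) (W a) &
        sumL2 P W I].

End chaos.

Section processes.
Context {R : realType} {d : measure_display} {Omega : measurableType d}.
Variables (P : probability Omega R) (T : R).
Local Notation H := (L2 (leb T)).

(* The L_2((0,T))-valued random element of a process: eta is jointly measurable
   and is, up to null sets, w |-> u(., w).  The process itself need not have
   measurable trajectories. *)
Definition path_element (u : R -> Omega -> R) (eta : Omega -> H) :=
  measurable_fun [set: measurableTypeR R * Omega]
    (fun z : measurableTypeR R * Omega => eta z.2 z.1) /\
  \forall s \ae leb T, u s = (eta ^~ s : Omega -> R) %[ae P].

(* The class L_2((0,T); H_X), where H_X is the space [field_L2 X]. *)
Definition process_L2 (X : H -> {RV P >-> R}) (u : R -> Omega -> R) :=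
  (\forall s \ae leb T, field_L2 X (u s)) /\
  exists2 eta : Omega -> H, path_element u eta &
    (\int[P]_w (dotL2 (leb T) (eta w) (eta w))%:E < +oo)%E.

Variables (B : H -> {RV P >-> R}) (m : nat -> H) (Ks : H -> H).

(* I is the integral of u over [0, t] with respect to f |-> B (Ks f). *)
Definition ito_integral (u : R -> Omega -> R) (t : R) (I : Omega -> R) :=
  exists2 eta : Omega -> H,
    path_element (fun s w => u s w * \1_`[0, t] s) eta &
    wn_integral B m (fun w => Ks (eta w)) I.

Definition ito_equation (u : R -> Omega -> R) (t : R) :=
  exists2 I : Omega -> R,
    ito_integral u t I & u t = (fun w => 1 + I w) %[ae P].

End processes.

(* Main.v *)
(** Write [v(t) = K* chi_t] and [E(v) = exp (B v - |v|^2/2)].  The chaos coefficients of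
    [E(v)] are [prod_k (v, m_k)^(a_k) / sqrt (a_k!)].  For [v = v(t)] they are products of the
    primitives [int_0^t K m_k], so the product rule gives
    [c_a(t) = 1_(a = 0) + sum_k sqrt (a_k) int_0^t c_(a - e_k)(s) (K m_k)(s) ds].
    The Ito equation imposes exactly this system, triangular in [|a|], on the coefficients of a
    solution; as both sides of the equation lie in the closed span of the chaos basis, a
    solution equals [E(v(t))] almost surely whenever the equation holds at [t].
    Conversely [E(v(t))] has the right coefficients, and the series of Wick products converges
    because [sum_a (|a| + 1) |eta_a|^2] is finite: it is at most [sum_a 2^|a| |eta_a|^2], which
    Bessel's inequality for [E(sqrt 2 v(s))], integrated over [s], controls. *)

Require Import Defs.
From HB Require Import structures.
From mathcomp Require Import all_boot all_order all_algebra finmap.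
From mathcomp Require Import all_classical all_reals all_analysis.
From mathcomp Require Import measurable_realfun ring lra.
From mathcomp Require summability.

Set Implicit Arguments.
Unset Strict Implicit.
Unset Printing Implicit Defensive.

Import Order.TTheory GRing.Theory Num.Theory.
Import numFieldNormedType.Exports.

Local Open Scope classical_set_scope.
Local Open Scope ring_scope.

(** * Semi-inner products and closed spans *)

(** Elements of [L2 mu] are functions, so [dotL2] is only semidefinite and the Hilbert space
    arguments are made for such forms; a vanishing square norm becomes an almost everywhere identity
    only at the end. Three places carry the difficulty. Gaussian expectations: products of Hermite
    polynomials in the noise are integrated against [expR (B y w)] by repeated differentiation of
    the moment generating function along the [m k], which yields the orthonormality of [xi] and the
    coefficients of exponentials. Closed span: [E(v)] belongs to it because its squared coefficients
    over boxes of multi-indices factor into truncated exponential series, whose product tends to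
    [exp |v|^2], the square norm of [E(v)]. Measurability: the family [B (Ks (chi T t))] need not be
    measurable in [t], whereas the integrand must be a jointly measurable random element of [L2]; a
    version is built from dyadic times, along which the exponentials converge almost surely. *)

Record semi_inner (R : realType) (V : lmodType R) (dot : V -> V -> R) : Prop :=
  SemiInner {
    innerC : forall u v, dot u v = dot v u;
    innerDl : forall u v w, dot (u + v) w = dot u w + dot v w;
    innerZl : forall a u v, dot (a *: u) v = a * dot u v;
    inner_ge0 : forall u, 0 <= dot u u }.

Section SemiInnerTheory.
Context {R : realType} {V : lmodType R}.
Variable dot : V -> V -> R.
Hypothesis sd : semi_inner dot.

Let dotC := innerC sd.
Let dotDl := innerDl sd.
Let dotZl := innerZl sd.
Let dot_ge0 := inner_ge0 sd.

Lemma innerDr u v w : dot w (u + v) = dot w u + dot w v.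
Proof. by rewrite dotC dotDl !(dotC _ w). Qed.

Lemma innerZr a u v : dot v (a *: u) = a * dot v u.
Proof. by rewrite dotC dotZl dotC. Qed.

Lemma innerNl u v : dot (- u) v = - dot u v.
Proof. by rewrite -scaleN1r dotZl mulN1r. Qed.

Lemma innerNr u v : dot v (- u) = - dot v u.
Proof. by rewrite dotC innerNl dotC. Qed.

Lemma innerBl u v w : dot (u - v) w = dot u w - dot v w.
Proof. by rewrite dotDl innerNl. Qed.

Lemma innerBr u v w : dot w (u - v) = dot w u - dot w v.
Proof. by rewrite innerDr innerNr. Qed.

Lemma inner0l v : dot 0 v = 0.
Proof. by rewrite -(scale0r 0) dotZl mul0r. Qed.

Lemma inner_suml I (r : seq I) (F : I -> V) v :
  dot (\sum_(i <- r) F i) v = \sum_(i <- r) dot (F i) v.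
Proof.
elim: r => [|i r IH]; first by rewrite !big_nil inner0l.
by rewrite !big_cons dotDl IH.
Qed.

(** The form may vanish on a nonzero [v]. Then the square norm of [u + t *: v] is affine in [t] and
    nonnegative, which forces [dot u v = 0]; otherwise the usual residual is used, multiplied by
    [dot v v] to avoid a division. *)
Lemma inner_CauchySchwarz u v : (dot u v) ^+ 2 <= dot u u * dot v v.
Proof.
have [v0|v0] := eqVneq (dot v v) 0.
  have H t : 0 <= dot u u + t * (2 * dot u v).
    have := dot_ge0 (u + t *: v).
    rewrite dotDl !innerDr !dotZl !innerZr v0 (dotC v u).
    by rewrite !mulr0 addr0 -addrA mulrDl mul1r mulrDr.
  (* If [dot u v] were nonzero, the affine function would equal -1 at this point. *)
  have := H (- (dot u u + 1) / (2 * dot u v)).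
  have [->|uv] := eqVneq (dot u v) 0; first by rewrite expr0n v0 !mulr0.
  by rewrite divfK ?mulf_neq0//; lra.
have vp : 0 < dot v v by rewrite lt_neqAle eq_sym v0 dot_ge0.
have := dot_ge0 (dot v v *: u - dot u v *: v).
rewrite innerBl !innerBr !dotZl !innerZr (dotC v u).
have -> : dot v v * (dot v v * dot u u) - dot v v * (dot u v * dot u v) -
  (dot u v * (dot v v * dot u v) - dot u v * (dot u v * dot v v)) =
  dot v v * (dot u u * dot v v - dot u v ^+ 2) by ring.
by rewrite pmulr_rge0// subr_ge0.
Qed.

Lemma inner_sqD_le u v : dot (u + v) (u + v) <= 2 * dot u u + 2 * dot v v.
Proof.
have := dot_ge0 (u - v).
rewrite innerBl !innerBr dotDl !innerDr (dotC v u); lra.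
Qed.

Section Orthonormal.
Context {A : choiceType}.
Variable e : A -> V.
Hypothesis e_orth : forall a b, dot (e a) (e b) = (a == b)%:R.

Definition lincomb (J : {fset A}) (c : A -> R) : V := \sum_(a <- J) c a *: e a.

Definition proj (J : {fset A}) (v : V) : V := lincomb J (fun a => dot v (e a)).

Lemma inner_lincomb J c v : dot v (lincomb J c) = \sum_(a <- J) c a * dot v (e a).
Proof.
rewrite dotC inner_suml; apply: eq_bigr => a _.
by rewrite dotZl dotC.
Qed.

Lemma coef_lincomb J c b :
  dot (lincomb J c) (e b) = if b \in J then c b else 0.
Proof.
rewrite inner_suml; case: ifPn => bJ.
  rewrite (big_fsetD1 b)//= dotZl e_orth eqxx mulr1 big1_fset ?addr0// => a.
  by rewrite !inE => /andP[ab _] _; rewrite dotZl e_orth (negbTE ab) mulr0.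
rewrite big1_fset// => a aJ _; rewrite dotZl e_orth.
by case: eqVneq aJ bJ => [->->//|]; rewrite mulr0.
Qed.

Lemma sq_lincomb J c : dot (lincomb J c) (lincomb J c) = \sum_(a <- J) c a ^+ 2.
Proof.
rewrite inner_lincomb big_seq [RHS]big_seq.
by apply: eq_bigr => a aJ; rewrite coef_lincomb aJ expr2.
Qed.

(** Completing the square in the coefficients: Bessel's inequality, the residual of a projection and
    its optimality are all read off from it. *)
Lemma sq_sub_lincomb J c v : dot (v - lincomb J c) (v - lincomb J c) =
  dot v v - \sum_(a <- J) dot v (e a) ^+ 2 + \sum_(a <- J) (c a - dot v (e a)) ^+ 2.
Proof.
rewrite innerBl !innerBr (dotC (lincomb _ _) v) sq_lincomb inner_lincomb.
have -> : \sum_(a <- J) (c a - dot v (e a)) ^+ 2 =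
  \sum_(a <- J) c a ^+ 2 - 2 * \sum_(a <- J) c a * dot v (e a) +
  \sum_(a <- J) dot v (e a) ^+ 2.
  rewrite mulr_sumr -sumrB -big_split/=; apply: eq_bigr => a _; ring.
ring.
Qed.

Lemma sq_sub_proj J v : dot (v - proj J v) (v - proj J v) =
  dot v v - \sum_(a <- J) dot v (e a) ^+ 2.
Proof.
by rewrite sq_sub_lincomb [X in _ + X]big1 ?addr0// => a _; rewrite subrr expr0n.
Qed.

Lemma proj_best J c v : dot (v - proj J v) (v - proj J v) <=
  dot (v - lincomb J c) (v - lincomb J c).
Proof.
by rewrite sq_sub_proj sq_sub_lincomb lerDl sumr_ge0// => a _; exact: sqr_ge0.
Qed.

Lemma bessel (J : {fset A}) v : \sum_(a <- J) dot v (e a) ^+ 2 <= dot v v.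
Proof. by have := dot_ge0 (v - proj J v); rewrite sq_sub_proj subr_ge0. Qed.

Lemma proj_mono (J J' : {fset A}) v : (J `<=` J')%fset ->
  dot (v - proj J' v) (v - proj J' v) <= dot (v - proj J v) (v - proj J v).
Proof.
move=> JJ'; rewrite !sq_sub_proj lerD2l lerN2.
rewrite [leRHS](big_fsetID _ (mem J))/=.
rewrite (_ : [fset x | x in J' & x \in J]%fset = J).
  by rewrite lerDl sumr_ge0// => a _; exact: sqr_ge0.
apply/fsetP => x; rewrite !inE; apply/andP/idP => [[]//|xJ]; split=> //.
exact: (fsubsetP JJ').
Qed.

Lemma projD J u v : proj J (u + v) = proj J u + proj J v.
Proof.
rewrite /proj /lincomb -big_split/=; apply: eq_bigr => a _.
by rewrite dotDl scalerDl.
Qed.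

Lemma projZ J c u : proj J (c *: u) = c *: proj J u.
Proof.
rewrite /proj /lincomb scaler_sumr; apply: eq_bigr => a _.
by rewrite dotZl scalerA.
Qed.

(* As [e] is orthonormal, this is its closed linear span. *)
Definition cspan (v : V) := forall eps, 0 < eps ->
  exists J, dot (v - proj J v) (v - proj J v) < eps.

Lemma cspan_lincomb J c : cspan (lincomb J c).
Proof.
move=> eps eps0; exists J; apply: le_lt_trans (proj_best J c _) _.
by rewrite subrr inner0l.
Qed.

Lemma cspan_basis a : cspan (e a).
Proof.
by have := cspan_lincomb [fset a]%fset (fun=> 1); rewrite /lincomb big_seq_fset1 scale1r.
Qed.

Lemma cspanD u v : cspan u -> cspan v -> cspan (u + v).
Proof.
move=> cu cv eps eps0.
have eps4 : 0 < eps / 4 by rewrite divr_gt0.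
have [J JH] := cu _ eps4; have [J' JH'] := cv _ eps4.
exists (J `|` J')%fset; rewrite projD opprD addrACA.
apply: le_lt_trans (inner_sqD_le _ _) _.
have := le_lt_trans (proj_mono u (fsubsetUl J J')) JH.
have := le_lt_trans (proj_mono v (fsubsetUr J J')) JH'.
lra.
Qed.

Lemma cspanZ c u : cspan u -> cspan (c *: u).
Proof.
move=> cu eps eps0.
have d0 : 0 < c ^+ 2 + 1 by rewrite ltr_wpDl// sqr_ge0.
have [J JH] := cu _ (divr_gt0 eps0 d0).
exists J; rewrite projZ -scalerBr dotZl innerZr mulrA -expr2.
move: JH; rewrite ltr_pdivlMr// mulrDr mulr1 mulrC => JH.
by apply: le_lt_trans JH; rewrite lerDl dot_ge0.
Qed.

Lemma cspanN u : cspan u -> cspan (- u).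
Proof. by rewrite -scaleN1r; exact: cspanZ. Qed.

Lemma cspanB u v : cspan u -> cspan v -> cspan (u - v).
Proof. by move=> cu cv; apply/cspanD/cspanN. Qed.

Lemma cspan_sum I (r : seq I) (F : I -> V) :
  (forall i, cspan (F i)) -> cspan (\sum_(i <- r) F i).
Proof.
move=> cF; apply: big_ind => //; last exact: cspanD.
by have := cspan_lincomb fset0 (fun=> 0); rewrite /lincomb big_seq_fset0.
Qed.

(** Taking residuals is additive and does not increase the norm, so replacing [v] by a nearby [w]
    costs no more than a multiple of their distance. *)
Lemma cspan_closed v :
  (forall eps, 0 < eps -> exists2 w, cspan w & dot (v - w) (v - w) < eps) ->
  cspan v.
Proof.
move=> H eps eps0.
have eps4 : 0 < eps / 4 by rewrite divr_gt0.
have [w cw vw] := H _ eps4; have [J JH] := cw _ eps4.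
exists J.
have vE : v - proj J v = (v - w - proj J (v - w)) + (w - proj J w).
  have -> : proj J v = proj J (v - w) + proj J w by rewrite -projD subrK.
  by rewrite addrACA subrK opprD.
rewrite vE; apply: le_lt_trans (inner_sqD_le _ _) _.
have : dot (v - w - proj J (v - w)) (v - w - proj J (v - w)) <= dot (v - w) (v - w).
  by rewrite sq_sub_proj gerBl sumr_ge0// => a _; exact: sqr_ge0.
lra.
Qed.

(** Half of Parseval's identity, special to the closed span: the residual outside a suitable [J] is
    arbitrarily small. *)
Lemma cspan_sq_le v c : cspan v ->
  (forall J : {fset A}, \sum_(a <- J) dot v (e a) ^+ 2 <= c) -> dot v v <= c.
Proof.
move=> cv H; apply/ler_addgt0Pr => eps eps0.
by have [J] := cv _ eps0; rewrite sq_sub_proj; have := H J; lra.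
Qed.

Lemma cspan_coef0 v : cspan v -> (forall a, dot v (e a) = 0) -> dot v v = 0.
Proof.
move=> cv v0; apply/eqP; rewrite eq_le dot_ge0// andbT.
by apply: cspan_sq_le => // J; rewrite big1// => a _; rewrite v0 expr0n.
Qed.

End Orthonormal.

Definition sq_cauchy (u : nat -> V) := forall eps, 0 < eps ->
  exists N, forall n k, (N <= n)%N -> (N <= k)%N -> dot (u n - u k) (u n - u k) < eps.

Definition sq_limit (u : nat -> V) (l : V) := forall eps, 0 < eps ->
  exists N, forall n, (N <= n)%N -> dot (u n - l) (u n - l) < eps.

Definition sq_complete := forall u, sq_cauchy u -> exists l, sq_limit u l.

Lemma bounded_nneg_tail (x : nat -> R) (M eps : R) :
  (forall n, 0 <= x n) -> (forall N, \sum_(k < N) x k <= M) -> 0 < eps ->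
  exists N, forall n, (N <= n)%N -> \sum_(N <= k < n) x k < eps.
Proof.
move=> x0 xM eps0; set S := [set y | exists N, y = \sum_(k < N) x k].
have Ssup : has_sup S.
  by split; [exists (\sum_(k < 0) x k), 0%N|exists M => _ [N ->]].
have [_ [N ->] HN] := @sup_adherent _ S _ eps0 Ssup.
exists N => n Nn; have : \sum_(k < n) x k <= sup S.
  by apply: (sup_upper_bound Ssup); exists n.
rewrite -!(big_mkord xpredT) (@big_cat_nat _ _ _ N)//= big_mkord => H1.
by move: HN H1; lra.
Qed.

(** Riesz-Fischer along an injective enumeration [s] of part of the family. The enumeration serves
    the Wick products, whose prescribed coefficients sit at the indices [mi_add (mi_unit k) a]. *)
Lemma summable_coefs {A : choiceType} (e : A -> V) (s : nat -> A) (x : nat -> R) (M : R) :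
  sq_complete -> (forall a b, dot (e a) (e b) = (a == b)%:R) -> injective s ->
  (forall N, \sum_(k < N) x k ^+ 2 <= M) ->
  exists v, [/\ cspan e v, forall k, dot v (e (s k)) = x k &
    forall a, (forall k, a != s k) -> dot v (e a) = 0].
Proof.
move=> cpl e_orth s_inj xM; pose u n := \sum_(k < n) x k *: e (s k).
have x0 n : 0 <= x n ^+ 2 by exact: sqr_ge0.
have sqB N n : (N <= n)%N ->
    dot (u n - u N) (u n - u N) = \sum_(N <= k < n) x k ^+ 2.
  move=> Nn; have -> : u n - u N = \sum_(N <= k < n) x k *: e (s k).
    rewrite /u -!(big_mkord xpredT (fun k => x k *: e (s k))).
    by rewrite (@big_cat_nat _ _ _ N)//= addrAC subrr add0r.
  rewrite inner_suml big_nat [RHS]big_nat; apply: eq_bigr => k kn.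
  rewrite dotC inner_suml (bigD1_seq k) ?mem_index_iota ?iota_uniq//=.
  rewrite dotZl innerZr e_orth eqxx mulr1 -expr2 big1 ?addr0// => j jk.
  by rewrite dotZl innerZr e_orth (inj_eq s_inj) (negbTE jk) !mulr0.
have [v uv] : exists v, sq_limit u v.
  apply: cpl => eps eps0.
  have [N HN] := bounded_nneg_tail x0 xM (divr_gt0 eps0 (ltr0n _ 4)).
  exists N => n k Nn Nk; rewrite -(subrK (u N) (u n)) -addrA.
  apply: le_lt_trans (inner_sqD_le _ _) _.
  rewrite -(opprB (u k)) innerNl innerNr opprK !sqB//.
  have := HN _ Nn; have := HN _ Nk; lra.
(* Each coefficient of [u n] is eventually constant in [n], and Cauchy-Schwarz carries its value to
   the limit [v]. *)
have cf a y : (exists N, forall n, (N <= n)%N -> dot (u n) (e a) = y) -> dot v (e a) = y.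
  move=> [N HN]; apply/eqP; rewrite -subr_eq0 -sqrf_eq0 eq_le sqr_ge0 andbT.
  apply/ler_addgt0Pr => eps eps0; rewrite add0r.
  have [N' HN'] := uv _ eps0; apply: ltW; apply: le_lt_trans (HN' (maxn N N') _).
    rewrite -(HN (maxn N N')) ?leq_maxl// -sqrrN opprB -innerBl.
    by apply: le_trans (inner_CauchySchwarz _ _) _; rewrite e_orth eqxx mulr1.
  exact: leq_maxr.
exists v; split.
- apply: cspan_closed => // eps eps0; have [N HN] := uv _ eps0.
  exists (u N); first by apply: cspan_sum => // i; exact/cspanZ/cspan_basis.
  by rewrite -(opprB (u N)) innerNl innerNr opprK HN.
- move=> k; apply: cf; exists k.+1 => n kn.
  rewrite inner_suml (bigD1 (Ordinal kn))//= dotZl e_orth eqxx mulr1.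
  rewrite big1 ?addr0// => i ik; rewrite dotZl e_orth (inj_eq s_inj).
  by move: ik; rewrite -val_eqE/= => /negbTE ->; rewrite mulr0.
- move=> a Ha; apply: cf; exists 0%N => n _; rewrite inner_suml big1// => i _.
  by rewrite dotZl e_orth eq_sym (negbTE (Ha _)) mulr0.
Qed.

(** The Fourier coefficients of [v] are square summable, hence by completeness those of some [w] in
    the closed span; totality makes [v - w] null. *)
Lemma total_cspan (e : nat -> V) : sq_complete ->
  (forall j k, dot (e j) (e k) = (j == k)%:R) ->
  (forall v, (forall k, dot v (e k) = 0) -> dot v v = 0) ->
  forall v, cspan e v.
Proof.
move=> cpl e_orth tot v.
have bd N : \sum_(k < N) dot v (e k) ^+ 2 <= dot v v.
  have := bessel e_orth [fset nat_of_ord i | i in 'I_N]%fset v.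
  by rewrite big_imfset//=; [rewrite big_enum|move=> i j _ _ /ord_inj].
have [w [cw wE _]] := summable_coefs (x := fun k => dot v (e k)) cpl e_orth (@inj_id nat) bd.
apply: cspan_closed => // eps eps0; exists w => //.
by rewrite tot// => k; rewrite innerBl wE subrr.
Qed.

End SemiInnerTheory.

(** If [J0] comes within [eps] of the supremum of all finite sums, nothing disjoint from it can add
    [eps]. *)
Lemma bounded_nneg_tail_fset (R : realType) (I : choiceType) (x : I -> R) (M eps : R) :
  (forall i, 0 <= x i) -> (forall J : {fset I}, \sum_(i <- J) x i <= M) -> 0 < eps ->
  exists J0 : {fset I}, forall J : {fset I},
    (forall i, i \in J -> i \notin J0) -> \sum_(i <- J) x i < eps.
Proof.
move=> x0 xM eps0; set S := [set y | exists J : {fset I}, y = \sum_(i <- J) x i].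
have Ssup : has_sup S.
  by split; [exists (\sum_(i <- fset0) x i), fset0|exists M => _ [N ->]].
have [_ [J0 ->] HJ] := @sup_adherent _ S _ eps0 Ssup.
exists J0 => J JJ0; have : \sum_(i <- (J0 `|` J)%fset) x i <= sup S.
  by apply: (sup_upper_bound Ssup); exists (J0 `|` J)%fset.
rewrite (big_fsetID _ (mem J0))/=.
rewrite (_ : [fset i | i in (J0 `|` J)%fset & i \in J0]%fset = J0); last first.
  by apply/fsetP => i; rewrite !inE/=; case: (i \in J0); rewrite /= ?andbF.
rewrite (_ : [fset i | i in (J0 `|` J)%fset & i \notin J0]%fset = J).
  by move: HJ; lra.
apply/fsetP => i; rewrite !inE/=; apply/idP/idP => [|iJ].
  by case/andP => /orP[->|].
by rewrite iJ orbT JJ0.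
Qed.

(** * Square integrable functions *)

#[local] Existing Instance summability.totally_filter.

Section L2Theory.
Context {d : measure_display} {S : measurableType d} {R : realType}.
Variable mu : {measure set S -> \bar R}.

Lemma L2_measurable (f : S -> R) : f \in Lfun mu 2%:E -> measurable_fun setT f.
Proof. by rewrite inE => /andP[]; rewrite inE. Qed.

Lemma Lfun2P (f : S -> R) : f \in Lfun mu 2%:E <->
  measurable_fun setT f /\ (\int[mu]_x (f x ^+ 2)%:E < +oo)%E.
Proof.
have abs2 : (\int[mu]_x (`|(f x)%:E| `^ 2) = \int[mu]_x (f x ^+ 2)%:E)%E.
  apply: eq_integral => x _; rewrite /= powR_mulrn// -normrX.
  by rewrite ger0_norm ?sqr_ge0.
split=> [fL|[mf foo]].
  split; first exact: L2_measurable.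
  move/integrableP : (Lfun2_integrable_sqr fL) => [_].
  apply: le_lt_trans; apply: ge0_le_integral => //.
  - by move=> x _; rewrite lee_fin sqr_ge0.
  - by apply/measurable_EFinP/measurable_funX/L2_measurable.
  - do 2 apply: measurableT_comp => //.
    exact/measurable_funX/L2_measurable.
  - by move=> x _; exact: lee_abs.
rewrite inE; apply/andP; split; rewrite inE//= /finite_norm unlock/=.
by rewrite poweR_lty// abs2.
Qed.

Lemma dotL2_integrable (f g : S -> R) :
  f \in Lfun mu 2%:E -> g \in Lfun mu 2%:E ->
  mu.-integrable setT (fun x => (f x * g x)%:E).
Proof. by move=> fL gL; have /Lfun1_integrable := Lfun2_mul_Lfun1 fL gL. Qed.

Lemma dotL2_sqE (f : S -> R) : f \in Lfun mu 2%:E ->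
  ((dotL2 mu f f)%:E = \int[mu]_x (f x ^+ 2)%:E)%E.
Proof.
move=> fL; rewrite /dotL2 /Rintegral fineK; last first.
  exact/integrable_fin_num/dotL2_integrable.
by apply: eq_integral => x _; rewrite expr2.
Qed.

Lemma dotL2_semi_inner : semi_inner (fun f g : L2 mu => dotL2 mu f g).
Proof.
split=> [f g|f g h|a f g|f].
- by rewrite /dotL2; congr fine; apply: eq_integral => x _; rewrite mulrC.
- rewrite /dotL2 -RintegralD//; try exact/dotL2_integrable/LfunP/LfunP.
  by congr fine; apply: eq_integral => x _; rewrite -mulrDl.
- rewrite /dotL2 -RintegralZl//; try exact/dotL2_integrable/LfunP/LfunP.
  by congr fine; apply: eq_integral => x _; rewrite mulrA.
- by apply: Rintegral_ge0 => x _; rewrite -expr2 sqr_ge0.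
Qed.

Lemma normL2E (f : S -> R) : f \in Lfun mu 2%:E ->
  normL2 mu f = (Num.sqrt (dotL2 mu f f))%:E.
Proof.
move=> fL; rewrite /normL2 unlock/= poweR12_sqrt.
  rewrite (_ : (\int[mu]_x _)%E = (dotL2 mu f f)%:E)// dotL2_sqE//.
  apply: eq_integral => x _; rewrite /= powR_mulrn// -normrX.
  by rewrite ger0_norm ?sqr_ge0.
by apply: integral_ge0 => x _; rewrite lee_fin powR_ge0.
Qed.

Lemma dotL2_ae_eq (f f' g g' : S -> R) :
  measurable_fun setT f -> measurable_fun setT f' ->
  measurable_fun setT g -> measurable_fun setT g' ->
  f = f' %[ae mu] -> g = g' %[ae mu] -> dotL2 mu f g = dotL2 mu f' g'.
Proof.
move=> mf mf' mg mg' ff' gg'; congr fine; apply: ae_eq_integral => //.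
- by apply/measurable_EFinP/measurable_funM.
- by apply/measurable_EFinP/measurable_funM.
- by apply: filterS2 ff' gg' => x /= + + _ => -> // ->.
Qed.

Lemma dotL2_eq0_ae (f : S -> R) : f \in Lfun mu 2%:E -> dotL2 mu f f = 0 ->
  f = cst 0 %[ae mu].
Proof.
move=> fL f0; have mf := L2_measurable fL.
have : (\int[mu]_x `|(f x ^+ 2)%:E| = 0)%E.
  have <- : (dotL2 mu f f)%:E = 0%E by rewrite f0.
  rewrite dotL2_sqE//; apply: eq_integral => x _.
  by rewrite gee0_abs// lee_fin sqr_ge0.
move/ae_eq_integral_abs => /(_ measurableT).
case=> [|N [mN N0 NH]]; first by apply/measurable_EFinP/measurable_funX.
exists N; split=> // x /= fx; apply: NH => /= h; apply: fx => _.
by have /eqP := h I; rewrite eqe sqrf_eq0 => /eqP.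
Qed.

Lemma Lfun2_ae_eq (f g : S -> R) : measurable_fun setT g ->
  f \in Lfun mu 2%:E -> f = g %[ae mu] -> g \in Lfun mu 2%:E.
Proof.
move=> mg /Lfun2P[mf foo] fg; apply/Lfun2P; split=> //.
suff <- : (\int[mu]_x (f x ^+ 2)%:E = \int[mu]_x (g x ^+ 2)%:E)%E by [].
apply: ae_eq_integral => //; try exact/measurable_EFinP/measurable_funX.
by apply: filterS fg => x /= + _ => ->.
Qed.

Lemma sum_L2E I (r : seq I) (F : I -> L2 mu) (x : S) :
  (\sum_(i <- r) F i : L2 mu) x = \sum_(i <- r) F i x.
Proof. by elim/big_ind2 : _ => // f a g b /= <- <-. Qed.

Lemma sumL2P (I : choiceType) (F : I -> L2 mu) (s : S -> R)
    (sL : s \in Lfun mu 2%:E) : sumL2 mu (fun i => F i : S -> R) s <->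
  forall eps, 0 < eps -> exists J0 : {fset I}, forall J : {fset I},
    (J0 `<=` J)%fset ->
    let D := \sum_(i <- J) F i - Lfun_Sub (lee1n 2) sL in dotL2 mu D D < eps.
Proof.
have nE (J : {fset I}) : normL2 mu (fun x => \sum_(i <- J) F i x - s x) =
    (Num.sqrt (let D := \sum_(i <- J) F i - Lfun_Sub (lee1n 2) sL in dotL2 mu D D))%:E.
  rewrite -(normL2E (LfunP (\sum_(i <- J) F i - Lfun_Sub (lee1n 2) sL))).
  by congr normL2; apply/funext => x; rewrite -sum_L2E.
split=> [[_ /fine_cvgP[_ cv]] eps eps0|H].
  have /cvgrPdist_lt/(_ (Num.sqrt eps)) := cv; rewrite sqrtr_gt0 => /(_ eps0).
  move=> [J0 _ HJ0]; exists J0 => J J0J; have /= := HJ0 J J0J.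
  by rewrite nE/= sub0r normrN ger0_norm ?sqrtr_ge0// ltr_sqrt.
split=> //; suff cv : (fun J : {fset I} => (Num.sqrt (let D :=
    \sum_(i <- J) F i - Lfun_Sub (lee1n 2) sL in dotL2 mu D D))%:E)
    @ @summability.totally I --> 0%E by move: cv; rewrite -(funext nE).
apply: cvg_EFin; first by near=> J.
apply/cvgrPdist_lt => eps eps0.
have [J0 HJ0] := H (eps ^+ 2) (exprn_gt0 2 eps0).
exists J0 => // J J0J; have /= := HJ0 J J0J.
rewrite sub0r normrN ger0_norm ?sqrtr_ge0// => h.
by rewrite -(ger0_norm (ltW eps0)) -sqrtr_sqr ltr_sqrt// exprn_gt0.
Unshelve. all: by end_near. Qed.

(** The sum of the [g n] has finite integral by monotone convergence, so it is finite almost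
    everywhere. *)
Lemma ae_summable (g : nat -> S -> R) :
  (forall n, measurable_fun setT (g n)) -> (forall n x, 0 <= g n x) ->
  (\sum_(0 <= n <oo) \int[mu]_x (g n x)%:E < +oo)%E ->
  {ae mu, forall x, cvgn (series (g^~ x))}.
Proof.
move=> mg g0; rewrite -integral_nneseries//; last 2 first.
- by move=> n; apply/measurable_EFinP.
- by move=> n x _; rewrite lee_fin.
move=> goo.
have mG : measurable_fun setT (fun x => \sum_(0 <= n <oo) (g n x)%:E)%E.
  apply: ge0_emeasurable_sum => [n x _ _|n _]; first by rewrite lee_fin.
  exact/measurable_EFinP.
have iG : mu.-integrable setT (fun x => \sum_(0 <= n <oo) (g n x)%:E)%E.
  apply/integrableP; split=> //; rewrite (eq_integral (fun x => \sum_(0 <= n <oo) (g n x)%:E)%E)//.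
  by move=> x _; rewrite gee0_abs// nneseries_ge0// => n _ _; rewrite lee_fin.
apply: filterS (integrable_ae measurableT iG) => x /= /(_ I) fin.
apply: nondecreasing_is_cvgn.
  by apply/nondecreasing_seqP => n; rewrite !seriesEnat/= big_nat_recr//= lerDl.
exists (fine (\sum_(0 <= n <oo) (g n x)%:E)%E) => _ [n _ <-].
rewrite -lee_fin fineK// seriesEnat/= -sumEFin.
by apply: nneseries_lim_ge => k _ _; rewrite lee_fin.
Qed.

End L2Theory.

(** A total substitute for the limit, measurable in parameters and equal to the limit wherever that
    exists; [fine] sends an infinite value to 0. *)
Definition limsupR (R : realType) (u : nat -> R) : R := fine (limn_esup (EFin \o u)).

Lemma cvg_real_EFin (R : realType) I (F : set_system I) {FF : Filter F}
  (u : I -> R) (l : R) : u @ F --> l -> (fun n => (u n)%:E) @ F --> l%:E.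
Proof. by move=> ul; apply: cvg_EFin => //; exact: nearW. Qed.

Lemma cvg_limsupR (R : realType) (u : nat -> R) (l : R) :
  u @ \oo --> l -> limsupR u = l.
Proof. by move=> /cvg_real_EFin/cvg_limn_einf_sup[_ ul]; rewrite /limsupR ul. Qed.

Lemma measurable_limsupR d (S : measurableType d) (R : realType) (v : nat -> S -> R) :
  (forall n, measurable_fun setT (v n)) ->
  measurable_fun setT (fun x => limsupR (v ^~ x)).
Proof.
move=> mv; apply: (@measurableT_comp _ _ _ _ _ _ (@fine R)) => //.
by apply: measurable_fun_limn_esup => n; apply/measurable_EFinP.
Qed.

Lemma measurable_limn_einf d (S : measurableType d) (R : realType)
    (v : nat -> S -> \bar R) : (forall n, measurable_fun setT (v n)) ->
  measurable_fun setT (fun x => limn_einf (v ^~ x)).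
Proof.
move=> mv; rewrite (_ : (fun x => _) = -%E \o (fun x => limn_esup (fun n => - v n x)%E)).
  apply: measurableT_comp => //; apply: measurable_fun_limn_esup => n.
  exact: measurableT_comp.
apply/funext => x /=; rewrite -limn_einfN; congr limn_einf.
by apply/funext => n /=; rewrite oppeK.
Qed.

Lemma limn_einf_le (R : realType) (u : nat -> \bar R) (l : \bar R) :
  (forall n, u n <= l)%E -> (limn_einf u <= l)%E.
Proof.
move=> ul; rewrite limn_einf_lim; apply: lime_le; first exact: is_cvg_einfs.
apply: nearW => n; apply: le_trans (ul n); apply: ereal_inf_lbound.
by exists n => /=.
Qed.

(** * Completeness of the space of square integrable functions *)

Section RieszFischer.
Context {d : measure_display} {S : measurableType d} {R : realType}.
Variable mu : {measure set S -> \bar R}.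

(** The rate [8^-1 ^+ n] leaves room for a weight [2 ^+ n]: the weighted squares still have
    integrals dominated by a geometric series of ratio 1/4, and [|t| <= 2^-n + 2^n * t^2] turns
    their almost everywhere summability into absolute summability of the increments. *)
Lemma fast_cauchy_ae_cvg (v : nat -> L2 mu) :
  (forall n, dotL2 mu (v n.+1 - v n) (v n.+1 - v n) <= 8^-1 ^+ n) ->
  {ae mu, forall x, cvgn (v ^~ x)}.
Proof.
move=> vH; pose g n x := 2 ^+ n * (v n.+1 x - v n x) ^+ 2 : R.
have mv n : measurable_fun setT (v n) by exact/L2_measurable/LfunP.
have mg n : measurable_fun setT (g n).
  by apply: measurable_funM => //; apply/measurable_funX/measurable_funB.
have g0 n x : 0 <= g n x by apply: mulr_ge0; [exact: exprn_ge0|exact: sqr_ge0].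
have : {ae mu, forall x, cvgn (series (g^~ x))}.
  apply: ae_summable => //.
  apply: (@le_lt_trans _ _ (\sum_(0 <= n <oo) (geometric 1 4^-1 n)%:E)%E); last first.
    have : `|4^-1 : R| < 1 by rewrite ger0_norm ?invr_ge0// invf_lt1// ltr1n.
    move=> /(@cvg_geometric_series R 1)/cvg_real_EFin/cvg_lim geo.
    rewrite (_ : (\sum_(0 <= n <oo) _)%E = (1 / (1 - 4^-1))%:E) ?ltry//.
    by rewrite -geo//; congr (lim (_ @ \oo)); apply/funext => n; rewrite sumEFin.
  apply: lee_nneseries => [n _ _|n _].
    by apply: integral_ge0 => x _; rewrite lee_fin.
  under eq_integral do rewrite EFinM.
  rewrite ge0_integralZl_EFin ?exprn_ge0//; last first.
  - by apply/measurable_EFinP/measurable_funX/measurable_funB.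
  - by move=> x _; rewrite lee_fin sqr_ge0.
  have := dotL2_sqE (LfunP (v n.+1 - v n)) => /= <-.
  rewrite -EFinM lee_fin/= mul1r.
  have -> : 4^-1 ^+ n = 2 ^+ n * 8^-1 ^+ n :> R.
    by rewrite -exprMn; congr (_ ^+ _); field.
  by apply: ler_wpM2l; [exact: exprn_ge0|exact: vH].
apply: filterS => x gx.
have dx : cvgn (series (fun n => v n.+1 x - v n x)).
  apply: normed_cvg; apply: (@series_le_cvg _ _ (fun n => geometric 1 2^-1 n + g n x)).
  - by move=> n /=.
  - by move=> n; rewrite addr_ge0//= mul1r exprn_ge0// invr_ge0.
  - move=> n /=; rewrite mul1r /g; set t := v n.+1 x - v n x.
    have p0 : 0 < 2 ^+ n :> R by rewrite exprn_gt0.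
    rewrite exprVn -(normr_id t) -(real_normK (num_real t)).
    move: (normr_ge0 t); move: `|t| => y y0; rewrite ger0_norm//.
    rewrite -(ler_pM2r p0) mulrDl mulVf ?gt_eqF//.
    have := sqr_ge0 (2 ^+ n * y - 1); have := sqr_ge0 (2 ^+ n * y); nra.
  - rewrite (_ : series _ = series (geometric 1 2^-1) + series (g^~ x)).
      apply: is_cvgD => //; apply: is_cvg_geometric_series.
      by rewrite ger0_norm ?invr_ge0// invf_lt1// ltr1n.
    by apply/funext => n; rewrite /series/= big_split.
rewrite (_ : v ^~ x = (fun n => v 0%N x + series (fun n => v n.+1 x - v n x) n)).
  by apply: is_cvgD => //; exact: is_cvg_cst.
by apply/funext => n; rewrite seriesEnat/= telescope_sumr// addrC subrK.
Unshelve. all: by end_near. Qed.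

Lemma L2_complete : sq_complete (fun f g : L2 mu => dotL2 mu f g).
Proof.
move=> u uC.
have /choice[phi phiP] (j : nat) : exists N : nat, forall n k,
    (N <= n)%N -> (N <= k)%N -> dotL2 mu (u n - u k) (u n - u k) < 8^-1 ^+ j.
  by apply: uC; rewrite exprn_gt0.
(* Summing makes [psi j] dominate every [phi i] with [i <= j], and the successors make it dominate
   [j] as well. *)
pose psi j := (\sum_(i < j.+1) (phi i).+1)%N.
have psi_ge j i : (i <= j)%N -> (phi i <= psi j)%N.
  by move=> ij; rewrite /psi (bigD1 (Ordinal (ij : (i < j.+1)%N)))//= (leq_trans (leqnSn _))// leq_addr.
have psi_id j : (j <= psi j)%N.
  rewrite /psi; elim: j => // j IH; rewrite big_ord_recr/= addnS ltnS.
  exact: leq_trans IH (leq_addr _ _).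
pose v j := u (psi j).
have mv n : measurable_fun setT (v n) by exact/L2_measurable/LfunP.
have mu_ n : measurable_fun setT (u n) by exact/L2_measurable/LfunP.
have vcv : {ae mu, forall x, cvgn (v ^~ x)}.
  by apply: fast_cauchy_ae_cvg => n; apply/ltW/phiP; exact: psi_ge.
pose f x := limsupR (v ^~ x).
have mf : measurable_fun setT f by exact: measurable_limsupR.
(* Fatou's lemma along the almost everywhere convergent subsequence bounds the distance from [u k]
   to [f]. *)
have fatou_le k eps : (forall j, (k <= j)%N -> dotL2 mu (u k - v j) (u k - v j) <= eps) ->
    (\int[mu]_x ((u k x - f x) ^+ 2)%:E <= eps%:E)%E.
  move=> H; pose h j x := ((u k x - v (j + k)%N x) ^+ 2)%:E.
  have mh j : measurable_fun setT (h j).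
    exact/measurable_EFinP/measurable_funX/measurable_funB.
  have -> : (\int[mu]_x ((u k x - f x) ^+ 2)%:E = \int[mu]_x limn_einf (h^~ x))%E.
    apply: ae_eq_integral => //.
    - exact/measurable_EFinP/measurable_funX/measurable_funB.
    - exact: measurable_limn_einf.
    apply: filterS vcv => x /= vx _; apply/esym.
    have vf : v ^~ x @ \oo --> f x by rewrite /f (cvg_limsupR vx).
    apply: (cvg_limn_einf_sup _).1; apply: cvg_real_EFin.
    under eq_fun do rewrite expr2.
    rewrite expr2; have w : u k x - v (j + k)%N x @[j --> \oo] --> u k x - f x.
      by apply: cvgB; [exact: cvg_cst|rewrite (cvg_shiftn k (v^~ x))].
    exact: cvgM.
  apply: le_trans (fatou _ _ _ _) _ => //.
    by move=> n x _; rewrite lee_fin sqr_ge0.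
  apply: limn_einf_le => n.
  by have := H (n + k)%N (leq_addl _ _); rewrite -lee_fin (dotL2_sqE (LfunP _)).
have fL : f \in Lfun mu 2%:E.
  have [N HN] := uC 1 ltr01; have kL : (fun x => u N x - f x) \in Lfun mu 2%:E.
    apply/Lfun2P; split; first exact: measurable_funB.
    apply: le_lt_trans (fatou_le N 1 _) (ltry _) => j Nj; apply/ltW/HN => //.
    exact: leq_trans Nj (psi_id j).
  have -> : f = (u N - Lfun_Sub (lee1n 2) kL : L2 mu) :> (S -> R).
    by apply/funext => x /=; rewrite opprB addrC subrK.
  exact: LfunP.
exists (Lfun_Sub (lee1n 2) fL) => eps eps0.
have [N HN] := uC (eps / 2) (divr_gt0 eps0 (ltr0n _ 2)).
exists N => n Nn; apply: (@le_lt_trans _ _ (eps / 2)); last by lra.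
rewrite -lee_fin (dotL2_sqE (LfunP _)).
apply: fatou_le => j nj; apply/ltW/HN => //.
exact: leq_trans Nn (leq_trans nj (psi_id j)).
Unshelve. all: by end_near. Qed.
End RieszFischer.

(** * Gaussian polynomial moments *)

Section HermitePolynomials.
Context {R : realType}.

Fixpoint hermite_poly (n : nat) : {poly R} :=
  if n is n'.+1 then 'X * hermite_poly n' - (hermite_poly n')^`() else 1.

Lemma hermiteE (n : nat) (t : R) : hermite n t = (hermite_poly n).[t].
Proof.
pose g := fun s : R => expR (- s ^+ 2 / 2).
have dn k : derive1n k g = fun s => (-1) ^+ k * (hermite_poly k).[s] * g s.
  elim: k => [|k IH]; first by apply/funext => s; rewrite expr0 hornerC !mul1r.
  rewrite derive1nS IH; apply/funext => s; rewrite derive1E; apply: derive_val.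
  pose dp := is_derive_poly (hermite_poly k) s.
  apply: is_derive_eq.
  rewrite /= !hornerE /= /GRing.scale/= [(-1) ^+ k.+1]exprS /g.
  by move: (expR _) => E; field.
rewrite /hermite dn /g.
have -> : forall x y z w : R, x * y * (x * z * w) = (x ^+ 2) * (y * w) * z.
  by move=> *; ring.
by rewrite -exprM mulnC exprM sqrrN !expr1n -expRD -mulrDl subrr mul0r expR0 !mul1r.
Qed.

(** [(gauss_moment n).[y]] is the expectation of [(N + y) ^+ n] for [N] standard Gaussian. The
    recursion is Gaussian integration by parts, the derivative in [y] standing for the expectation
    of the derivative. *)
Fixpoint gauss_moment (n : nat) : {poly R} :=
  if n is n'.+1 then (gauss_moment n')^`() + 'X * gauss_moment n' else 1.

(* [(gauss_shift p).[y]] is the expectation of [p.[N + y]] for [N] standard Gaussian. *)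
Definition gauss_shift (p : {poly R}) : {poly R} :=
  \sum_(i < size p) p`_i *: gauss_moment i.

Lemma gauss_shift_widen (p : {poly R}) n : (size p <= n)%N ->
  gauss_shift p = \sum_(i < n) p`_i *: gauss_moment i.
Proof.
move=> pn; rewrite /gauss_shift (big_ord_widen _ (fun i => p`_i *: gauss_moment i) pn).
rewrite big_mkcond/=; apply: eq_bigr => i _; case: ltnP => // ip.
by rewrite nth_default// scale0r.
Qed.

Lemma gauss_shiftD p q : gauss_shift (p + q) = gauss_shift p + gauss_shift q.
Proof.
have pn := leq_maxl (size p) (size q); have qn := leq_maxr (size p) (size q).
rewrite (gauss_shift_widen (size_polyD p q)) (gauss_shift_widen pn).
rewrite (gauss_shift_widen qn) -big_split/=.
by apply: eq_bigr => i _; rewrite coefD scalerDl.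
Qed.

Lemma gauss_shiftZ a p : gauss_shift (a *: p) = a *: gauss_shift p.
Proof.
rewrite (gauss_shift_widen (size_scale_leq a p)) /gauss_shift scaler_sumr.
by apply: eq_bigr => i _; rewrite coefZ scalerA.
Qed.

Lemma gauss_shiftC c : gauss_shift c%:P = c%:P.
Proof.
rewrite (gauss_shift_widen (size_polyC_leq1 c)) big_ord1 coefC/=.
by rewrite -mul_polyC mulr1.
Qed.

Lemma gauss_shiftB p q : gauss_shift (p - q) = gauss_shift p - gauss_shift q.
Proof. by rewrite -scaleN1r gauss_shiftD gauss_shiftZ scaleN1r. Qed.

Lemma gauss_shiftXM p :
  gauss_shift ('X * p) = (gauss_shift p)^`() + 'X * gauss_shift p.
Proof.
have Xp : (size ('X * p)%R <= (size p).+1)%N.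
  by rewrite (leq_trans (size_polyMleq _ _))// size_polyX.
rewrite (gauss_shift_widen Xp) big_ord_recl coefXM/= scale0r add0r /gauss_shift.
rewrite raddf_sum/= mulr_sumr -big_split/=; apply: eq_bigr => i _.
by rewrite coefXM/= derivZ scalerDr scalerAr.
Qed.

Lemma gauss_shift_deriv p : gauss_shift p^`() = (gauss_shift p)^`().
Proof.
elim/poly_ind: p => [|p c IH]; first by rewrite derivC !gauss_shiftC derivC.
rewrite mulrC derivD derivC addr0 derivM derivX mul1r !gauss_shiftD !gauss_shiftXM IH.
rewrite gauss_shiftC !derivD derivC addr0 derivM derivX mul1r addrCA.
by rewrite addrC -!addrA; congr (_ + _); rewrite addrC.
Qed.

(** Under [gauss_shift], multiplication by ['X] acquires an extra derivative, and the Hermite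
    recursion subtracts exactly that one. *)
Lemma gauss_shift_hermite n : gauss_shift (hermite_poly n) = 'X^n.
Proof.
elim: n => [|n IH] /=; first by rewrite gauss_shiftC.
by rewrite gauss_shiftB gauss_shiftXM gauss_shift_deriv IH addrAC subrr add0r exprS.
Qed.

Lemma deriv_hermite n : (hermite_poly n.+1)^`() = n.+1%:R *: hermite_poly n.
Proof.
elim: n => [|n IH]; first by rewrite /= derivB derivM derivX !derivC mulr0 subr0 mulr1 addr0 scale1r.
have -> : hermite_poly n.+2 = 'X * hermite_poly n.+1 - (hermite_poly n.+1)^`() by [].
rewrite IH derivB derivM derivX mul1r derivZ IH -scalerAr -addrA -scalerBr.
by rewrite -[X in _ *: X]/(hermite_poly n.+1) -[n.+2]add1n natrD scalerDl scale1r.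
Qed.

Lemma hermite_orthogonal n k :
  (gauss_shift (hermite_poly n * hermite_poly k)).[0] = (n == k)%:R * n`!%:R.
Proof.
(* Integration by parts at [y = 0]: one degree of the Hermite polynomial is traded for a derivative
   of [q]. *)
have S q j : (gauss_shift (hermite_poly j.+1 * q)).[0] =
    (gauss_shift (hermite_poly j * q^`())).[0].
  rewrite /= mulrBl gauss_shiftB -mulrA gauss_shiftXM -gauss_shift_deriv derivM gauss_shiftD.
  rewrite !hornerE/=; ring.
elim: n k => [|n IH] k.
  by rewrite /= mul1r gauss_shift_hermite hornerXn expr0n eq_sym mulr1.
case: k => [|k]; first by rewrite S /= derivC mulr0 gauss_shiftC hornerC mul0r.
rewrite S deriv_hermite -scalerAr gauss_shiftZ hornerZ IH eqSS factS natrM.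
by case: eqVneq => [->|_]; rewrite ?mul0r ?mulr0// !mul1r.
Qed.

End HermitePolynomials.

Lemma ge0_integral_normal_prob (R : realType) (m s : R) (f : R -> \bar R) :
  measurable_fun setT f -> (forall x, (0 <= f x)%E) ->
  (\int[normal_prob m s]_x f x =
   \int[@lebesgue_measure R]_x (f x * (normal_pdf m s x)%:E))%E.
Proof.
move=> mf f0; have dom := @normal_prob_dominates R m s.
rewrite -(Radon_Nikodym_SigmaFinite.change_of_variables dom)//.
apply: ae_eq_integral => //.
- apply: emeasurable_funM => //; apply: (measurable_int (@lebesgue_measure R)).
  exact: Radon_Nikodym_SigmaFinite.f_integrable.
- apply: emeasurable_funM => //; apply/measurable_EFinP.
  exact: measurable_normal_pdf.
- apply: ae_eqe_mul2l; apply: integral_ae_eq => //.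
  + exact: Radon_Nikodym_SigmaFinite.f_integrable.
  + by apply/measurable_EFinP; exact: measurable_normal_pdf.
  + by move=> E _ mE; rewrite -Radon_Nikodym_SigmaFinite.f_integral.
Qed.

Lemma normal_prob_mgf (R : realType) (s z : R) : 0 < s ->
  (\int[normal_prob 0 s]_x (expR (z * x))%:E = (expR (z ^+ 2 * s ^+ 2 / 2))%:E)%E.
Proof.
move=> s0; have s1 : s != 0 by rewrite gt_eqF.
rewrite ge0_integral_normal_prob; last 2 first.
- by apply/measurable_EFinP; apply: measurableT_comp => //; apply: measurable_funM.
- by move=> x; rewrite lee_fin expR_ge0.
(* Completing the square: tilting the density by [expR (z * x)] moves its mean to [z * s ^+ 2], up
   to the constant in front. *)
transitivity (\int[@lebesgue_measure R]_x
    ((expR (z ^+ 2 * s ^+ 2 / 2))%:E * (normal_pdf (z * s ^+ 2) s x)%:E))%E.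
  apply: eq_integral => x _; rewrite -!EFinM !normal_pdfE// /normal_fun.
  congr EFin; rewrite mulrCA [RHS]mulrCA -!expRD; congr (_ * expR _); field.
  by rewrite s1.
rewrite ge0_integralZl_EFin//.
- by rewrite integral_normal_pdf mule1.
- by move=> x _; rewrite lee_fin normal_pdf_ge0.
- by apply/measurable_EFinP; exact: measurable_normal_pdf.
Qed.

(** One formula covers the degenerate case as well, with [s = 0]. For the noise, [s ^+ 2] is
    identified as a square norm in [noise_mgf]. *)
Lemma centered_gaussian_mgf (R : realType) d (Omega : measurableType d)
    (P : probability Omega R) (Y : {RV P >-> R}) : centered_gaussian Y ->
  exists2 s, 0 <= s & forall z,
    (\int[P]_w (expR (z * Y w))%:E = (expR (z ^+ 2 * s ^+ 2 / 2))%:E)%E.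
Proof.
case=> [Y0|[s s0 Ys]].
  exists 0 => // z; rewrite expr0n mulr0 mul0r expR0.
  transitivity (\int[P]_w (cst 1%:E w))%E; last first.
    by rewrite integral_cst//= probability_setT mul1e.
  apply: ae_eq_integral => //.
    by apply/measurable_EFinP; apply: measurableT_comp => //; apply: measurable_funM.
  by apply: filterS Y0 => w /= + _ => ->//; rewrite mulr0 expR0.
exists s => [|z]; first exact: ltW.
rewrite -(normal_prob_mgf z s0).
have mY : @measurable_fun _ _ Omega (measurableTypeR R) setT Y.
  by move=> mD A mA; exact: (@measurable_funPT _ _ _ _ Y mD A mA).
rewrite -(@ge0_integral_pushforward _ _ _ (measurableTypeR R) R _ mY P setT
  (fun x => (expR (z * x))%:E))//.
- by apply: eq_measure_integral => A mA _; exact: Ys.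
- by apply/measurable_EFinP; apply: measurableT_comp => //; apply: measurable_funM.
Qed.

(** * White noise *)

Section WhiteNoise.
Context {R : realType} {d : measure_display} {Omega : measurableType d}.
Variable P : probability Omega R.
Context {dS : measure_display} {S : measurableType dS}.
Variable mu : {measure set S -> \bar R}.
Variable B : L2 mu -> {RV P >-> R}.
Hypothesis B_noise : white_noise B.

Lemma noise_measurable f : measurable_fun setT (B f).
Proof. exact: measurable_funPT. Qed.
Hint Resolve noise_measurable : core.

Lemma noise_linear (a b : R) f g :
  B (a *: f + b *: g) = (fun w => a * B f w + b * B g w) %[ae P].
Proof. by have [[_ + _] _] := B_noise; exact. Qed.

Lemma noise_L2 f : (B f : Omega -> R) \in Lfun P 2%:E.
Proof.
apply/Lfun2P; split => //; have [_ /(_ f f)] := B_noise.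
rewrite unlock /= => h.
by under eq_integral do rewrite expr2; rewrite h ltry.
Qed.

Lemma noise_dot f g : dotL2 P (B f) (B g) = dotL2 mu f g.
Proof. by have [_ /(_ f g)] := B_noise; rewrite unlock => h; rewrite /dotL2 /Rintegral h. Qed.

Definition noiseL2 f : L2 P := Lfun_Sub (lee1n 2) (noise_L2 f).

Lemma noise0 : B 0 = cst 0 %[ae P].
Proof.
have := noise_linear 0 0 0 0; rewrite !scale0r addr0.
by apply: filterS => w /= h _; rewrite h// !mul0r addr0.
Qed.

Lemma noiseD f g : B (f + g) = (fun w => B f w + B g w) %[ae P].
Proof.
have := noise_linear 1 1 f g; rewrite !scale1r.
by apply: filterS => w /= h _; rewrite h// !mul1r.
Qed.

Lemma noiseZ a f : B (a *: f) = (fun w => a * B f w) %[ae P].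
Proof.
have := noise_linear a 0 f 0; rewrite scale0r addr0.
by apply: filterS => w /= h _; rewrite h// mul0r addr0.
Qed.

Lemma noiseN f : B (- f) = (fun w => - B f w) %[ae P].
Proof.
have := noiseZ (-1) f; rewrite scaleN1r.
by apply: filterS => w /= h _; rewrite h// mulN1r.
Qed.

(* Closed under products, contains the polynomials in the noise and is
   contained in every [L^p]. *)
Definition exp_bounded (Y : Omega -> R) := measurable_fun setT Y /\
  exists s : seq (L2 mu), {ae P, forall w, `|Y w| <= \sum_(f <- s) expR (B f w)}.

Lemma noise_exp_lty f : (\int[P]_w (expR (B f w))%:E < +oo)%E.
Proof.
have [[/(_ f)/centered_gaussian_mgf[s _ /(_ 1) h] _ _] _] := B_noise.
by move: h; under eq_integral do rewrite mul1r; move=> ->; rewrite ltry.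
Qed.

Lemma measurable_expR_noise f : measurable_fun setT (fun w => expR (B f w)).
Proof. exact: measurableT_comp. Qed.
Hint Resolve measurable_expR_noise : core.

Lemma exp_bounded_integrable (Y : Omega -> R) : exp_bounded Y -> P.-integrable setT (fun w => (Y w)%:E).
Proof.
move=> [mY [s Ys]]; apply/integrableP; split; first exact/measurable_EFinP.
suff h : (\int[P]_w `|(Y w)%:E| <= \int[P]_w \sum_(f <- s) (expR (B f w))%:E)%E.
  apply: le_lt_trans h _; rewrite ge0_integral_sum//.
  - by apply: lte_sum_pinfty => f _; exact: noise_exp_lty.
  - by move=> f; apply/measurable_EFinP.
apply: ae_ge0_le_integral => //.
- by apply: measurableT_comp => //; apply/measurable_EFinP.
- by move=> w _; apply: sume_ge0 => f _; rewrite lee_fin expR_ge0.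
- by apply: emeasurable_sum => f; apply/measurable_EFinP.
- by apply: filterS Ys => w /= h _; rewrite sumEFin lee_fin.
Qed.

Lemma exp_bounded_le (Y Z : Omega -> R) : measurable_fun setT Y -> exp_bounded Z ->
  {ae P, forall w, `|Y w| <= `|Z w|} -> exp_bounded Y.
Proof.
move=> mY [_ [s sZ]] YZ; split=> //; exists s.
by apply: filterS2 YZ sZ => w; exact: le_trans.
Qed.

Lemma exp_bounded_exp f : exp_bounded (fun w => expR (B f w)).
Proof.
split=> //; exists [:: f]; apply: filterS (ae_eq_refl P setT (fun=> 0 : R)) => w _.
by rewrite big_seq1 ger0_norm ?expR_ge0.
Qed.

Lemma exp_boundedD (Y Z : Omega -> R) : exp_bounded Y -> exp_bounded Z ->
  exp_bounded (fun w => Y w + Z w).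
Proof.
move=> [mY [s sY]] [mZ [r rZ]]; split; first exact: measurable_funD.
exists (s ++ r); apply: filterS2 sY rZ => w sY rZ.
by rewrite big_cat/=; apply: le_trans (ler_normD _ _) (lerD _ _).
Qed.

(** Additivity of the noise turns a product of two exponentials into the exponential of [B (f + g)],
    so the bound remains a finite sum of the same shape. *)
Lemma exp_boundedM (Y Z : Omega -> R) : exp_bounded Y -> exp_bounded Z ->
  exp_bounded (fun w => Y w * Z w).
Proof.
move=> [mY [s sY]] [mZ [r rZ]]; split; first exact: measurable_funM.
exists [seq f + g | f <- s, g <- r].
have aeD : {ae P, forall w, \sum_(h <- [seq f + g | f <- s, g <- r]) expR (B h w) =
    \sum_(f <- s) \sum_(g <- r) expR (B f w) * expR (B g w)}.
  elim: s {sY} => [|f s IH].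
    by apply: filterS (ae_eq_refl P setT (fun=> 0 : R)) => w _; rewrite /= !big_nil.
  have : {ae P, forall w, \sum_(h <- [seq f + g | g <- r]) expR (B h w) =
      \sum_(g <- r) expR (B f w) * expR (B g w)}.
    elim: r {rZ IH} => [|g r IH].
      by apply: filterS (ae_eq_refl P setT (fun=> 0 : R)) => w _; rewrite /= !big_nil.
    apply: filterS2 IH (noiseD f g) => w /= IH fg.
    by rewrite !big_cons IH fg// expRD.
  by apply: filterS2 IH => w IH h; rewrite /= big_cat big_cons/= IH h.
apply: filterS3 aeD sY rZ => w -> sY rZ; rewrite normrM.
apply: (le_trans (ler_pM _ _ sY rZ)) => //.
by rewrite mulr_suml; apply: ler_sum => f _; rewrite mulr_sumr.
Qed.

Lemma exp_bounded_cst (c : R) : exp_bounded (fun=> c).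
Proof.
(* [expR (B 0 w)] is 1 almost surely, so enough copies of it dominate the constant. *)
split => //; exists (nseq (Num.truncn `|c|).+1 0).
apply: filterS noise0 => w B0; rewrite big_nseq iter_addr addr0 B0//= expR0.
exact/ltW/truncnS_gt.
Qed.

Lemma exp_boundedZ (c : R) (Y : Omega -> R) : exp_bounded Y -> exp_bounded (fun w => c * Y w).
Proof. by move=> h; apply: exp_boundedM => //; exact: exp_bounded_cst. Qed.

Lemma exp_bounded_expabs f : exp_bounded (fun w => expR `|B f w|).
Proof.
apply: (@exp_bounded_le _ (fun w => expR (B f w) + expR (B (- f) w))).
- by apply: measurableT_comp => //; apply: measurableT_comp.
- by apply: exp_boundedD; exact: exp_bounded_exp.
- apply: filterS (noiseN f) => w /= BN; rewrite BN//; move: (B f w) => x.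
  rewrite [leLHS]ger0_norm ?expR_ge0// [leRHS]ger0_norm ?addr_ge0 ?expR_ge0//.
  by case: (ger0P x) => _; rewrite ?lerDl ?lerDr expR_ge0.
Qed.

Lemma exp_bounded_noise f : exp_bounded (B f).
Proof.
apply: (exp_bounded_le (noise_measurable f) (exp_bounded_expabs f)).
apply: filterS (ae_eq_refl P setT (fun=> 0 : R)) => w _.
by rewrite [leRHS]ger0_norm ?expR_ge0// (le_trans _ (expR_ge1Dx _))// lerDr.
Qed.

Lemma exp_boundedX (Y : Omega -> R) n : exp_bounded Y -> exp_bounded (fun w => Y w ^+ n).
Proof.
move=> hY; elim: n => [|n IH]; first exact: (exp_bounded_cst 1).
by under eq_fun do rewrite exprS; exact: exp_boundedM.
Qed.

Lemma exp_bounded_sum I (r : seq I) (F : I -> Omega -> R) :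
  (forall i, exp_bounded (F i)) -> exp_bounded (fun w => \sum_(i <- r) F i w).
Proof.
move=> hF; elim: r => [|i r IH].
  by under eq_fun do rewrite big_nil; exact: exp_bounded_cst.
by under eq_fun do rewrite big_cons; exact: exp_boundedD.
Qed.

Lemma exp_bounded_prod I (r : seq I) (F : I -> Omega -> R) :
  (forall i, exp_bounded (F i)) -> exp_bounded (fun w => \prod_(i <- r) F i w).
Proof.
move=> hF; elim: r => [|i r IH].
  by under eq_fun do rewrite big_nil; exact: exp_bounded_cst.
by under eq_fun do rewrite big_cons; exact: exp_boundedM.
Qed.

Lemma exp_bounded_horner (p : {poly R}) f : exp_bounded (fun w => p.[B f w]).
Proof.
under eq_fun do rewrite horner_coef; apply: exp_bounded_sum => i.
exact/exp_boundedZ/exp_boundedX/exp_bounded_noise.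
Qed.

Lemma exp_bounded_L2 (Y : Omega -> R) : exp_bounded Y -> Y \in Lfun P 2%:E.
Proof.
move=> hY; apply/Lfun2P; split; first by case: hY.
have /exp_bounded_integrable/integrableP[_] := exp_boundedX 2 hY.
suff -> : (\int[P]_w `|(Y w ^+ 2)%:E| = \int[P]_w (Y w ^+ 2)%:E)%E by [].
by apply: eq_integral => w _; rewrite gee0_abs// lee_fin sqr_ge0.
Qed.

End WhiteNoise.

(** * Differentiation under the Gaussian expectation *)

Section SmallLemmas.
Context {R : realType}.

(** The exponential growth of this remainder is harmless: it stays integrable for
    [x = z * B f w]. *)
Lemma expR_taylor1 (x : R) : `|expR x - 1 - x| <= x ^+ 2 * expR `|x|.
Proof.
have e1 := expR_ge1Dx x.
have e2 : expR x - 1 <= x * expR x.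
  have := expR_ge1Dx (- x); have p := expR_gt0 x; rewrite -(ler_pM2r p).
  by rewrite -expRD addNr expR0; lra.
rewrite ger0_norm; last by lra.
have q : expR x - 1 - x <= x * (expR x - 1) by lra.
apply: (le_trans q); have [x0|x0] := leP 0 x.
  by rewrite ger0_norm//; nra.
have : 1 <= expR `|x| by rewrite -expR0 ler_expR.
nra.
Qed.

Lemma is_derive0_unique (psi : R -> R) (D C psi' : R) :
  is_derive (0 : R) 1 psi psi' ->
  (forall z, `|z| <= 1 -> `|psi z - psi 0 - z * D| <= z ^+ 2 * C) -> D = psi'.
Proof.
move=> dpsi H; have [/= ex <-] := dpsi.
have C0 : 0 <= C.
  by have := H 1; rewrite normr1 expr1n !mul1r => /(_ (lexx _)); exact: le_trans.
apply/esym/cvg_lim => //; apply/cvgrPdist_lt => eps eps0.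
have d0 : 0 < Num.min 1 (eps / (C + 1)).
  by rewrite lt_min ltr01 divr_gt0// ltr_wpDl.
near=> z; rewrite /GRing.scale/= addr0 mulr1.
have z0 : z != 0 by near: z; exact: nbhs_dnbhs_neq.
have zd : `|z| < Num.min 1 (eps / (C + 1)).
  by near: z; apply: dnbhs0_lt.
have := H z; move: zd; rewrite lt_min => /andP[z1 zC] /(_ (ltW z1)).
have -> : psi z - psi 0 - z * D = - (z * (D - z^-1 * (psi z - psi 0))).
  by field.
rewrite normrN normrM -(real_normK (num_real z)) expr2 -mulrA ler_pM2l ?normr_gt0//.
move=> h; apply: le_lt_trans h _.
move: zC; rewrite ltr_pdivlMr ?ltr_wpDl// mulrDr mulr1 => h.
by apply: le_lt_trans h; rewrite lerDl.
Unshelve. all: by end_near. Qed.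

End SmallLemmas.

Section GaussianCalculus.
Context {R : realType} {d : measure_display} {Omega : measurableType d}.
Variable P : probability Omega R.
Context {dS : measure_display} {S : measurableType dS}.
Variable mu : {measure set S -> \bar R}.
Variable B : L2 mu -> {RV P >-> R}.
Hypothesis B_noise : white_noise B.
Let ebM := exp_boundedM B_noise.
Let ebI := exp_bounded_integrable B_noise.
Let sdmu := dotL2_semi_inner mu.

Lemma exp_bounded_expZ (z : R) f : exp_bounded B (fun w => expR (z * B f w)).
Proof.
apply: (exp_bounded_le _ (exp_bounded_exp B (z *: f))).
  by apply: measurableT_comp => //; apply: measurable_funM => //.
by apply: filterS (noiseZ B_noise z f) => w /= ->.
Qed.

(** For [|z| <= 1] the first order remainder is at most [z ^+ 2] times [M], which is integrable
    since [exp_bounded] is stable under products. *)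
Lemma noise_derivative (N : Omega -> R) f (psi : R -> R) (psi' : R) :
  exp_bounded B N -> (forall z, \int[P]_w (N w * expR (z * B f w)) = psi z) ->
  is_derive (0 : R) 1 psi psi' -> \int[P]_w (N w * B f w) = psi'.
Proof.
move=> hN Hpsi dpsi.
have hB := exp_bounded_noise B_noise f.
pose M w := `|N w| * (B f w ^+ 2 * expR `|B f w|).
have haN : exp_bounded B (fun w => `|N w|).
  apply: (exp_bounded_le _ hN); first by case: hN => mN _; exact: measurableT_comp.
  by apply: filterS (ae_eq_refl P setT (fun=> 0 : R)) => w _; rewrite normr_id.
have hM : exp_bounded B M.
  apply: ebM => //; apply: ebM; last exact: exp_bounded_expabs.
  exact: exp_boundedX.
apply: (is_derive0_unique (C := \int[P]_w M w) dpsi) => z z1.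
have h1 := ebM hN (exp_bounded_expZ z f).
have h2 : exp_bounded B (fun w => z * (N w * B f w)) by apply: exp_boundedZ => //; exact: ebM.
have h3 : exp_bounded B (fun w => N w * expR (z * B f w) - N w).
  by have := exp_boundedD h1 (exp_boundedZ B_noise (-1) hN); under eq_fun do rewrite mulN1r.
have h4 : exp_bounded B (fun w => N w * expR (z * B f w) - N w - z * (N w * B f w)).
  by have := exp_boundedD h3 (exp_boundedZ B_noise (-1) h2); under eq_fun do rewrite mulN1r.
have -> : psi z - psi 0 - z * (\int[P]_w (N w * B f w)) =
    \int[P]_w (N w * expR (z * B f w) - N w - z * (N w * B f w)).
  rewrite RintegralB//; [|exact: ebI|exact: ebI].
  rewrite RintegralB//; [|exact: ebI|exact: ebI].
  rewrite RintegralZl//; last exact/ebI/ebM.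
  rewrite -!Hpsi; congr (_ - _ - _); apply: eq_Rintegral => w _.
  by rewrite mul0r expR0 mulr1.
apply: (le_trans (le_normr_Rintegral measurableT (ebI h4))).
rewrite -RintegralZl//; last exact: ebI.
apply: le_Rintegral => //.
- apply/ebI; apply: (exp_bounded_le _ h4).
    by case: h4 => m4 _; exact: measurableT_comp.
  by apply: filterS (ae_eq_refl P setT (fun=> 0 : R)) => w _; rewrite normr_id.
- exact/ebI/exp_boundedZ.
move=> w _; have -> : N w * expR (z * B f w) - N w - z * (N w * B f w) =
   N w * (expR (z * B f w) - 1 - z * B f w) by ring.
rewrite normrM /M mulrCA ler_wpM2l//.
apply: (le_trans (expR_taylor1 _)); rewrite exprMn -mulrA.
do 2 (rewrite ler_wpM2l ?sqr_ge0//).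
by rewrite ler_expR normrM ler_piMl.
Qed.

(** The parameter [s] of the law is found by differentiating the moment generating function twice at
    0, which gives [s ^+ 2] as second moment of [B f]; the white noise property equates that moment
    with the square norm of [f]. *)
Lemma noise_mgf f : \int[P]_w expR (B f w) = expR (dotL2 mu f f / 2).
Proof.
have [[/(_ f)/centered_gaussian_mgf[s _ mgf] _ _] _] := B_noise.
have mgfR z : \int[P]_w expR (z * B f w) = expR (z ^+ 2 * s ^+ 2 / 2).
  by rewrite /Rintegral mgf.
have D1 z : \int[P]_w (B f w * expR (z * B f w)) = z * s ^+ 2 * expR (z ^+ 2 * s ^+ 2 / 2).
  under eq_Rintegral do rewrite mulrC.
  apply: (@noise_derivative _ _ (fun y => expR ((z + y) ^+ 2 * s ^+ 2 / 2))).
  - exact: exp_bounded_expZ.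
  - move=> y; rewrite -mgfR; apply: eq_Rintegral => w _.
    by rewrite -expRD mulrDl.
  - apply: is_derive_eq; rewrite /GRing.scale/= !addr0.
    by move: (expR _) => E; field.
have D2 : \int[P]_w (B f w * B f w) = s ^+ 2.
  apply: (noise_derivative (exp_bounded_noise B_noise f) D1).
  by apply: is_derive_eq; rewrite /GRing.scale/= expr0n/= !mul0r expR0; field.
have := mgfR 1; under eq_Rintegral do rewrite mul1r; move=> ->.
by rewrite expr1n mul1r -D2 -[X in X / 2]/(dotL2 P (B f) (B f)) noise_dot.
Qed.

Lemma Rintegral_ae_eq (Y Z : Omega -> R) : measurable_fun setT Y ->
  measurable_fun setT Z -> Y = Z %[ae P] -> \int[P]_w Y w = \int[P]_w Z w.
Proof.
move=> mY mZ YZ; congr fine; apply: ae_eq_integral => //; try exact/measurable_EFinP.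
by apply: filterS YZ => w /= + _ => ->.
Qed.

Section Orthonormal.
Variable m : nat -> L2 mu.
Hypothesis m_orth : forall j k, dotL2 mu (m j) (m k) = (j == k)%:R.

(** Multiplying the integrand by [B (m k0)] amounts to differentiating in [y] along [m k0]. The
    factor [a] is constant in that direction and the Gaussian factor contributes
    [dotL2 mu y (m k0)], so the effect on the polynomial is the recursion [gauss_shiftXM]. *)
Lemma gauss_step (A : Omega -> R) (a : L2 mu -> R) k0 :
  exp_bounded B A -> (forall y (z : R), a (y + z *: m k0) = a y) ->
  (forall y, \int[P]_w (A w * expR (B y w)) = a y * expR (dotL2 mu y y / 2)) ->
  forall q y, \int[P]_w (q.[B (m k0) w] * A w * expR (B y w)) =
    (gauss_shift q).[dotL2 mu y (m k0)] * a y * expR (dotL2 mu y y / 2).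
Proof.
move=> hA ainv HA; elim/poly_ind => [|q c IH] y.
  rewrite gauss_shiftC hornerC !mul0r.
  under eq_Rintegral do rewrite hornerC !mul0r.
  by rewrite /Rintegral integral0.
have hq : exp_bounded B (fun w => q.[B (m k0) w] * A w * expR (B y w)).
  by apply: ebM; [apply: ebM => //; exact: exp_bounded_horner|exact: exp_bounded_exp].
have hc : exp_bounded B (fun w => c * (A w * expR (B y w))).
  by apply/exp_boundedZ/ebM => //; exact: exp_bounded_exp.
transitivity (\int[P]_w (q.[B (m k0) w] * A w * expR (B y w) * B (m k0) w +
    c * (A w * expR (B y w)))).
  by apply: eq_Rintegral => w _; rewrite hornerMXaddC; ring.
rewrite RintegralD//; [|exact/ebI/ebM/exp_bounded_noise|exact: ebI].
rewrite RintegralZl//; last by apply/ebI/ebM => //; exact: exp_bounded_exp.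
rewrite HA.
pose yk := dotL2 mu y (m k0); pose yy := dotL2 mu y y.
(* The induction hypothesis at [y + z *: m k0], whose square norm is [yy + 2 * z * yk + z ^+ 2]
   because [m k0] is a unit vector. *)
pose psi z := (gauss_shift q).[yk + z] * a y * expR ((yy + 2 * z * yk + z ^+ 2) / 2).
have dpsi : is_derive (0 : R) 1 psi
    (((gauss_shift q)^`().[yk] + yk * (gauss_shift q).[yk]) * a y * expR (yy / 2)).
  have dp : is_derive (0 : R) 1 (fun z => (gauss_shift q).[yk + z]) (gauss_shift q)^`().[yk].
    have dq := is_derive_poly (gauss_shift q) (yk + 0).
    have dg : is_derive (0 : R) 1 (fun z : R => yk + z) 1.
      by apply: is_derive_eq; rewrite add0r mulr1.
    have := @is_derive1_comp _ (horner (gauss_shift q)) (fun z : R => yk + z) _ _ _ dq dg.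
    by rewrite addr0 mulr1.
  apply: is_derive_eq; rewrite /GRing.scale/= !addr0 expr0n/=.
  rewrite !(mulr0, mul0r, addr0, add0r, mulr1).
  by move: (expR _) => E; field.
have Hpsi z :
    \int[P]_w (q.[B (m k0) w] * A w * expR (B y w) * expR (z * B (m k0) w)) = psi z.
  have dE : dotL2 mu (y + z *: m k0) (m k0) = yk + z.
    by rewrite (innerDl sdmu) (innerZl sdmu) m_orth eqxx mulr1.
  have dd : dotL2 mu (y + z *: m k0) (y + z *: m k0) = yy + 2 * z * yk + z ^+ 2.
    rewrite (innerDr sdmu) (innerZr sdmu) dE (innerDl sdmu) (innerZl sdmu).
    by rewrite (innerC sdmu (m k0)) -/yk -/yy; ring.
  rewrite /psi -dE -dd -(ainv y z) -IH; apply: Rintegral_ae_eq.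
  + by case: (ebM hq (exp_bounded_expZ z (m k0))).
  + have h : exp_bounded B (fun w => q.[B (m k0) w] * A w).
      by apply: ebM => //; exact: exp_bounded_horner.
    by case: (ebM h (exp_bounded_exp B (y + z *: m k0))).
  have := noise_linear B_noise 1 z y (m k0).
  by apply: filterS => w /=; rewrite scale1r => -> // _; rewrite mul1r expRD mulrA.
rewrite (noise_derivative hq Hpsi dpsi).
rewrite [q * 'X]mulrC gauss_shiftD gauss_shiftXM gauss_shiftC.
by rewrite !hornerD hornerM hornerX hornerC -/yk -/yy; ring.
Qed.

(** The independence of the [B (m k)] in the form used below: [y = 0] gives moments, a general [y]
    the coefficients of exponentials. *)
Lemma gauss_prod (s : seq nat) (p : nat -> {poly R}) y : uniq s ->
  \int[P]_w ((\prod_(k <- s) (p k).[B (m k) w]) * expR (B y w)) =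
  (\prod_(k <- s) (gauss_shift (p k)).[dotL2 mu y (m k)]) * expR (dotL2 mu y y / 2).
Proof.
elim: s y => [|k s IH] y /=.
  move=> _; rewrite big_nil mul1r -noise_mgf; apply: eq_Rintegral => w _.
  by rewrite big_nil mul1r.
move=> /andP[ks us]; rewrite big_cons.
rewrite -(@gauss_step (fun w => \prod_(k <- s) (p k).[B (m k) w])
  (fun y => \prod_(k <- s) (gauss_shift (p k)).[dotL2 mu y (m k)])).
- by apply: eq_Rintegral => w _; rewrite big_cons.
- by apply: exp_bounded_prod => // i; exact: exp_bounded_horner.
- move=> y' z; rewrite !big_seq; apply: eq_bigr => j js.
  rewrite (innerDl sdmu) (innerZl sdmu) m_orth; case: eqVneq ks js => [->/negP//|_ _ _].
  by rewrite mulr0 addr0.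
- by move=> y'; exact: IH.
Qed.

End Orthonormal.
End GaussianCalculus.

(** * Multi-indices and the chaos basis *)

Section MultiIndex.

Lemma mi_addE (a b : multi_index) k : mi_add a b k = (a k + b k)%N.
Proof.
rewrite /mi_add fsfunE inE !mem_finsupp.
by case: (a k) (b k) => [|x] [|y] //=; rewrite ?addn0.
Qed.

Definition mi_unit (k : nat) : multi_index := [fsfun j in [fset k]%fset => 1%N | 0%N].

Lemma mi_unitE k j : mi_unit k j = (j == k).
Proof. by rewrite fsfunE inE; case: eqVneq. Qed.

Definition mi_sub (a b : multi_index) : multi_index :=
  [fsfun k in finsupp a => (a k - b k)%N | 0%N].

Lemma mi_subE a b k : mi_sub a b k = (a k - b k)%N.
Proof. by rewrite fsfunE mem_finsupp; case: (a k). Qed.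

Definition mi_deg (a : multi_index) : nat := (\sum_(k <- finsupp a) a k)%N.

(** As the factor at exponent 0 is neutral, multi-indices with different supports can be compared
    over one common list. *)
Lemma mi_widen (V : Type) (idx : V) (op : Monoid.com_law idx) (a : multi_index)
    (s : seq nat) (F : nat -> nat -> V) : uniq s -> {subset finsupp a <= s} ->
  (forall k, F k 0%N = idx) ->
  \big[op/idx]_(k <- finsupp a) F k (a k) = \big[op/idx]_(k <- s) F k (a k).
Proof.
move=> us sas F0; rewrite [RHS](bigID (mem (finsupp a)))/=.
rewrite [X in op _ X]big1 ?Monoid.mulm1.
  rewrite -[RHS]big_filter; apply: perm_big; apply: uniq_perm; [exact: fset_uniq|exact: filter_uniq|].
  by move=> k; rewrite mem_filter; case: (boolP (k \in finsupp a)) => // /sas ->.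
by move=> k; rewrite memNfinsupp => /eqP ->.
Qed.

Lemma mi_deg_widen (a : multi_index) s : uniq s -> {subset finsupp a <= s} ->
  mi_deg a = (\sum_(k <- s) a k)%N.
Proof. by move=> us sas; rewrite /mi_deg (mi_widen (F := fun _ n => n) _ us sas). Qed.

Lemma mi_fact_widen (a : multi_index) s : uniq s -> {subset finsupp a <= s} ->
  mi_fact a = (\prod_(k <- s) (a k)`!)%N.
Proof. by move=> us sas; rewrite /mi_fact (mi_widen (F := fun _ n => n`!%N) _ us sas). Qed.

Lemma mi_fact_gt0 a : (0 < mi_fact a)%N.
Proof. by rewrite /mi_fact prodn_gt0// => k; exact: fact_gt0. Qed.

Lemma mi_deg1 a : mi_deg a = 1%N -> exists k, a = mi_unit k.
Proof.
move=> a1; have [k kP] : exists k, k \in finsupp a.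
  apply/fset0Pn/eqP => a0; move: a1; rewrite /mi_deg a0.
  by rewrite big_seq_fset0.
exists k; apply/fsfunP => j; rewrite mi_unitE.
move: a1; rewrite /mi_deg (big_fsetD1 k)//=.
have : (0 < a k)%N by rewrite lt0n -mem_finsupp.
case ak : (a k) => [//|[|n]] _; last by rewrite !addSn.
rewrite add1n => -[/eqP]; rewrite sum_nat_seq_eq0 => /allP H.
case: (eqVneq j k) => [->|jk]; first by rewrite ak.
have [ja|] := boolP (j \in finsupp a); last by rewrite memNfinsupp => /eqP.
by apply/eqP/(H j); rewrite in_fsetD1 jk.
Qed.

Lemma mi_unit_fact k : mi_fact (mi_unit k) = 1%N.
Proof.
rewrite (@mi_fact_widen _ [:: k])//; first by rewrite big_seq1 mi_unitE eqxx.
by move=> j; rewrite mem_finsupp mi_unitE inE; case: (j == k).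
Qed.

Lemma mi_unit_deg k : mi_deg (mi_unit k) = 1%N.
Proof.
rewrite (@mi_deg_widen _ [:: k])//; first by rewrite big_seq1 mi_unitE eqxx.
by move=> j; rewrite mem_finsupp mi_unitE inE; case: (j == k).
Qed.

Lemma mi_unit_inj : injective mi_unit.
Proof. by move=> j k /fsfunP/(_ j); rewrite !mi_unitE eqxx; case: eqP. Qed.

Lemma mi_addIr b : injective (mi_add ^~ b).
Proof.
move=> a a' /fsfunP H; apply/fsfunP => k; have := H k.
by rewrite !mi_addE => /eqP; rewrite eqn_add2r => /eqP.
Qed.

Lemma mi_addIl b : injective (mi_add b).
Proof.
move=> a a' /fsfunP H; apply/fsfunP => k; have := H k.
by rewrite !mi_addE => /eqP; rewrite eqn_add2l => /eqP.
Qed.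

Lemma mi_add_sub_unit a k : k \in finsupp a -> mi_add (mi_unit k) (mi_sub a (mi_unit k)) = a.
Proof.
rewrite mem_finsupp => ak; apply/fsfunP => j; rewrite mi_addE mi_subE !mi_unitE.
by case: eqVneq => [->|_]; rewrite ?add0n ?subn0// subnKC// lt0n.
Qed.

Lemma mi_degD a b : mi_deg (mi_add a b) = (mi_deg a + mi_deg b)%N.
Proof.
pose s := (finsupp a `|` finsupp b)%fset.
have us : uniq s by exact: fset_uniq.
rewrite !(@mi_deg_widen _ s us).
- by rewrite -big_split/=; apply: eq_bigr => k _; rewrite mi_addE.
- by move=> k kb; rewrite inE kb orbT.
- by move=> k kb; rewrite inE kb.
- move=> k; rewrite mem_finsupp mi_addE inE !mem_finsupp.
  by case: (a k) (b k) => [|?] [|?].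
Qed.

Lemma mi_fact_add_unit k a : mi_fact (mi_add (mi_unit k) a) = ((a k).+1 * mi_fact a)%N.
Proof.
pose s := (k |` finsupp a)%fset; have us : uniq s by exact: fset_uniq.
have ks : k \in s by rewrite !inE eqxx.
rewrite !(@mi_fact_widen _ s us).
- rewrite !(big_fsetD1 k ks)/= mi_addE mi_unitE eqxx add1n factS mulnA.
  congr (_ * _)%N; rewrite big_seq [RHS]big_seq; apply: eq_bigr => j.
  by rewrite in_fsetD1 => /andP[jk _]; rewrite mi_addE mi_unitE (negbTE jk).
- by move=> j ja; rewrite inE ja orbT.
- move=> j; rewrite mem_finsupp mi_addE mi_unitE !inE mem_finsupp.
  by case: (j == k).
Qed.

End MultiIndex.

Section Chaos.
Context {R : realType} {d : measure_display} {Omega : measurableType d}.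
Variable P : probability Omega R.
Context {dS : measure_display} {S : measurableType dS}.
Variable mu : {measure set S -> \bar R}.
Variable B : L2 mu -> {RV P >-> R}.
Hypothesis B_noise : white_noise B.
Variable m : nat -> L2 mu.
Hypothesis m_orth : forall j k, dotL2 mu (m j) (m k) = (j == k)%:R.
Let sdmu := dotL2_semi_inner mu.

Definition mi_coef (x : nat -> R) (a : multi_index) : R :=
  \prod_(k <- finsupp a) (x k ^+ a k / Num.sqrt (a k)`!%:R).

Lemma mi_coef_widen x (a : multi_index) s : uniq s -> {subset finsupp a <= s} ->
  mi_coef x a = \prod_(k <- s) (x k ^+ a k / Num.sqrt (a k)`!%:R).
Proof.
move=> us sas.
rewrite /mi_coef (mi_widen (F := fun k n => x k ^+ n / Num.sqrt n`!%:R) _ us sas)//.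
by move=> k; rewrite expr0 fact0 sqrtr1 divr1.
Qed.

Let hp (a : multi_index) k : {poly R} :=
  (Num.sqrt (a k)`!%:R)^-1 *: hermite_poly (a k).

Lemma xi_widen (a : multi_index) s w : uniq s -> {subset finsupp a <= s} ->
  xi B m a w = \prod_(k <- s) ((Num.sqrt (a k)`!%:R)^-1 *: hermite_poly (a k)).[B (m k) w].
Proof.
move=> us sas; rewrite /xi (mi_widen (F := fun k n =>
  hermite n (B (m k) w) / Num.sqrt n`!%:R) _ us sas)//=.
  by apply: eq_bigr => k _; rewrite hornerZ hermiteE mulrC.
by move=> k; rewrite fact0 sqrtr1 divr1 hermiteE hornerC.
Qed.

Lemma exp_bounded_xi a : exp_bounded B (xi B m a).
Proof.
rewrite (_ : xi B m a = fun w => \prod_(k <- finsupp a) (hp a k).[B (m k) w]).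
  by apply: exp_bounded_prod => // k; exact: exp_bounded_horner.
by apply/funext => w; rewrite (@xi_widen _ (finsupp a)).
Qed.

Lemma xi_in_L2 a : xi B m a \in Lfun P 2%:E.
Proof. exact: (exp_bounded_L2 B_noise (exp_bounded_xi a)). Qed.

Definition xiL2 a : L2 P := Lfun_Sub (lee1n 2) (xi_in_L2 a).

Lemma noise0_exp : (fun w => expR (B 0 w)) = cst 1 %[ae P].
Proof. by apply: filterS (noise0 B_noise) => w /= h _; rewrite h// expR0. Qed.

Lemma xi_orthonormal a b : dotL2 P (xiL2 a) (xiL2 b) = (a == b)%:R.
Proof.
pose s := (finsupp a `|` finsupp b)%fset; have us : uniq s by exact: fset_uniq.
have sa : {subset finsupp a <= s} by move=> k ka; rewrite inE ka.
have sb : {subset finsupp b <= s} by move=> k kb; rewrite inE kb orbT.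
have hab := exp_boundedM B_noise (exp_bounded_xi a) (exp_bounded_xi b).
(* The factor [expR (B 0 w)], almost surely 1, brings the integrand to the form of [gauss_prod] at
   [y = 0]. *)
transitivity (\int[P]_w ((\prod_(k <- s) (hp a k * hp b k).[B (m k) w]) * expR (B 0 w))).
  apply: Rintegral_ae_eq.
  - by case: hab.
  - apply: measurable_funM; last exact: measurable_expR_noise.
    by have [] := exp_bounded_prod B_noise s
      (fun k => exp_bounded_horner B_noise (hp a k * hp b k) (m k)).
  - apply: filterS noise0_exp => w /= -> // _; rewrite mulr1.
    rewrite (xi_widen _ us sa) (xi_widen _ us sb) -big_split/=.
    by apply: eq_bigr => k _; rewrite hornerM.
rewrite gauss_prod// (inner0l sdmu) mul0r expR0 mulr1.
transitivity (\prod_(k <- s) (a k == b k)%:R : R).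
  apply: eq_bigr => k _; rewrite (inner0l sdmu) /hp.
  rewrite -scalerAl -scalerAr !gauss_shiftZ !hornerZ hermite_orthogonal.
  case: eqVneq => [->|_]; last by rewrite mul0r !mulr0.
  rewrite mul1r mulrA -invfM -expr2 sqr_sqrtr ?ler0n// mulVf//.
case: eqVneq => [->|ab]; first by rewrite big1// => k _; rewrite eqxx.
have [k ks abk] : exists2 k, k \in s & a k != b k.
  apply: contrapT => H; move/eqP: ab; apply; apply/fsfunP => k.
  apply: contrapT => /eqP abk; apply: H; exists k => //; rewrite inE !mem_finsupp.
  by case: (a k) (b k) abk => [|?] [|?].
by rewrite (big_fsetD1 k ks)/= (negbTE abk) mul0r.
Qed.

Lemma xi_exp_coef a y : \int[P]_w (xi B m a w * expR (B y w)) =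
  mi_coef (fun k => dotL2 mu y (m k)) a * expR (dotL2 mu y y / 2).
Proof.
have -> : mi_coef (fun k => dotL2 mu y (m k)) a =
    \prod_(k <- finsupp a) (gauss_shift (hp a k)).[dotL2 mu y (m k)].
  apply: eq_bigr => k _.
  by rewrite gauss_shiftZ gauss_shift_hermite hornerZ hornerXn mulrC.
rewrite -(gauss_prod B_noise m_orth (hp a) y (fset_uniq _)).
by apply: eq_Rintegral => w _; rewrite (@xi_widen _ (finsupp a)).
Qed.

Definition exp_vec (y : L2 mu) (w : Omega) : R := expR (B y w - dotL2 mu y y / 2).

Lemma exp_vecE y w : exp_vec y w = expR (- (dotL2 mu y y / 2)) * expR (B y w).
Proof. by rewrite /exp_vec addrC expRD. Qed.

Lemma exp_bounded_exp_vec y : exp_bounded B (exp_vec y).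
Proof.
rewrite (_ : exp_vec y = fun w => expR (- (dotL2 mu y y / 2)) * expR (B y w)).
  by apply: exp_boundedZ => //; exact: exp_bounded_exp.
by apply/funext => w; rewrite exp_vecE.
Qed.

Lemma exp_vec_in_L2 y : exp_vec y \in Lfun P 2%:E.
Proof. exact: (exp_bounded_L2 B_noise (exp_bounded_exp_vec y)). Qed.

Definition exp_vecL2 y : L2 P := Lfun_Sub (lee1n 2) (exp_vec_in_L2 y).

Lemma exp_vec_coef y a : dotL2 P (exp_vecL2 y) (xiL2 a) =
  mi_coef (fun k => dotL2 mu y (m k)) a.
Proof.
have hb := exp_bounded_integrable B_noise
  (exp_boundedM B_noise (exp_bounded_xi a) (exp_bounded_exp B y)).
transitivity (\int[P]_w (expR (- (dotL2 mu y y / 2)) * (xi B m a w * expR (B y w)))).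
  by apply: eq_Rintegral => w _; rewrite /= exp_vecE; ring.
by rewrite RintegralZl// xi_exp_coef mulrCA -expRD addNr expR0 mulr1.
Qed.

Lemma exp_vec_sq y : dotL2 P (exp_vecL2 y) (exp_vecL2 y) = expR (dotL2 mu y y).
Proof.
have hb := exp_bounded_integrable B_noise (exp_bounded_exp B (2 *: y)).
transitivity (\int[P]_w (expR (- dotL2 mu y y) * expR (B (2 *: y) w))).
  apply: Rintegral_ae_eq.
  - by case: (exp_boundedM B_noise (exp_bounded_exp_vec y) (exp_bounded_exp_vec y)).
  - by case: (exp_boundedZ B_noise (expR (- dotL2 mu y y)) (exp_bounded_exp B (2 *: y))).
  - apply: filterS (noiseZ B_noise 2 y) => w /= -> // _.
    by rewrite -!expRD /exp_vec; congr expR; field.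
rewrite RintegralZl// noise_mgf// (innerZl sdmu) (innerZr sdmu) -expRD.
by congr expR; field.
Qed.

(** The coefficient is the derivative at [z = 0] of the expectation of [xi a] times
    [expR (z * B f w)], namely of [c * z ^+ mi_deg a * expR (z ^+ 2 * N / 2)]; only degree one
    contributes. *)
Lemma noise_xi_coef f a : dotL2 P (noiseL2 B_noise f) (xiL2 a) =
  if mi_deg a == 1%N then mi_coef (fun k => dotL2 mu f (m k)) a else 0.
Proof.
set c := mi_coef _ a; pose N := dotL2 mu f f.
pose psi (z : R) := c * z ^+ mi_deg a * expR (z ^+ 2 * N / 2).
have Hpsi z : \int[P]_w (xi B m a w * expR (z * B f w)) = psi z.
  transitivity (\int[P]_w (xi B m a w * expR (B (z *: f) w))).
    apply: Rintegral_ae_eq.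
    - by case: (exp_boundedM B_noise (exp_bounded_xi a) (exp_bounded_expZ B_noise z f)).
    - by case: (exp_boundedM B_noise (exp_bounded_xi a) (exp_bounded_exp B (z *: f))).
    - by apply: filterS (noiseZ B_noise z f) => w /= ->.
  rewrite xi_exp_coef (innerZl sdmu) (innerZr sdmu) mulrA -expr2 /psi; congr (_ * _).
  rewrite /c /mi_coef /mi_deg expr_sum -big_split/=; apply: eq_bigr => k _.
  by rewrite (innerZl sdmu) exprMn -mulrA mulrC.
rewrite (innerC (dotL2_semi_inner P)).
have -> : dotL2 P (xiL2 a) (noiseL2 B_noise f) = \int[P]_w (xi B m a w * B f w) by [].
pose E' : R := 0; have dE : is_derive (0 : R) 1 (fun z => expR (z ^+ 2 * N / 2)) E'.
  by apply: is_derive_eq; rewrite /GRing.scale/= expr0n/= !(mulr0, mul0r, addr0).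
apply: (noise_derivative B_noise (exp_bounded_xi a) Hpsi).
have dX : is_derive (0 : R) 1 (fun z => z ^+ mi_deg a) (mi_deg a == 1%N)%:R.
  rewrite (_ : (fun z => _) = horner ('X^(mi_deg a) : {poly R})).
    apply: (is_derive_eq (is_derive_poly ('X^(mi_deg a)) 0)).
    rewrite derivXn hornerMn hornerXn expr0n.
    by case: (mi_deg a) => [|[|n]] //=; rewrite mul0rn.
  by apply/funext => z; rewrite hornerXn.
apply: is_derive_eq; rewrite /GRing.scale/= /E' mulr0 add0r.
rewrite (_ : 0 ^+ 2 = 0); last by rewrite expr0n.
by rewrite !mul0r expR0 mul1r; case: ifP => _; rewrite ?mulr0 ?mulr1.
Qed.

End Chaos.

Lemma cvg_big_prod (R : realType) I (r : seq I) (F : I -> nat -> R) (l : I -> R) :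
  (forall i, F i @ \oo --> l i) ->
  (fun n => \prod_(i <- r) F i n) @ \oo --> \prod_(i <- r) l i.
Proof.
move=> Fl; elim: r => [|i r IH].
  by rewrite big_nil; under eq_fun do rewrite big_nil; exact: cvg_cst.
by rewrite big_cons; under eq_fun do rewrite big_cons; exact: cvgM.
Qed.

Section TruncatedMultiIndex.
Context {N n : nat}.

(** Multi-indices supported below [N] with entries below [n]. The box shape lets a sum of products
    over them factor into one-variable sums. *)
Definition mi_of_ffun (f : {ffun 'I_N -> 'I_n}) : multi_index :=
  [fsfun k in [fset k | k in iota 0 N]%fset =>
    if insub k is Some i then f i : nat else 0%N | 0%N].

Lemma mi_of_ffunE f (i : 'I_N) : mi_of_ffun f i = f i.
Proof. by rewrite fsfunE !inE/= mem_iota/= add0n ltn_ord valK. Qed.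

Lemma mi_of_ffun_inj : injective mi_of_ffun.
Proof.
move=> f g /fsfunP fg; apply/ffunP => i; apply: val_inj.
by rewrite /= -!mi_of_ffunE fg.
Qed.

Lemma finsupp_mi_of_ffun f : {subset finsupp (mi_of_ffun f) <= index_iota 0 N}.
Proof.
move=> k; rewrite mem_finsupp fsfunE !inE/= /index_iota subn0.
by case: ifP.
Qed.

End TruncatedMultiIndex.

(** * Stochastic exponentials in the closed chaos span *)

Section ChaosExpansion.
Context {R : realType} {d : measure_display} {Omega : measurableType d}.
Variable P : probability Omega R.
Context {dS : measure_display} {S : measurableType dS}.
Variable mu : {measure set S -> \bar R}.
Variable B : L2 mu -> {RV P >-> R}.
Hypothesis B_noise : white_noise B.
Variable m : nat -> L2 mu.
Hypothesis m_basis : orthonormal_basis m.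
Let m_orth := m_basis.1.
Let sdmu := dotL2_semi_inner mu.
Let sdP := dotL2_semi_inner P.
Let xi_o := xi_orthonormal B_noise m_orth.

Lemma basis_cspan (y : L2 mu) : cspan (fun f g : L2 mu => dotL2 mu f g) m y.
Proof.
apply: (total_cspan sdmu (@L2_complete _ _ _ mu) m_orth) => v v0.
have v00 := m_basis.2 v v0.
rewrite (dotL2_ae_eq (f' := cst 0) (g' := cst 0) _ _ _ _ v00 v00) //;
  try exact/L2_measurable/LfunP.
by rewrite /dotL2/=; under eq_Rintegral do rewrite mul0r; rewrite /Rintegral integral0.
Qed.

Lemma sum_mi_coef_sq N n (x : nat -> R) :
  \sum_(a <- [fset mi_of_ffun f | f : {ffun 'I_N -> 'I_n}]%fset) mi_coef x a ^+ 2 =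
  \prod_(i < N) \sum_(j < n) (x i ^+ 2) ^+ j / j`!%:R.
Proof.
rewrite big_imfset/=; last by move=> f g _ _; exact: mi_of_ffun_inj.
rewrite big_enum/= bigA_distr_bigA; apply: eq_bigr => f _.
rewrite (mi_coef_widen _ (iota_uniq 0 (N - 0)) (@finsupp_mi_of_ffun _ _ f)).
rewrite -prodrXl big_mkord; apply: eq_bigr => i _.
rewrite mi_of_ffunE exprMn exprVn sqr_sqrtr ?ler0n//.
by rewrite -!exprM mulnC.
Qed.

(** The residual over a box is [exp |y|^2] minus a product of truncated exponential series. The
    bound [N] brings the sum of the [x i ^+ 2] near [|y|^2], and then [n] brings the truncated
    series near their limits. *)
Lemma exp_vec_cspan y :
  cspan (fun f g : L2 P => dotL2 P f g) (xiL2 B_noise m) (exp_vecL2 B_noise y).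
Proof.
move=> eps eps0; set yy := dotL2 mu y y.
pose x k := dotL2 mu y (m k).
have e0 : 0 < expR yy by exact: expR_gt0.
(* The factor [expR yy] in the tolerance pays for the slope of the exponential in [Hs]. *)
have [J HJ] := basis_cspan y (divr_gt0 eps0 (mulr_gt0 (ltr0n R 2) e0)).
rewrite (sq_sub_proj sdmu m_orth) in HJ.
(* An initial segment containing [J] captures at least as much of [|y|^2]. *)
pose N := (\max_(k <- J) k).+1.
have HN : yy - \sum_(i < N) x i ^+ 2 < eps / (2 * expR yy).
  apply: le_lt_trans HJ; rewrite lerD2l lerN2.
  rewrite -(big_mkord xpredT (fun i => x i ^+ 2)) [leRHS](bigID (mem J))/=.
  rewrite -[X in _ <= X + _]big_filter [X in _ <= X + _](perm_big J) ?lerDl ?sumr_ge0//.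
    by move=> i _; exact: sqr_ge0.
  apply: uniq_perm; [exact/filter_uniq/iota_uniq|exact: fset_uniq|move=> k].
  rewrite mem_filter mem_index_iota/=; case: (boolP (k \in J)) => //= kJ.
  by rewrite ltnS; apply: (@leq_bigmax_seq _ _ xpredT id).
have cv : (fun n => \prod_(i < N) \sum_(j < n) (x i ^+ 2) ^+ j / j`!%:R) @ \oo -->
    \prod_(i < N) expR (x i ^+ 2).
  apply: cvg_big_prod => i.
  rewrite (_ : (fun n => _) = series (exp_coeff (x i ^+ 2))).
    exact: is_cvg_series_exp_coeff.
  by apply/funext => n; rewrite /series/= big_mkord.
have /cvgrPdist_lt/(_ _ (divr_gt0 eps0 (ltr0n R 2)))[n _ Hn] := cv.
exists [fset mi_of_ffun f | f : {ffun 'I_N -> 'I_n}]%fset.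
rewrite (sq_sub_proj sdP xi_o) (exp_vec_sq B_noise) -/yy.
under eq_bigr do rewrite (exp_vec_coef B_noise m_orth).
rewrite sum_mi_coef_sq.
have {Hn} := Hn n (leqnn n); rewrite -expR_sum.
set Q := \prod_(i < N) _; set s := \sum_(i < N) _ => HQ.
have Hs : expR yy - expR s <= expR yy * (yy - s).
  have h := expR_ge1Dx (s - yy).
  have -> : expR s = expR yy * expR (s - yy) by rewrite -expRD addrC subrK.
  rewrite -[X in X - _]mulr1 -mulrBr ler_pM2l//; lra.
move: HN; rewrite ltr_pdivlMr ?mulr_gt0// => HN.
move: HQ; rewrite ltr_norml => /andP[_ {}HQ]; move: Hs HQ HN; rewrite -/s; nra.
Qed.

End ChaosExpansion.

Section FsetLimit.
Context {R : realType} {V : lmodType R}.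
Variable dot : V -> V -> R.
Hypothesis sd : semi_inner dot.

Definition fset_limit (I : choiceType) (T : I -> V) (W : V) := forall eps, 0 < eps ->
  exists J0 : {fset I}, forall J : {fset I}, (J0 `<=` J)%fset ->
    dot (\sum_(i <- J) T i - W) (\sum_(i <- J) T i - W) < eps.

(** Pairing with [v] is continuous by Cauchy-Schwarz, and all partial sums over sets containing [K]
    have the same pairing with [v]. *)
Lemma fset_limit_coef (I : choiceType) (T : I -> V) (W v : V) (K : {fset I}) :
  fset_limit T W -> (forall i, i \notin K -> dot (T i) v = 0) ->
  dot W v = \sum_(i <- K) dot (T i) v.
Proof.
move=> TW TK; have p : 0 < dot v v + 1 by rewrite ltr_wpDl// (inner_ge0 sd).
apply/eqP; rewrite eq_sym -subr_eq0 -sqrf_eq0 eq_le sqr_ge0 andbT.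
apply/ler_addgt0Pr => eps eps0; rewrite add0r.
have [J0 HJ0] := TW _ (divr_gt0 eps0 p).
have := HJ0 (J0 `|` K)%fset (fsubsetUl _ _); set D := (X in dot X X) => HD.
have -> : \sum_(i <- K) dot (T i) v - dot W v = dot D v.
  rewrite (innerBl sd) (inner_suml sd); congr (_ - _); rewrite [RHS](big_fsetID _ (mem K))/=.
  rewrite [X in _ + X]big1_fset ?addr0; last first.
    by move=> i; rewrite !inE => /andP[_ iK] _; exact: TK.
  rewrite (_ : [fset i | i in (J0 `|` K)%fset & mem K i]%fset = K)//.
  by apply/fsetP => i; rewrite !inE/=; case: (i \in K); rewrite ?orbT ?andbF.
apply: le_trans (inner_CauchySchwarz sd _ _) _.
have := inner_ge0 sd v; have := inner_ge0 sd D.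
by move: HD; rewrite ltr_pdivlMr//; nra.
Qed.

Lemma fset_limit_cspan {A : choiceType} (e : A -> V) (I : choiceType) (T : I -> V) (W : V) :
  (forall a b, dot (e a) (e b) = (a == b)%:R) ->
  fset_limit T W -> (forall i, cspan dot e (T i)) -> cspan dot e W.
Proof.
move=> eo TW cT; apply: (cspan_closed sd eo) => eps eps0.
have [J0 HJ0] := TW _ eps0.
exists (\sum_(i <- J0) T i); first by apply: (cspan_sum sd eo).
by have := HJ0 J0 (fsubset_refl _); rewrite -opprB (innerNl sd) (innerNr sd) opprK.
Qed.

End FsetLimit.

(** * Wick products *)

Section Wick.
Context {R : realType} {d : measure_display} {Omega : measurableType d}.
Variable P : probability Omega R.
Context {dS : measure_display} {S : measurableType dS}.
Variable mu : {measure set S -> \bar R}.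
Variable B : L2 mu -> {RV P >-> R}.
Hypothesis B_noise : white_noise B.
Variable m : nat -> L2 mu.
Hypothesis m_basis : orthonormal_basis m.
Let m_orth := m_basis.1.
Let sdmu := dotL2_semi_inner mu.
Let sdP := dotL2_semi_inner P.
Let xi_o := xi_orthonormal B_noise m_orth.
Local Notation dotP := (fun f g : L2 P => dotL2 P f g).
Local Notation xi_ := (xiL2 B_noise m).

Lemma measurable_field_noise f :
  measurable_fun setT (B f : g_sigma_algebraType (field_events B) -> R).
Proof.
move=> _ A mA; rewrite setTI; apply: sub_sigma_algebra; exists f => //.
by exists A => //; rewrite setTI.
Qed.

Lemma field_measurable_noise f : field_measurable B (B f).
Proof.
exists (B f : g_sigma_algebraType (field_events B) -> R); last exact: ae_eq_refl.
exact: measurable_field_noise.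
Qed.

Lemma measurable_field_xi a : measurable_fun setT
  (xi B m a : g_sigma_algebraType (field_events B) -> R).
Proof.
rewrite (_ : (xi B m a : g_sigma_algebraType (field_events B) -> R) =
  fun w => \prod_(k <- finsupp a)
    ((Num.sqrt (a k)`!%:R)^-1 *: hermite_poly (a k)).[B (m k) w]); last first.
  by apply/funext => w; rewrite (@xi_widen _ _ _ _ _ _ _ _ _ _ (finsupp a)).
apply: measurable_prod => k _.
apply: (@measurableT_comp _ _ _ _ _ _ (horner ((Num.sqrt (a k)`!%:R)^-1 *: hermite_poly (a k)))).
  by apply: continuous_measurable_fun; exact: continuous_horner.
move=> _ A mA; rewrite setTI; apply: sub_sigma_algebra; exists (m k) => //.
by exists A => //; rewrite setTI.
Qed.

Lemma field_L2_noise f : field_L2 B (B f).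
Proof. by split; [exact: noise_L2|exact: field_measurable_noise]. Qed.

Lemma field_L2_xi a : field_L2 B (xi B m a).
Proof.
split; first exact: xi_in_L2.
exists (xi B m a : g_sigma_algebraType (field_events B) -> R); last exact: ae_eq_refl.
exact: measurable_field_xi.
Qed.

Lemma mi_coef_unit (x : nat -> R) k : mi_coef x (mi_unit k) = x k.
Proof.
rewrite (@mi_coef_widen _ _ _ [:: k])// ?big_seq1.
  by rewrite mi_unitE eqxx -[nat_of_bool true]/1%N expr1 factS fact0 muln1 sqrtr1 divr1.
by move=> j; rewrite mem_finsupp mi_unitE inE; case: (j == k).
Qed.

Section WickTerm.
Variables (f : L2 mu) (a : multi_index).
Let fk k := dotL2 mu f (m k).

(** The summand of [wick] for [B f] and [xi a]. As [B f] has chaos degree one and [xi a] is a basis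
    vector, it vanishes unless the pair is some [(mi_unit k, a)]: the double series has a single
    free index [k]. *)
Definition wick_term (ab : multi_index * multi_index) : L2 P :=
  (dotL2 P (B f) (xi B m ab.1) * dotL2 P (xi B m a) (xi B m ab.2) *
   Num.sqrt ((mi_fact (mi_add ab.1 ab.2))%:R / (mi_fact ab.1 * mi_fact ab.2)%:R))
  *: xi_ (mi_add ab.1 ab.2).

Lemma wickE W : wick B m (B f) (xi B m a) W <->
  sumL2 P (fun ab => wick_term ab : Omega -> R) W.
Proof.
rewrite /wick (_ : (fun ab w => _) = fun ab => wick_term ab : Omega -> R); last first.
  by apply/funext => ab; apply/funext => w; rewrite mulrA.
split=> [[]//|h]; split=> //; [exact: field_L2_noise|exact: field_L2_xi].
Qed.

Lemma wick_term0r ab : ab.2 != a -> wick_term ab = 0.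
Proof.
move=> aba; rewrite /wick_term -[dotL2 P (xi B m a) _]/(dotL2 P (xi_ a) (xi_ ab.2)).
by rewrite xi_o eq_sym (negbTE aba) mulr0 mul0r scale0r.
Qed.

Lemma wick_term0l ab : (forall k, ab.1 != mi_unit k) -> wick_term ab = 0.
Proof.
move=> H; rewrite /wick_term.
rewrite -[dotL2 P (B f) _]/(dotL2 P (noiseL2 B_noise f) (xi_ ab.1)) noise_xi_coef//.
case: eqP => [/mi_deg1[k abk]|_]; last by rewrite !mul0r scale0r.
by have := H k; rewrite abk eqxx.
Qed.

Lemma wick_term_unit k : wick_term (mi_unit k, a) =
  (fk k * Num.sqrt (a k).+1%:R) *: xi_ (mi_add (mi_unit k) a).
Proof.
rewrite /wick_term /=; congr (_ *: _).
rewrite -[dotL2 P (xi B m a) _]/(dotL2 P (xi_ a) (xi_ a)) xi_o eqxx mulr1.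
rewrite -[dotL2 P (B f) _]/(dotL2 P (noiseL2 B_noise f) (xi_ (mi_unit k))) noise_xi_coef//.
rewrite mi_unit_deg eqxx mi_coef_unit mi_unit_fact mul1n mi_fact_add_unit natrM.
by rewrite mulfK// pnatr_eq0 -lt0n mi_fact_gt0.
Qed.

Lemma wick_term_coef0 ab al :
  (forall k, (ab == (mi_unit k, a)) ==> (al != mi_add (mi_unit k) a)) ->
  dotL2 P (wick_term ab) (xi_ al) = 0.
Proof.
case: ab => a' b' H; have [b'a|b'a] := eqVneq b' a; last first.
  by rewrite wick_term0r ?(inner0l sdP).
have [[k a'k]|nk] := pselect (exists k, a' = mi_unit k); last first.
  rewrite wick_term0l ?(inner0l sdP)// => k /=.
  by apply/eqP => h; apply: nk; exists k.
have := H k; rewrite b'a a'k eqxx implyTb => alk.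
by rewrite wick_term_unit (innerZl sdP) xi_o eq_sym (negbTE alk) mulr0.
Qed.

Lemma wick_coefs (W : Omega -> R) (WL : W \in Lfun P 2%:E) :
  wick B m (B f) (xi B m a) W ->
  [/\ cspan dotP xi_ (Lfun_Sub (lee1n 2) WL),
    forall k, dotL2 P W (xi B m (mi_add (mi_unit k) a)) = fk k * Num.sqrt (a k).+1%:R &
    forall al, (forall k, al != mi_add (mi_unit k) a) -> dotL2 P W (xi B m al) = 0].
Proof.
move/wickE/(sumL2P _ WL) => HW.
have {}HW : fset_limit dotP wick_term (Lfun_Sub (lee1n 2) WL) by exact: HW.
split.
- apply: (fset_limit_cspan sdP xi_o HW) => ab.
  exact/(cspanZ sdP)/(cspan_basis sdP xi_o).
- move=> k; transitivity (\sum_(ab <- [fset (mi_unit k, a)]%fset)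
      dotL2 P (wick_term ab) (xi_ (mi_add (mi_unit k) a))).
    refine (fset_limit_coef (v := xi_ (mi_add (mi_unit k) a))
      (K := [fset (mi_unit k, a)]%fset) sdP HW _) => ab; rewrite inE => abk.
    apply: wick_term_coef0 => j; apply/implyP => /eqP abj.
    apply: contraNneq abk => /mi_addIr/mi_unit_inj jk; rewrite abj jk; exact: eqxx.
  by rewrite big_seq_fset1 wick_term_unit (innerZl sdP) xi_o eqxx mulr1.
- move=> al H; transitivity (\sum_(ab <- fset0) dotL2 P (wick_term ab) (xi_ al)).
    refine (fset_limit_coef (v := xi_ al) (K := fset0) sdP HW _) => ab _.
    by apply: wick_term_coef0 => j; rewrite H implybT.
  by rewrite big_seq_fset0.
Qed.

Lemma wick_exists : exists W, wick B m (B f) (xi B m a) W.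
Proof.
pose x k := fk k * Num.sqrt (a k).+1%:R.
(* Each [(a k).+1] is at most [(mi_deg a).+1], the weight that reappears in the convergence of the
   series of Wick products. *)
have xM N : \sum_(k < N) x k ^+ 2 <= (mi_deg a).+1%:R * dotL2 mu f f.
  apply: (@le_trans _ _ ((mi_deg a).+1%:R * \sum_(k < N) fk k ^+ 2)).
    rewrite mulr_sumr; apply: ler_sum => k _.
    rewrite exprMn sqr_sqrtr ?ler0n// mulrC ler_wpM2r ?sqr_ge0// ler_nat ltnS.
    have [ka|] := boolP (nat_of_ord k \in finsupp a); last first.
      by rewrite memNfinsupp => /eqP ->.
    by rewrite /mi_deg (big_fsetD1 _ ka)/= leq_addr.
  rewrite ler_wpM2l//.
  have := bessel sdmu m_orth [fset nat_of_ord i | i in 'I_N]%fset f.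
  by rewrite big_imfset/=; [rewrite big_enum|move=> i j _ _ /ord_inj].
have [|W [cW Wk W0]] := summable_coefs (e := xi_) (s := fun k => mi_add (mi_unit k) a)
    (x := x) sdP (@L2_complete _ _ _ P) xi_o _ xM.
  by move=> j k /mi_addIr/mi_unit_inj.
exists W; apply/wickE/(sumL2P _ (LfunP W)) => eps eps0.
have [J1 HJ1] := cW _ eps0.
(* When [al] is [mi_add (mi_unit k) a], the pair listed for it is [(mi_unit k, a)], so any larger
   [J] reaches every index of [J1] where [W] has a nonzero coefficient. *)
exists [fset (mi_sub al a, a) | al in J1]%fset => J JJ.
set D := (X in let D := X in _).
(* The partial sum over [J] is the projection of [W] on [J'], since [W] has coefficient 0 at an
   index of [J1] that [J] does not reach. *)
pose J' := (J1 `|` [fset mi_add ab.1 ab.2 | ab in J & ab.2 == a])%fset.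
have J1J' : (J1 `<=` J')%fset by exact: fsubsetUl.
suff -> : D = - (W - proj dotP xi_ J' W).
  cbv zeta; rewrite (innerNl sdP) (innerNr sdP) opprK.
  exact: le_lt_trans (proj_mono sdP xi_o W J1J') HJ1.
have Tco ab : ab.2 = a ->
    wick_term ab = dotL2 P W (xi_ (mi_add ab.1 ab.2)) *: xi_ (mi_add ab.1 ab.2).
  case: ab => a' b' /= ->.
  have [[k ->]|nk] := pselect (exists k, a' = mi_unit k).
    by rewrite wick_term_unit Wk.
  rewrite wick_term0l => [|k /=]; last by apply/eqP => h; apply: nk; exists k.
  rewrite W0 ?scale0r// => k; apply/eqP => /mi_addIr h; apply: nk; by exists k.
rewrite /D opprB; congr (_ - _); last exact: val_inj.
rewrite /proj /lincomb (big_fsetID _ (mem [fset mi_add ab.1 ab.2 | ab in J & ab.2 == a]%fset))/=.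
rewrite [X in _ = _ + X]big1_fset ?addr0; last first.
  move=> al; rewrite !inE => /andP[/orP[alJ1|->//]] alN _.
  rewrite W0 ?scale0r// => k; apply: contra alN => /eqP alE.
  apply/imfsetP; exists (mi_unit k, a) => //=; rewrite !inE eqxx andbT.
  apply: (fsubsetP JJ); apply/imfsetP; exists al => //=.
  rewrite alE; congr pair; apply/fsfunP => j.
  by rewrite mi_subE mi_addE addnK.
rewrite (_ : [fset i | i in J' & _]%fset = [fset mi_add ab.1 ab.2 | ab in J & ab.2 == a]%fset).
  rewrite big_imfset/=; last first.
    by move=> [a1 b1] [a2 b2] /andP[_ /eqP/= ->] /andP[_ /eqP/= ->] /mi_addIr ->.
  rewrite big_filter [LHS](bigID (fun ab => ab.2 == a))/= [X in _ + X]big1 ?addr0.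
    by apply: eq_bigr => ab /eqP/Tco.
  by move=> ab /wick_term0r.
by apply/fsetP => al; rewrite !inE/=; case: (_ \in [fset _ | _ in _ & _]%fset); rewrite ?orbT ?andbF.
Qed.

End WickTerm.
End Wick.

Lemma sum_CauchySchwarz (R : realType) (s : seq nat) (u v : nat -> R) :
  (\sum_(k <- s) u k * v k) ^+ 2 <= (\sum_(k <- s) u k ^+ 2) * (\sum_(k <- s) v k ^+ 2).
Proof.
have sd : semi_inner (fun f g : nat -> R^o => \sum_(k <- s) f k * g k : R).
  split=> [f g|f g h|a f g|f].
  - by apply: eq_bigr => k _; rewrite mulrC.
  - by rewrite -big_split; apply: eq_bigr => k _; exact: mulrDl.
  - by rewrite mulr_sumr; apply: eq_bigr => k _; exact/esym/mulrA.
  - by apply: sumr_ge0 => k _; rewrite -expr2 sqr_ge0.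
exact: (inner_CauchySchwarz sd u v).
Qed.

(** * Series of Wick products *)

Section WickSums.
Context {R : realType} {d : measure_display} {Omega : measurableType d}.
Variable P : probability Omega R.
Context {dS : measure_display} {S : measurableType dS}.
Variable mu : {measure set S -> \bar R}.
Variable B : L2 mu -> {RV P >-> R}.
Hypothesis B_noise : white_noise B.
Variable m : nat -> L2 mu.
Hypothesis m_basis : orthonormal_basis m.
Let m_orth := m_basis.1.
Let sdmu := dotL2_semi_inner mu.
Let sdP := dotL2_semi_inner P.
Let xi_o := xi_orthonormal B_noise m_orth.
Local Notation dotP := (fun f g : L2 P => dotL2 P f g).
Local Notation xi_ := (xiL2 B_noise m).

Variables (eta_ : multi_index -> L2 mu) (W : multi_index -> Omega -> R).
Hypothesis HW : forall a, wick B m (B (eta_ a)) (xi B m a) (W a).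

Let WL a : W a \in Lfun P 2%:E. Proof. by have [_ _ []] := HW a. Qed.
Let Wb a : L2 P := Lfun_Sub (lee1n 2) (WL a).
Let y a k := dotL2 mu (eta_ a) (m k).

Let pred al k := mi_sub al (mi_unit k).

Let pred_inj al : {in finsupp al &, injective (pred al)}.
Proof.
move=> j k jal kal; rewrite /pred => jk.
by have := mi_add_sub_unit kal; rewrite -jk -{2}(mi_add_sub_unit jal) => /mi_addIr/mi_unit_inj.
Qed.

Let W_pred al k : k \in finsupp al ->
  dotL2 P (Wb (pred al k)) (xi_ al) = Num.sqrt (al k)%:R * y (pred al k) k.
Proof.
move=> kal; have [_ Wk _] := wick_coefs B_noise m_basis (WL (pred al k)) (HW _).
rewrite -[in xi_ al](mi_add_sub_unit kal).
transitivity (y (pred al k) k * Num.sqrt (pred al k k).+1%:R); first exact: Wk.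
rewrite mulrC /pred mi_subE mi_unitE eqxx subn1 prednK//.
by rewrite lt0n -mem_finsupp.
Qed.

Let W_0 al a : (forall k, k \in finsupp al -> a != pred al k) ->
  dotL2 P (Wb a) (xi_ al) = 0.
Proof.
move=> H; have [_ _ W0] := wick_coefs B_noise m_basis (WL a) (HW _).
apply: W0 => k; apply/eqP => alE.
have kal : k \in finsupp al by rewrite alE mem_finsupp mi_addE mi_unitE eqxx.
have /negP := H k kal; apply; apply/eqP/(@mi_addIl (mi_unit k)).
by rewrite mi_add_sub_unit.
Qed.

(** Only the [W a] with [a] a predecessor of [al], that is [al] lowered by one at some [k] of its
    support, meet [xi al]; distinct [k] give distinct predecessors. *)
Lemma wick_sum_coefs (I : Omega -> R) (IL : I \in Lfun P 2%:E) : sumL2 P W I ->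
  cspan dotP xi_ (Lfun_Sub (lee1n 2) IL) /\
  forall al : multi_index, dotL2 P I (xi B m al) =
    \sum_(k <- finsupp al) Num.sqrt (al k)%:R * dotL2 mu (eta_ (mi_sub al (mi_unit k))) (m k).
Proof.
move=> sW; have {sW} HI : fset_limit dotP Wb (Lfun_Sub (lee1n 2) IL).
  exact: ((sumL2P Wb IL).1 sW).
split.
  apply: (fset_limit_cspan sdP xi_o HI) => a.
  by have [] := wick_coefs B_noise m_basis (WL a) (HW a).
move=> al; transitivity (\sum_(a <- [fset pred al k | k in finsupp al]%fset)
    dotL2 P (Wb a) (xi_ al)).
  refine (fset_limit_coef (v := xi_ al) (K := [fset pred al k | k in finsupp al]%fset)
    sdP HI _) => a aK.
  by apply: W_0 => k kal; apply: contraNneq aK => ->; apply/imfsetP; exists k.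
rewrite big_imfset/=; last exact: pred_inj.
by rewrite big_seq [RHS]big_seq; apply: eq_bigr => k; exact: W_pred.
Qed.

(** The [W a] need not be mutually orthogonal, so the residual is estimated coefficient by
    coefficient. At [al], Cauchy-Schwarz over the missing predecessors costs [mi_deg al], which is
    [(mi_deg a).+1] for each predecessor [a]; regrouping by [a] and [k] and Bessel's inequality for
    [eta_ a] bound the total by a tail of the assumed sum. *)
Lemma wick_sum_exists (I : L2 P) (M : R) : cspan dotP xi_ I ->
  (forall al, dotL2 P I (xi_ al) =
    \sum_(k <- finsupp al) Num.sqrt (al k)%:R * dotL2 mu (eta_ (mi_sub al (mi_unit k))) (m k)) ->
  (forall J : {fset multi_index},
    \sum_(a <- J) (mi_deg a).+1%:R * dotL2 mu (eta_ a) (eta_ a) <= M) ->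
  sumL2 P W I.
Proof.
move=> cI Ico etaM; apply/(sumL2P Wb (LfunP I)) => eps eps0.
have x0 a : 0 <= (mi_deg a).+1%:R * dotL2 mu (eta_ a) (eta_ a).
  by rewrite mulr_ge0// (inner_ge0 sdmu).
have eps2 : 0 < eps / 2 by rewrite divr_gt0.
have [J0 HJ0] := bounded_nneg_tail_fset x0 etaM eps2.
exists J0 => J J0J; have -> : Lfun_Sub (lee1n 2) (LfunP I) = I by exact: val_inj.
cbv zeta; set D := _ - _.
have cD : cspan dotP xi_ D.
  apply: (cspanB sdP xi_o); last exact: cI.
  apply: (cspan_sum sdP xi_o) => a.
  by have [] := wick_coefs B_noise m_basis (WL a) (HW a).
(* The partial sum accounts for the predecessors inside [J]; the residual keeps those outside. *)
have Dco (al : multi_index) : dotL2 P D (xi_ al) =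
    - \sum_(k <- finsupp al | pred al k \notin J) Num.sqrt (al k)%:R * y (pred al k) k.
  rewrite (innerBl sdP) (inner_suml sdP) Ico.
  rewrite [X in _ - X](bigID (fun k => pred al k \in J))/= opprD addrA.
  rewrite [X in X - _](_ : _ = 0) ?add0r//; apply/eqP; rewrite subr_eq0; apply/eqP.
  rewrite (big_fsetID _ (mem [fset pred al k | k in finsupp al]%fset))/=.
  rewrite [X in _ + X]big1_fset ?addr0; last first.
    move=> a; rewrite !inE => /andP[_ aN] _; apply: W_0 => k kal.
    by apply: contra aN => /eqP ->; apply/imfsetP; exists k.
  rewrite (_ : [fset _ | _ in J & _]%fset =
    [fset pred al k | k in [fset k in finsupp al | pred al k \in J]%fset]%fset).
    rewrite big_imfset/=; last first.
      by move=> j k; rewrite !inE => /andP[jal _] /andP[kal _]; exact: pred_inj.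
    rewrite big_fset/= big_seq_cond [RHS]big_seq_cond.
    by apply: eq_bigr => k /andP[kal _]; exact: W_pred.
  apply/fsetP => a; rewrite !inE/=; apply/andP/imfsetP => /=.
    move=> [aJ /imfsetP[k /= kal aE]]; exists k => //.
    by rewrite !inE kal -aE.
  move=> [k]; rewrite !inE => /andP[kal kJ] ->; split=> //.
  by apply/imfsetP; exists k.
apply: (@le_lt_trans _ _ (eps / 2)); last by lra.
apply: (cspan_sq_le sdP xi_o) => // A.
pose h a k := (mi_deg a).+1%:R * y a k ^+ 2.
have h0 a k : 0 <= h a k by rewrite mulr_ge0// sqr_ge0.
pose L := (\bigcup_(al <- A) finsupp al)%fset.
(* The missing predecessors of the indices in [A]: a finite set disjoint from [J0]. *)
pose J' := [fset a in (\bigcup_(al <- A) [fset pred al k | k in finsupp al])%fset |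
  a \notin J]%fset.
have h_le al : al \in A -> dotL2 P D (xi_ al) ^+ 2 <=
    \sum_(k <- L) \sum_(a <- J') (mi_add (mi_unit k) a == al)%:R * h a k.
  move=> alA; rewrite Dco sqrrN.
  have cs := sum_CauchySchwarz [seq k <- finsupp al | pred al k \notin J]
    (fun k => Num.sqrt (al k)%:R) (fun k => y (pred al k) k).
  rewrite !big_filter in cs; apply: (le_trans cs).
  have G0 k : 0 <= \sum_(a <- J') (mi_add (mi_unit k) a == al)%:R * h a k.
    by apply: sumr_ge0 => a _; rewrite mulr_ge0.
  rewrite [leRHS](big_fsetID _ (mem (finsupp al)))/= ler_wpDr ?sumr_ge0//.
  rewrite (_ : [fset _ | _ in L & _]%fset = finsupp al); last first.
    apply/fsetP => k; rewrite !inE/= andbC; case: (boolP (k \in _)) => //= kal.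
    by apply/bigfcupP; exists al => //; rewrite alA.
  have dle : \sum_(k <- finsupp al | pred al k \notin J) Num.sqrt (al k)%:R ^+ 2 <=
      (mi_deg al)%:R :> R.
    rewrite /mi_deg natr_sum [leRHS](bigID (fun k => pred al k \notin J))/= ler_wpDr ?sumr_ge0//.
    by apply: ler_sum => k _; rewrite sqr_sqrtr.
  apply: (@le_trans _ _ (\sum_(k <- finsupp al | pred al k \notin J) h (pred al k) k)).
    apply: (le_trans (ler_wpM2r _ dle)); first by apply: sumr_ge0 => k _; exact: sqr_ge0.
    rewrite mulr_sumr big_seq_cond [leRHS]big_seq_cond; apply: ler_sum => k /andP[kal _].
    by rewrite /h -{1}(mi_add_sub_unit kal) mi_degD mi_unit_deg add1n.
  rewrite big_mkcond/= big_seq [leRHS]big_seq; apply: ler_sum => k kal.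
  case: ifPn => // pJ; have pJ' : pred al k \in J'.
    rewrite !inE pJ andbT; apply/bigfcupP; exists al; first by rewrite alA.
    by apply/imfsetP; exists k.
  rewrite (big_fsetD1 _ pJ')/= /pred mi_add_sub_unit// eqxx mul1r lerDl.
  by apply: sumr_ge0 => a _; rewrite mulr_ge0.
have J'P a : a \in J' -> a \notin J0.
  by rewrite !inE => /andP[_]; apply: contra; exact: (fsubsetP J0J).
apply: (@le_trans _ _ (\sum_(a <- J') (mi_deg a).+1%:R * dotL2 mu (eta_ a) (eta_ a))); last first.
  exact/ltW/HJ0.
apply: (@le_trans _ _ (\sum_(a <- J') \sum_(k <- L) h a k)); last first.
  apply: ler_sum => a _; rewrite -mulr_sumr ler_wpM2l//.
  exact: (bessel sdmu m_orth).
apply: (@le_trans _ _ (\sum_(al <- A) \sum_(k <- L) \sum_(a <- J')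
    (mi_add (mi_unit k) a == al)%:R * h a k)).
  by rewrite big_seq [leRHS]big_seq; apply: ler_sum.
(* For fixed [a] and [k] at most one [al] in [A] equals [mi_add (mi_unit k) a], so no term is
   counted twice. *)
rewrite exchange_big/= [leRHS]exchange_big/=; apply: ler_sum => k _.
rewrite exchange_big/=; apply: ler_sum => a _.
rewrite -mulr_suml -[leRHS]mul1r ler_wpM2r//.
have [cA|cA] := boolP (mi_add (mi_unit k) a \in A).
  rewrite (big_fsetD1 _ cA)/= eqxx big1_fset ?addr0// => al.
  by rewrite !inE eq_sym => /andP[/negbTE ->].
rewrite big1_fset// => al alA _.
by case: eqVneq alA cA => // -> ->.
Qed.

End WickSums.

(** * Integration on the interval *)

Section RealFubini.
Context {d1 d2 : measure_display} {T1 : measurableType d1} {T2 : measurableType d2}.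
Context {R : realType}.
Variable m1 : {sigma_finite_measure set T1 -> \bar R}.
Variable m2 : {sigma_finite_measure set T2 -> \bar R}.
Variable f : T1 * T2 -> R.
Hypothesis mf : measurable_fun setT f.
Hypothesis f_int : (\int[m1]_x \int[m2]_y (`|f (x, y)|)%:E < +oo)%E.

Let f_prod : (m1 \x m2)%E.-integrable setT (EFin \o f).
Proof. by apply/integrable12ltyP => //; exact/measurable_EFinP. Qed.

Lemma Rfubini_ae1 : {ae m1, forall x, m2.-integrable setT (fun y => (f (x, y))%:E)}.
Proof. exact: (ae_integrable1 f_prod). Qed.

Lemma Rfubini_ae2 : {ae m2, forall y, m1.-integrable setT (fun x => (f (x, y))%:E)}.
Proof. exact: (ae_integrable2 f_prod). Qed.

Lemma measurable_Rfubini1 : measurable_fun setT (fun x => \int[m2]_y f (x, y)).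
Proof.
apply: (@measurableT_comp _ _ _ _ _ _ (@fine R)) => //.
exact: (measurable_fubini_F f_prod).
Qed.

Lemma measurable_Rfubini2 : measurable_fun setT (fun y => \int[m1]_x f (x, y)).
Proof.
apply: (@measurableT_comp _ _ _ _ _ _ (@fine R)) => //.
exact: (measurable_fubini_G f_prod).
Qed.

Let ae_fin1 : ae_eq m1 setT (fun x => (\int[m2]_y f (x, y))%:E)
  (fun x => \int[m2]_y (f (x, y))%:E)%E.
Proof.
by apply: filterS Rfubini_ae1 => x h _; rewrite fineK//; exact: integrable_fin_num.
Qed.

Let ae_fin2 : ae_eq m2 setT (fun y => (\int[m1]_x f (x, y))%:E)
  (fun y => \int[m1]_x (f (x, y))%:E)%E.
Proof.
by apply: filterS Rfubini_ae2 => y h _; rewrite fineK//; exact: integrable_fin_num.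
Qed.

Lemma Rfubini : \int[m1]_x \int[m2]_y f (x, y) = \int[m2]_y \int[m1]_x f (x, y).
Proof.
rewrite /Rintegral; congr fine; have F := Fubini f_prod.
transitivity (\int[m1]_x (\int[m2]_y (f (x, y))%:E))%E.
  apply: ae_eq_integral => //; first exact/measurable_EFinP/measurable_Rfubini1.
  exact: (measurable_fubini_F f_prod).
rewrite F; apply/esym; apply: ae_eq_integral => //.
  exact/measurable_EFinP/measurable_Rfubini2.
exact: (measurable_fubini_G f_prod).
Qed.

End RealFubini.

Section LebInterval.
Context {R : realType}.
Variable T : R.

Lemma lebesgue_measure_oo_lty (a b : R) : (@lebesgue_measure R `]a, b[ < +oo)%E.
Proof. by rewrite lebesgue_measure_itv/=; case: ifP => _; rewrite -?EFinB ltry. Qed.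

(* [leb T] is only a measure; this copy carries the finiteness that Fubini needs. *)
Definition fleb : {finite_measure set (measurableTypeR R) -> \bar R} :=
  @mfrestr _ (measurableTypeR R) R `]0, T[ (@lebesgue_measure R)
    (measurable_itv `]0, T[) (lebesgue_measure_oo_lty 0 T).

Lemma integral_fleb (f : R -> \bar R) : (\int[fleb]_x f x = \int[leb T]_x f x)%E.
Proof. exact: eq_measure_integral. Qed.

Lemma Rintegral_fleb (f : R -> R) : \int[fleb]_x f x = \int[leb T]_x f x.
Proof. by rewrite /Rintegral integral_fleb. Qed.

Lemma leb_aeS (A B : R -> Prop) : (forall x, A x -> B x) ->
  {ae leb T, forall x, A x} -> {ae leb T, forall x, B x}.
Proof.
have F : Filter (nbhs (almost_everywhere (leb T))) by exact: ae_filter_ringOfSetsType.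
by move=> AB; exact: filterS.
Qed.

Lemma leb_aeI (A B : R -> Prop) : {ae leb T, forall x, A x} ->
  {ae leb T, forall x, B x} -> {ae leb T, forall x, A x /\ B x}.
Proof.
have F : Filter (nbhs (almost_everywhere (leb T))) by exact: ae_filter_ringOfSetsType.
by move=> hA hB; exact: filterI.
Qed.

Lemma integrable_fleb (f : R -> \bar R) :
  fleb.-integrable setT f <-> (leb T).-integrable setT f.
Proof.
by split=> /integrableP[mf]; [rewrite integral_fleb|rewrite -integral_fleb] => h;
  apply/integrableP.
Qed.

Lemma leb_itv_le (s t : R) : s <= t -> (leb T [set` `]s, t]%R] <= (t - s)%:E)%E.
Proof.
move=> st; apply: (@le_trans _ _ (@lebesgue_measure R [set` `]s, t]%R])).
  by apply: le_measure; rewrite ?inE//; exact: measurableI.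
by rewrite lebesgue_measure_itv/= lte_fin; case: ifP => // _; rewrite lee_fin subr_ge0.
Qed.

Lemma leb_set1 (x : R) : leb T [set x] = 0%E.
Proof.
apply/eqP; rewrite eq_le measure_ge0 andbT -(lebesgue_measure_set1 x).
by apply: le_measure; rewrite ?inE//; exact: measurableI.
Qed.

Lemma leb_ae_itv : {ae leb T, forall s, 0 <= s <= T}.
Proof.
exists (~` `]0, T[); split; first exact: measurableC.
  by rewrite /leb/= /mrestr setICl measure0.
by move=> s /= h h'; apply: h; move: h'; rewrite /= in_itv/= => /andP[/ltW-> /ltW->].
Qed.

Lemma L2_leb_integrable (f : R -> R) : f \in Lfun (leb T) 2%:E ->
  (leb T).-integrable setT (fun x => (f x)%:E).
Proof.
move=> fL; have fin : leb T setT \is a fin_num by exact: (fin_num_measure fleb).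
by have /Lfun1_integrable := Lfun_subset12 fin fL.
Qed.

Lemma chiE (t x : R) : chi T t x = ((0 <= x <= t)%R : bool)%:R.
Proof. by rewrite /= indicE mem_setE in_itv. Qed.

Lemma measurable_chi2 : measurable_fun [set: measurableTypeR R * measurableTypeR R]
  (fun z => chi T z.1 z.2).
Proof.
rewrite (_ : (fun z => _) = fun z : R * R => if (0 <= z.2) && (z.2 <= z.1) then 1 else 0).
  apply: measurable_fun_ifT => //.
  by apply: measurable_and; apply: measurable_fun_ler.
by apply/funext => z; rewrite chiE; case: ifP.
Qed.

End LebInterval.

Section Primitive.
Context {R : realType}.
Variable T : R.
Local Notation lb := (leb T).

Definition prim (f : R -> R) (t : R) : R := \int[lb]_x (chi T t x * f x).

Lemma chi01 t x : 0 <= chi T t x <= 1.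
Proof. by rewrite chiE; case: (0 <= x <= t); rewrite ?lexx ?ler01. Qed.

Lemma abs_chi_le t x : `|chi T t x| <= 1.
Proof. by have /andP[h1 h2] := chi01 t x; rewrite ger0_norm. Qed.

(** Off the diagonal, the square over [[0, t]] is the disjoint union of its two triangles. *)
Lemma chi_split t x y : y != x ->
  chi T t x * chi T x y + chi T t y * chi T y x = chi T t x * chi T t y.
Proof.
rewrite neq_lt !chiE => /orP[yx|xy].
  rewrite (lt_geF yx) andbF mulr0 addr0 (ltW yx) andbT.
  case: (boolP (0 <= x <= t)) => [/andP[_ xt]|_]; last by rewrite !mul0r.
  by rewrite (le_trans (ltW yx) xt) andbT.
rewrite (lt_geF xy) andbF mulr0 add0r (ltW xy) andbT [RHS]mulrC.
case: (boolP (0 <= y <= t)) => [/andP[_ yt]|_]; last by rewrite !mul0r.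
by rewrite (le_trans (ltW xy) yt) andbT.
Qed.

Lemma measurable_chi t : measurable_fun setT (chi T t : R -> R).
Proof. exact: measurable_indic. Qed.

Lemma integrable_bounded_mul (F g : R -> R) (C : R) : measurable_fun setT F ->
  (forall x, `|F x| <= C) -> lb.-integrable setT (fun x => (g x)%:E) ->
  lb.-integrable setT (fun x => (F x * g x)%:E).
Proof.
move=> mF FC ig; have := integrableZl measurableT C ig.
have mg : measurable_fun setT g by apply/measurable_EFinP; exact: measurable_int ig.
apply: le_integrable => //; first by apply/measurable_EFinP/measurable_funM.
move=> x _; rewrite -EFinM !abse_EFin lee_fin !normrM ler_wpM2r//.
exact: (le_trans (FC x) (ler_norm C)).
Qed.

Lemma integrable_chi_mul t (f : R -> R) : lb.-integrable setT (fun x => (f x)%:E) ->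
  lb.-integrable setT (fun x => (chi T t x * f x)%:E).
Proof. exact: integrable_bounded_mul (measurable_chi t) (abs_chi_le t). Qed.

Lemma fubini_finite_mul (h : R * R -> R) (f g : R -> R) :
  measurable_fun [set: measurableTypeR R * measurableTypeR R] h ->
  lb.-integrable setT (fun x => (f x)%:E) -> lb.-integrable setT (fun x => (g x)%:E) ->
  (forall x y, `|h (x, y)| <= `|g x| * `|f y|) ->
  (\int[fleb T]_x \int[fleb T]_y (`|h (x, y)|)%:E < +oo)%E.
Proof.
move=> mh /integrable_fleb/integrableP[mf fi] /integrable_fleb/integrableP[mg gi] hle.
have Cf0 : (0 <= \int[fleb T]_y `|(f y)%:E|)%E by apply: integral_ge0.
apply: (@le_lt_trans _ _ (\int[fleb T]_x (`|(g x)%:E| * \int[fleb T]_y `|(f y)%:E|)))%E; last first.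
  rewrite ge0_integralZr//; last exact: measurableT_comp.
  by rewrite lte_mul_pinfty// ?integral_ge0// ge0_fin_numE// integral_ge0.
have mh' : measurable_fun setT (fun z : measurableTypeR R * measurableTypeR R => (`|h z|)%:E).
  by apply/measurable_EFinP; exact: measurableT_comp.
apply: ge0_le_integral => //.
- by move=> x _; apply: integral_ge0 => y _; rewrite lee_fin.
- exact: (measurable_fun_fubini_tonelli_F _ mh').
- by apply: emeasurable_funM => //; exact: measurableT_comp.
- move=> x _; rewrite -ge0_integralZl//; last exact: measurableT_comp.
  apply: ge0_le_integral => //.
  + exact: (measurableT_comp mh' (measurable_pair1 _)).
  + by apply: emeasurable_funM => //; exact: measurableT_comp.
  + by move=> y _; rewrite !abse_EFin -EFinM lee_fin.
Qed.

Lemma abs_Rintegral_chi_le (phi f : R -> R) : measurable_fun setT phi ->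
  (forall x, `|phi x| <= 1) -> lb.-integrable setT (fun x => (f x)%:E) ->
  `|\int[lb]_x (phi x * f x)| <= \int[lb]_x `|f x|.
Proof.
move=> mphi phi1 fi; have ip := integrable_bounded_mul mphi phi1 fi.
apply: (le_trans (le_normr_Rintegral measurableT ip)).
apply: le_Rintegral => //.
- exact: (integrable_norm ip).
- exact: (integrable_norm fi).
- by move=> x _; rewrite normrM ler_piMl.
Qed.

Lemma prim_bounded f t : lb.-integrable setT (fun x => (f x)%:E) ->
  `|prim f t| <= \int[lb]_x `|f x|.
Proof. exact: abs_Rintegral_chi_le (measurable_chi t) (abs_chi_le t). Qed.

Lemma leb_integrable_cst (c : R) : lb.-integrable setT (fun=> c%:E).
Proof. by apply/integrable_fleb; exact: (finite_measure_integrable_cst (fleb T) c). Qed.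

Lemma measurable_prim f : lb.-integrable setT (fun x => (f x)%:E) ->
  measurable_fun setT (prim f).
Proof.
move=> fi; have mf : measurable_fun setT f by apply/measurable_EFinP; exact: measurable_int fi.
have mh : measurable_fun [set: measurableTypeR R * measurableTypeR R]
    (fun z => chi T z.1 z.2 * f z.2).
  by apply: measurable_funM; [exact: measurable_chi2|exact: measurableT_comp].
have := @measurable_Rfubini1 _ _ _ _ _ (fleb T) (fleb T) _ mh
  (fubini_finite_mul mh fi (leb_integrable_cst 1) _).
under eq_fun do rewrite Rintegral_fleb; apply.
by move=> x y /=; rewrite normr1 normrM ler_wpM2r// abs_chi_le.
Qed.

(** The product is an integral over a square, which [chi_split] cuts into two triangles; Fubini
    exchanges the variables on one of them, so that both are integrated against [g] outermost. *)
Lemma prim_mul f g t : lb.-integrable setT (fun x => (f x)%:E) ->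
  lb.-integrable setT (fun x => (g x)%:E) ->
  prim f t * prim g t =
  prim (fun x => prim f x * g x) t + prim (fun x => f x * prim g x) t.
Proof.
move=> fi gi.
have mf : measurable_fun setT f by apply/measurable_EFinP; exact: measurable_int fi.
have mg : measurable_fun setT g by apply/measurable_EFinP; exact: measurable_int gi.
pose h (z : R * R) := chi T t z.1 * chi T z.1 z.2 * f z.1 * g z.2.
have mh : measurable_fun [set: measurableTypeR R * measurableTypeR R] h.
  apply: measurable_funM; last exact: measurableT_comp.
  apply: measurable_funM; last exact: measurableT_comp.
  apply: measurable_funM; last exact: measurable_chi2.
  by apply: measurableT_comp => //; exact: measurable_chi.
have h_le x y : `|h (x, y)| <= `|f x| * `|g y|.
  rewrite /h/= !normrM ler_wpM2r// ler_piMl// mulr_ile1//; exact: abs_chi_le.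
have h_int := fubini_finite_mul mh gi fi h_le.
have Fub := Rfubini mh h_int.
have mh2 := measurable_Rfubini2 mh h_int.
(* With [x] the argument of [g], [k1] integrates [f] over the later times up to [t] and [k2] over
   the earlier ones. *)
pose k1 x := \int[lb]_y (chi T t y * chi T y x * f y).
pose k2 x := \int[lb]_y (chi T t x * chi T x y * f y).
have chi2_meas x : measurable_fun setT (fun y => chi T t y * chi T y x).
  apply: measurable_funM; first exact: measurable_chi.
  exact: (measurableT_comp (measurable_chi2 T) (measurable_pair2 x)).
have chi2_le x y : `|chi T t y * chi T y x| <= 1.
  by rewrite normrM mulr_ile1// abs_chi_le.
have chi3_meas x : measurable_fun setT (fun y => chi T t x * chi T x y).
  by apply: measurable_funM => //; exact: measurable_chi.
have chi3_le x y : `|chi T t x * chi T x y| <= 1.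
  by rewrite normrM mulr_ile1// abs_chi_le.
have E1 : prim (fun x => f x * prim g x) t = \int[lb]_x (k1 x * g x).
  transitivity (\int[fleb T]_x \int[fleb T]_y h (x, y)).
    rewrite Rintegral_fleb; apply: eq_Rintegral => x _.
    rewrite Rintegral_fleb mulrA /prim -RintegralZl//; last exact: integrable_chi_mul.
    by apply: eq_Rintegral => y _; rewrite /h/=; ring.
  rewrite Fub Rintegral_fleb; apply: eq_Rintegral => y _.
  rewrite Rintegral_fleb /k1 -RintegralZr//.
  exact: integrable_bounded_mul (chi2_meas y) (chi2_le y) fi.
have E2 : prim (fun x => prim f x * g x) t = \int[lb]_x (k2 x * g x).
  apply: eq_Rintegral => x _; rewrite mulrA; congr (_ * _).
  rewrite /prim -RintegralZl//; last exact: integrable_chi_mul.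
  by apply: eq_Rintegral => y _; rewrite mulrA.
have mk1 : measurable_fun setT k1.
  pose h1 (z : R * R) := chi T t z.1 * chi T z.1 z.2 * f z.1.
  have mh1 : measurable_fun [set: measurableTypeR R * measurableTypeR R] h1.
    apply: measurable_funM; last exact: measurableT_comp.
    apply: measurable_funM; last exact: measurable_chi2.
    by apply: measurableT_comp => //; exact: measurable_chi.
  have h1_le x y : `|h1 (x, y)| <= `|f x| * `|1|.
    by rewrite /h1/= !normrM normr1 mulr1 ler_piMl// mulr_ile1// abs_chi_le.
  have := measurable_Rfubini2 mh1 (fubini_finite_mul mh1 (leb_integrable_cst 1) fi h1_le).
  by under eq_fun do rewrite Rintegral_fleb.
have mk2 : measurable_fun setT k2.
  rewrite (_ : k2 = fun x => chi T t x * prim f x).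
    by apply: measurable_funM; [exact: measurable_chi|exact: measurable_prim].
  apply/funext => x; rewrite /prim -RintegralZl//; last exact: integrable_chi_mul.
  by apply: eq_Rintegral => y _; rewrite mulrA.
have k1_le x : `|k1 x| <= \int[lb]_y `|f y|.
  exact: (abs_Rintegral_chi_le (chi2_meas x) (chi2_le x) fi).
have k2_le x : `|k2 x| <= \int[lb]_y `|f y|.
  exact: (abs_Rintegral_chi_le (chi3_meas x) (chi3_le x) fi).
rewrite E1 E2 -RintegralD//; [|exact: integrable_bounded_mul mk2 k2_le gi|
  exact: integrable_bounded_mul mk1 k1_le gi].
rewrite {2}/prim -RintegralZl//; last exact: integrable_chi_mul.
apply: eq_Rintegral => x _; rewrite mulrA -mulrDl; congr (_ * _).
rewrite /k1 /k2 -RintegralD//; [|exact: integrable_bounded_mul (chi3_meas x) (chi3_le x) fi|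
  exact: integrable_bounded_mul (chi2_meas x) (chi2_le x) fi].
rewrite /prim -RintegralZr//; last exact: integrable_chi_mul.
congr fine; apply: ae_eq_integral => //.
- by apply/measurable_EFinP; do 2 apply: measurable_funM => //; exact: measurable_chi.
- by apply/measurable_EFinP/measurable_funD; apply: measurable_funM.
(* [chi_split] may fail only at [y = x], a null set. *)
exists [set x]; split; [exact: measurable_set1|exact: leb_set1|].
move=> y; apply: contra_notP => /eqP yx _; congr EFin.
by rewrite -mulrDl chi_split// mulrAC [chi T t x * _]mulrC.
Qed.

End Primitive.

(** * Coefficients of the stochastic exponential *)

Section Density.
Context {R : realType}.
Variable T : R.
Local Notation lb := (leb T).
Local Notation prim := (prim T).

(** A stand-in for absolute continuity that is closed under products. As [prim] vanishes at negative
    times, the constant [c] is the value of [F] there. *)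
Definition has_density (F f : R -> R) :=
  [/\ measurable_fun setT F, exists C, forall t, `|F t| <= C,
      lb.-integrable setT (fun x => (f x)%:E) & exists c, forall t, F t = c + prim f t].

Lemma integrable_sum_real I (r : seq I) (f : I -> R -> R) :
  (forall i, lb.-integrable setT (fun x => (f i x)%:E)) ->
  lb.-integrable setT (fun x => (\sum_(i <- r) f i x)%:E).
Proof.
move=> fi; under eq_fun do rewrite -sumEFin.
exact: integrable_sum.
Qed.

Lemma prim_cst_l c f t : lb.-integrable setT (fun x => (f x)%:E) ->
  prim (fun x => c * f x) t = c * prim f t.
Proof.
move=> fi; rewrite /prim -RintegralZl//; last exact: integrable_chi_mul.
by apply: eq_Rintegral => x _; rewrite mulrCA.
Qed.

Lemma prim_add f g t : lb.-integrable setT (fun x => (f x)%:E) ->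
  lb.-integrable setT (fun x => (g x)%:E) ->
  prim (fun x => f x + g x) t = prim f t + prim g t.
Proof.
move=> fi gi; rewrite /prim -RintegralD//; [|exact: integrable_chi_mul|exact: integrable_chi_mul].
by apply: eq_Rintegral => x _; rewrite mulrDr.
Qed.

Lemma prim_eq f g t : f =1 g -> prim f t = prim g t.
Proof. by move=> fg; apply: eq_Rintegral => x _; rewrite fg. Qed.

Lemma prim_sum I (r : seq I) (f : I -> R -> R) t :
  (forall i, lb.-integrable setT (fun x => (f i x)%:E)) ->
  prim (fun x => \sum_(i <- r) f i x) t = \sum_(i <- r) prim (f i) t.
Proof.
move=> fi; elim: r => [|i r IH].
  rewrite big_nil /prim; under eq_Rintegral do rewrite big_nil mulr0.
  by rewrite /Rintegral integral0.
rewrite big_cons -IH -prim_add//; last exact: integrable_sum_real.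
by apply: prim_eq => x; rewrite big_cons.
Qed.

Lemma has_density_ext F F' f f' : F =1 F' -> f =1 f' ->
  has_density F f -> has_density F' f'.
Proof. by move=> /funext -> /funext ->. Qed.

Lemma has_density_mul F f G g : has_density F f -> has_density G g ->
  has_density (fun t => F t * G t) (fun t => F t * g t + f t * G t).
Proof.
move=> [mF [C FC] fi [c Fc]] [mG [C' GC'] gi [c' Gc']].
have Fg : lb.-integrable setT (fun x => (F x * g x)%:E) by exact: integrable_bounded_mul mF FC gi.
have fG : lb.-integrable setT (fun x => (f x * G x)%:E).
  under eq_fun do rewrite mulrC; exact: integrable_bounded_mul mG GC' fi.
split.
- exact: measurable_funM.
- by exists (C * C') => t; rewrite normrM ler_pM.
- by under eq_fun do rewrite EFinD; exact: integrableD.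
have mpf := measurable_prim fi; have mpg := measurable_prim gi.
have pfg : lb.-integrable setT (fun x => (prim f x * g x)%:E).
  exact: integrable_bounded_mul mpf (fun x => prim_bounded x fi) gi.
have fpg : lb.-integrable setT (fun x => (f x * prim g x)%:E).
  by under eq_fun do rewrite mulrC; exact: integrable_bounded_mul mpg (fun x => prim_bounded x gi) fi.
have cg : lb.-integrable setT (fun x => (c * g x)%:E) by exact: (integrableZl measurableT c gi).
have c'f : lb.-integrable setT (fun x => (c' * f x)%:E) by exact: (integrableZl measurableT c' fi).
exists (c * c') => t; rewrite prim_add//.
rewrite (@prim_eq (fun x => F x * g x) (fun x => c * g x + prim f x * g x)); last first.
  by move=> x; rewrite Fc mulrDl.
rewrite (@prim_eq (fun x => f x * G x) (fun x => c' * f x + f x * prim g x)); last first.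
  by move=> x; rewrite Gc' mulrDr mulrC.
rewrite !prim_add// !prim_cst_l// Fc Gc' mulrDl !mulrDr (prim_mul t fi gi); ring.
Qed.

Lemma has_density_cst c : has_density (fun=> c) (fun=> 0).
Proof.
split; [exact: measurable_cst|by exists `|c|%R|exact: leb_integrable_cst|].
exists c => t; rewrite /prim; under eq_Rintegral do rewrite mulr0.
by rewrite /Rintegral integral0 addr0.
Qed.

Lemma has_density_prim f : lb.-integrable setT (fun x => (f x)%:E) ->
  has_density (prim f) f.
Proof.
move=> fi; split=> //; first exact: measurable_prim.
  by exists (\int[lb]_x `|f x|) => t; exact: prim_bounded.
by exists 0 => t; rewrite add0r.
Qed.

Lemma has_densityX F f n : has_density F f ->
  has_density (fun t => F t ^+ n) (fun t => n%:R * F t ^+ n.-1 * f t).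
Proof.
move=> h; elim: n => [|n IH].
  by apply: has_density_ext (has_density_cst 1) => t; rewrite ?expr0 ?mul0r.
apply: has_density_ext (has_density_mul h IH) => t; first by rewrite exprS.
case: n {IH} => [|n] /=; first by rewrite !expr0 mulr0n !mul0r mulr0 add0r mulr1 !mul1r.
by rewrite exprS -[n.+2]addn1 natrD; ring.
Qed.

Lemma has_density_prod (s : seq nat) (F f : nat -> R -> R) : uniq s ->
  (forall k, has_density (F k) (f k)) ->
  has_density (fun t => \prod_(k <- s) F k t)
    (fun t => \sum_(k <- s) f k t * \prod_(j <- s | j != k) F j t).
Proof.
move=> us h; elim: s us => [_|k s IH /= /andP[ks us]].
  by apply: has_density_ext (has_density_cst 1) => t; rewrite big_nil.
apply: has_density_ext (has_density_mul (h k) (IH us)) => t; rewrite !big_cons//.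
rewrite eqxx/= addrC; congr (_ * _ + _).
  rewrite big_seq [RHS]big_seq_cond; apply: eq_big => [j|//].
  by case: (boolP (j \in s)) => //= js; case: eqVneq js ks => // -> ->.
rewrite mulr_sumr big_seq [RHS]big_seq; apply: eq_bigr => j js.
by rewrite big_cons (_ : k != j); [ring|apply: contraNneq ks => ->].
Qed.

Lemma prim_before0 f t : t < 0 -> prim f t = 0.
Proof.
move=> t0; rewrite /prim (_ : (fun x => _) = fun=> 0); first by rewrite /Rintegral integral0.
apply/funext => x; rewrite chiE; case: andP => [[x0 xt]|]; last by rewrite mul0r.
by have := le_lt_trans (le_trans x0 xt) t0; rewrite ltxx.
Qed.

Section CoefficientIdentity.
Variable b : nat -> R -> R.
Hypothesis bi : forall k, lb.-integrable setT (fun x => (b k x)%:E).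
Let c (t : R) (a : multi_index) : R := mi_coef (fun k => prim (b k) t) a.

(** The derivative of [x^n / sqrt (n!)] is [sqrt n] times the same expression for [n - 1]: this
    normalisation is the origin of the factors [Num.sqrt (a k)%:R]. *)
Lemma mi_coef_density (a : multi_index) : has_density (c ^~ a)
  (fun s => \sum_(k <- finsupp a) Num.sqrt (a k)%:R * (c s (mi_sub a (mi_unit k)) * b k s)).
Proof.
have h k := has_density_mul (has_densityX (a k) (has_density_prim (bi k)))
  (has_density_cst (Num.sqrt (a k)`!%:R)^-1).
apply: has_density_ext (has_density_prod (fset_uniq (finsupp a)) h) => // t.
rewrite big_seq [RHS]big_seq; apply: eq_bigr => k ka.
have us := fset_uniq (finsupp a).
rewrite mulr0 add0r /c (@mi_coef_widen _ _ _ (finsupp a))//; last first.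
  by move=> j; rewrite !mem_finsupp mi_subE; case: (a j).
rewrite !(big_fsetD1 k ka)/= mi_subE mi_unitE eqxx subn1.
have -> : \prod_(j <- finsupp a | j != k) (prim (b j) t ^+ a j / Num.sqrt (a j)`!%:R) =
    \prod_(j <- (finsupp a `\ k)%fset) (prim (b j) t ^+ mi_sub a (mi_unit k) j /
      Num.sqrt (mi_sub a (mi_unit k) j)`!%:R).
  rewrite -big_filter (perm_big (finsupp a `\ k)%fset)/=.
    rewrite big_seq [RHS]big_seq; apply: eq_bigr => j; rewrite in_fsetD1 => /andP[jk _].
    by rewrite mi_subE mi_unitE (negbTE jk) subn0.
  apply: uniq_perm; [exact: filter_uniq|exact: fset_uniq|].
  by move=> j; rewrite mem_filter in_fsetD1.
set p := \prod_(_ <- _) _.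
have : (0 < a k)%N by rewrite lt0n -mem_finsupp.
case: (a k) => // n _ /=; rewrite factS natrM sqrtrM ?ler0n//.
have n0 : Num.sqrt n.+1%:R != 0 :> R by rewrite sqrtr_eq0 -ltNge ltr0n.
have f0 : Num.sqrt n`!%:R != 0 :> R by rewrite sqrtr_eq0 -ltNge ltr0n fact_gt0.
have e : n.+1%:R = Num.sqrt n.+1%:R ^+ 2 :> R by rewrite sqr_sqrtr.
move: n0 f0 e; move: (Num.sqrt n.+1%:R) (Num.sqrt n`!%:R) => r q r0 q0 ->.
by field; rewrite r0 q0.
Qed.

Lemma mi_coef_prim (a : multi_index) t : c t a = mi_coef (fun=> 0) a +
  \sum_(k <- finsupp a) Num.sqrt (a k)%:R *
    prim (fun s => c s (mi_sub a (mi_unit k)) * b k s) t.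
Proof.
have [_ _ _ [e He]] := mi_coef_density a.
have cb k : lb.-integrable setT (fun s => (c s (mi_sub a (mi_unit k)) * b k s)%:E).
  have [mF [C FC] _ _] := mi_coef_density (mi_sub a (mi_unit k)).
  exact: integrable_bounded_mul mF FC (bi k).
have sb k : lb.-integrable setT
    (fun s => (Num.sqrt (a k)%:R * (c s (mi_sub a (mi_unit k)) * b k s))%:E).
  exact: (integrableZl measurableT _ (cb k)).
have He' s : c s a = e + \sum_(k <- finsupp a) Num.sqrt (a k)%:R *
    prim (fun s => c s (mi_sub a (mi_unit k)) * b k s) s.
  by rewrite He prim_sum//; congr (_ + _); apply: eq_bigr => k _; rewrite prim_cst_l.
(* At the negative time -1 every primitive vanishes, which identifies the constant. *)
rewrite He'; congr (_ + _); have := He' (-1); rewrite big1 ?addr0.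
  move=> <-; congr mi_coef; apply/funext => k; apply: prim_before0; lra.
by move=> k _; rewrite prim_before0 ?mulr0//; lra.
Qed.

End CoefficientIdentity.

(** An inequality rather than an equality, because [leb T] only sees the part of the interval inside
    []0, T[]. *)
Lemma chi_dist s t : dotL2 lb (chi T t - chi T s) (chi T t - chi T s) <= `|t - s|.
Proof.
wlog st : s t / s <= t.
  move=> H; case: (leP s t) => [|/ltW] ts; first exact: H.
  rewrite distrC; apply: le_trans (H _ _ ts); rewrite -(opprB (chi T s)).
  by rewrite (innerNl (dotL2_semi_inner lb)) (innerNr (dotL2_semi_inner lb)) opprK.
rewrite ger0_norm ?subr_ge0// -lee_fin (dotL2_sqE (LfunP _)).
apply: le_trans (leb_itv_le T st).
have -> : (lb [set` `]s, t]%R] = \int[lb]_x (\1_[set` `]s, t]%R] x)%:E)%E.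
  by rewrite integral_indic// setIT.
apply: ge0_le_integral => //.
- by move=> x _; rewrite lee_fin sqr_ge0.
- apply/measurable_EFinP; apply: measurable_funX.
  by apply: measurable_funB; exact: measurable_chi.
- by apply/measurable_EFinP; exact: measurable_indic.
move=> x _; rewrite lee_fin -[X in X ^+ 2]/(chi T t x - chi T s x) !chiE indicE mem_setE in_itv/=.
case: (lerP 0 x) => x0 /=; last by rewrite subrr expr0n.
case: (leP x s) => xs /=; first by rewrite (le_trans xs st) subrr expr0n.
by rewrite subr0; case: (x <= t); rewrite ?expr1n ?expr0n.
Qed.

End Density.

(** * Uniqueness *)

Section AdjointBounds.
Context {d : measure_display} {S : measurableType d} {R : realType}.
Variable mu : {measure set S -> \bar R}.
Variables K Ks : L2 mu -> L2 mu.
Hypothesis K_bounded : bounded_operator K.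
Hypothesis Ks_adjoint : adjoint_of K Ks.
Let sd := dotL2_semi_inner mu.

Lemma adjointE (f g : L2 mu) : dotL2 mu (Ks f) g = dotL2 mu f (K g).
Proof. by rewrite (innerC sd) -Ks_adjoint (innerC sd). Qed.

(** [Ks] is given through its pairing, so [D], an image or a difference of images, is controlled by
    rewriting its square norm as a pairing with [K D] and applying Cauchy-Schwarz. The constant is
    the square of the operator bound of [K]. *)
Lemma adjoint_bounded : exists2 C, 0 <= C & forall f g : L2 mu,
  dotL2 mu (Ks f - Ks g) (Ks f - Ks g) <= C * dotL2 mu (f - g) (f - g) /\
  dotL2 mu (Ks f) (Ks f) <= C * dotL2 mu f f.
Proof.
have [_ [C KC]] := K_bounded.
have KC2 f : dotL2 mu (K f) (K f) <= C ^+ 2 * dotL2 mu f f.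
  have := KC f; rewrite !normL2E; try exact: LfunP.
  rewrite -EFinM lee_fin => h.
  rewrite -[leLHS]sqr_sqrtr ?(inner_ge0 sd)// -[X in _ * X]sqr_sqrtr ?(inner_ge0 sd)//.
  rewrite -exprMn; have := sqrtr_ge0 (dotL2 mu (K f) (K f)); nra.
have key (f D : L2 mu) : dotL2 mu D D = dotL2 mu f (K D) -> dotL2 mu D D <= C ^+ 2 * dotL2 mu f f.
  move=> DE; have D0 := inner_ge0 sd D; have [->|Dn0] := eqVneq (dotL2 mu D D) 0.
    by rewrite mulr_ge0 ?sqr_ge0 ?(inner_ge0 sd).
  have Dp : 0 < dotL2 mu D D by rewrite lt_neqAle eq_sym Dn0.
  rewrite -(ler_pM2r Dp) -expr2 {1}DE.
  apply: (le_trans (inner_CauchySchwarz sd _ _)).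
  by rewrite mulrAC mulrC ler_wpM2r ?(inner_ge0 sd).
exists (C ^+ 2) => [|f g]; first exact: sqr_ge0.
split; apply: key; last by rewrite adjointE.
by rewrite (innerBl sd) !adjointE -(innerBl sd).
Qed.

End AdjointBounds.

(** * Exchange of expectation and time integration *)

Section EtaFubini.
Context {R : realType} {d : measure_display} {Omega : measurableType d}.
Variables (P : probability Omega R) (T : R).
Local Notation H := (L2 (leb T)).

Definition jointly_measurable (eta : Omega -> H) :=
  measurable_fun [set: measurableTypeR R * Omega] (fun z : measurableTypeR R * Omega => eta z.2 z.1).

Lemma eta_tonelli (eta : Omega -> H) : jointly_measurable eta ->
  (\int[P]_w (dotL2 (leb T) (eta w) (eta w))%:E =
   \int[leb T]_s \int[P]_w ((eta w s) ^+ 2)%:E)%E.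
Proof.
move=> me; rewrite -integral_fleb.
have msq : measurable_fun [set: measurableTypeR R * Omega]
    (fun z : measurableTypeR R * Omega => ((eta z.2 z.1) ^+ 2)%:E).
  by apply/measurable_EFinP; exact: measurable_funX.
rewrite (@fubini_tonelli _ _ _ _ _ (fleb T) P _ msq)/=; last first.
  by move=> z; rewrite lee_fin sqr_ge0.
by apply: eq_integral => w _; rewrite integral_fleb dotL2_sqE//; exact: LfunP.
Qed.

Section Fixed.
Variable eta : Omega -> H.
Hypothesis me : jointly_measurable eta.
Hypothesis eta_fin : (\int[P]_w (dotL2 (leb T) (eta w) (eta w))%:E < +oo)%E.
Variables (g : H) (Y : L2 P).
Let h (z : R * Omega) := eta z.2 z.1 * g z.1 * Y z.2.

Let mh : measurable_fun [set: measurableTypeR R * Omega] h.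
Proof.
apply: measurable_funM; first apply: measurable_funM => //.
  exact: (measurableT_comp (L2_measurable (LfunP g))).
exact: (measurableT_comp (L2_measurable (LfunP Y))).
Qed.

Let h_int : (\int[fleb T]_s \int[P]_w (`|h (s, w)|)%:E < +oo)%E.
Proof.
have mg := L2_measurable (LfunP g); have mY := L2_measurable (LfunP Y).
pose k1 (z : measurableTypeR R * Omega) : \bar R := ((eta z.2 z.1) ^+ 2)%:E.
pose k2 (z : measurableTypeR R * Omega) : \bar R := ((g z.1) ^+ 2 * (Y z.2) ^+ 2)%:E.
have mk1 : measurable_fun setT k1 by apply/measurable_EFinP/measurable_funX.
have mk2 : measurable_fun setT k2.
  apply/measurable_EFinP/measurable_funM; apply: measurable_funX.
    exact: (measurableT_comp mg).
  exact: (measurableT_comp mY).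
have k10 z : (0 <= k1 z)%E by rewrite lee_fin sqr_ge0.
have k20 z : (0 <= k2 z)%E by rewrite lee_fin mulr_ge0 ?sqr_ge0.
have mh' : measurable_fun setT (fun z : measurableTypeR R * Omega => (`|h z|)%:E).
  by apply/measurable_EFinP; exact: measurableT_comp.
(* The integrand is dominated through [|x * y| <= x ^+ 2 + y ^+ 2], with [x] the path and
   [y = g s * Y w]; both squares have finite integral. *)
apply: (@le_lt_trans _ _ (\int[fleb T]_s \int[P]_w (k1 (s, w) + k2 (s, w))))%E.
  apply: ge0_le_integral => //.
  - by move=> s _; apply: integral_ge0 => w _; rewrite lee_fin.
  - exact: (measurable_fun_fubini_tonelli_F _ mh').
  - apply: (measurable_fun_fubini_tonelli_F (fun z => k1 z + k2 z)%E).
      exact: emeasurable_funD.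
    by move=> z; rewrite adde_ge0.
  - move=> s _; apply: ge0_le_integral => //.
    + exact: (measurableT_comp mh' (measurable_pair1 _)).
    + by apply: emeasurable_funD; exact: (measurableT_comp _ (measurable_pair1 _)).
    + move=> w _; rewrite -EFinD lee_fin/= /h/= -exprMn -mulrA normrM.
      rewrite -(real_normK (num_real (eta w s))) -(real_normK (num_real (g s * Y w))).
      have := sqr_ge0 (`|eta w s| - `|g s * Y w|); have := normr_ge0 (eta w s).
      have := normr_ge0 (g s * Y w); nra.
have -> : (\int[fleb T]_s \int[P]_w (k1 (s, w) + k2 (s, w)) =
    \int[fleb T]_s (\int[P]_w k1 (s, w) + \int[P]_w k2 (s, w)))%E.
  apply: eq_integral => s _; rewrite ge0_integralD//.
  - exact: (measurableT_comp mk1 (measurable_pair1 _)).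
  - exact: (measurableT_comp mk2 (measurable_pair1 _)).
rewrite ge0_integralD//; last 4 first.
- by move=> s _; exact: integral_ge0.
- exact: (measurable_fun_fubini_tonelli_F _ mk1).
- by move=> s _; exact: integral_ge0.
- exact: (measurable_fun_fubini_tonelli_F _ mk2).
apply: lte_add_pinfty; first by rewrite integral_fleb /k1/= -eta_tonelli.
have /Lfun2P[_ gfin] := LfunP g; have /Lfun2P[_ Yfin] := LfunP Y.
have gE : (\int[fleb T]_s (g s ^+ 2)%:E < +oo)%E by rewrite integral_fleb.
have Y0 : (0 <= \int[P]_w (Y w ^+ 2)%:E)%E by apply: integral_ge0 => w _; rewrite lee_fin sqr_ge0.
have -> : (\int[fleb T]_s \int[P]_w k2 (s, w) =
    \int[fleb T]_s ((g s ^+ 2)%:E * \int[P]_w (Y w ^+ 2)%:E))%E.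
  apply: eq_integral => s _; rewrite -ge0_integralZl_EFin ?sqr_ge0//.
  - by move=> w _; rewrite lee_fin sqr_ge0.
  - exact/measurable_EFinP/measurable_funX.
rewrite ge0_integralZr//; last 2 first.
- exact/measurable_EFinP/measurable_funX.
- by move=> s _; rewrite lee_fin sqr_ge0.
by apply: lte_mul_pinfty => //; [apply: integral_ge0 => s _; rewrite lee_fin sqr_ge0|
  rewrite ge0_fin_numE// integral_ge0// => s _; rewrite lee_fin sqr_ge0].
Qed.

Lemma measurable_weighted : measurable_fun setT (fun s => \int[P]_w h (s, w)).
Proof. exact: measurable_Rfubini1 mh h_int. Qed.

Lemma weighted_integrable_ae : {ae leb T, forall s, P.-integrable setT (fun w => (h (s, w))%:E)}.
Proof. exact: (Rfubini_ae1 mh h_int). Qed.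

Lemma fubini_weighted : dotL2 P (fun w => dotL2 (leb T) (eta w) g) Y =
  \int[leb T]_s \int[P]_w h (s, w).
Proof.
transitivity (\int[P]_w \int[fleb T]_s h (s, w)).
  apply: eq_Rintegral => w _; rewrite Rintegral_fleb /h/= RintegralZr//.
  exact: dotL2_integrable (LfunP _) (LfunP _).
by rewrite -(Rfubini mh h_int) Rintegral_fleb.
Qed.

End Fixed.

(** The weight [g = 1] in [measurable_weighted] and [weighted_integrable_ae] gives the unweighted
    coefficients. *)
Lemma one_in_L2 : (fun=> 1 : R) \in Lfun (leb T) 2%:E.
Proof.
apply/Lfun2P; split=> //; under eq_integral do rewrite expr1n.
by apply: integrable_lty => //; exact: leb_integrable_cst.
Qed.

Lemma eta_coef_measurable (eta : Omega -> H) (Y : L2 P) : jointly_measurable eta ->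
  (\int[P]_w (dotL2 (leb T) (eta w) (eta w))%:E < +oo)%E ->
  measurable_fun setT (fun s => \int[P]_w (eta w s * Y w)).
Proof.
move=> me efin; have := measurable_weighted me efin (Lfun_Sub (lee1n 2) one_in_L2) Y.
rewrite (_ : (fun s => \int[P]_w _) = (fun s => \int[P]_w (eta w s * Y w)))//.
by apply/funext => s; apply: eq_Rintegral => w _ /=; rewrite mulr1.
Qed.

(** The weak expectation of a random path against [Y] can be computed time by time. *)
Lemma eta_dot_fubini (eta : Omega -> H) (g : H) (Y : L2 P) : jointly_measurable eta ->
  (\int[P]_w (dotL2 (leb T) (eta w) (eta w))%:E < +oo)%E ->
  dotL2 P (fun w => dotL2 (leb T) (eta w) g) Y =
  \int[leb T]_s ((\int[P]_w (eta w s * Y w)) * g s).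
Proof.
move=> me efin; rewrite fubini_weighted//; congr fine.
apply: ae_eq_integral => //.
- apply/measurable_EFinP; exact: measurable_weighted.
- apply/measurable_EFinP/measurable_funM; first exact: eta_coef_measurable.
  exact: (L2_measurable (LfunP g)).
apply: leb_aeS (weighted_integrable_ae me efin (Lfun_Sub (lee1n 2) one_in_L2) Y) => s hs _.
congr EFin; rewrite -RintegralZr//; first by apply: eq_Rintegral => w _ /=; rewrite mulrAC.
by move: hs => /=; under eq_fun do rewrite mulr1.
Qed.

End EtaFubini.

Section ItoEquation.
Context {R : realType} {d : measure_display} {Omega : measurableType d}.
Variables (P : probability Omega R) (T : R).
Local Notation H := (L2 (leb T)).
Variable B : H -> {RV P >-> R}.
Hypothesis B_noise : white_noise B.
Variable m : nat -> H.
Hypothesis m_basis : orthonormal_basis m.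
Variables K Ks : H -> H.
Hypothesis K_bounded : bounded_operator K.
Hypothesis Ks_adjoint : adjoint_of K Ks.
Let m_orth := m_basis.1.
Let sdP := dotL2_semi_inner P.
Let sdH := dotL2_semi_inner (leb T).
Let xi_o := xi_orthonormal B_noise m_orth.
Local Notation dotP := (fun f g : L2 P => dotL2 P f g).
Local Notation xi_ := (xiL2 B_noise m).

Definition sol_coef (s : R) (a : multi_index) : R :=
  mi_coef (fun k => prim T (K (m k)) s) a.

Definition sol (t : R) : L2 P := exp_vecL2 B_noise (Ks (chi T t)).

Let Km_int k : (leb T).-integrable setT (fun x => (K (m k) x)%:E).
Proof. exact: L2_leb_integrable (LfunP _). Qed.

Lemma sol_coefE t a : dotL2 P (sol t) (xi_ a) = sol_coef t a.
Proof.
rewrite (exp_vec_coef B_noise m_orth); congr mi_coef; apply/funext => k.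
exact: (adjointE Ks_adjoint).
Qed.

Lemma sol_coef_rec t (a : multi_index) : sol_coef t a = mi_coef (fun=> 0) a +
  \sum_(k <- finsupp a) Num.sqrt (a k)%:R *
    prim T (fun s => sol_coef s (mi_sub a (mi_unit k)) * K (m k) s) t.
Proof. exact: mi_coef_prim. Qed.

Lemma measurable_sol_coef a : measurable_fun setT (sol_coef ^~ a).
Proof. by have [] := mi_coef_density Km_int a. Qed.

Lemma mi_deg_pred (a : multi_index) k : k \in finsupp a ->
  (mi_deg (mi_sub a (mi_unit k)) < mi_deg a)%N.
Proof. by move=> ka; rewrite -{2}(mi_add_sub_unit ka) mi_degD mi_unit_deg. Qed.

Section Solution.
Variable u : R -> Omega -> R.
Hypothesis u_L2 : {ae leb T, forall s, u s \in Lfun P 2%:E}.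
Hypothesis u_energy : exists2 eta : Omega -> H, path_element P u eta &
  (\int[P]_w (dotL2 (leb T) (eta w) (eta w))%:E < +oo)%E.

(** The integral fixes only some representative [eta] of the truncated process. Tonelli reads its
    energy off the time slices, and almost every slice is dominated by that of a representative of
    [u]. *)
Lemma truncated_energy t (eta : Omega -> H) :
  path_element P (fun s w => u s w * \1_`[0, t] s) eta ->
  (\int[P]_w (dotL2 (leb T) (eta w) (eta w))%:E < +oo)%E.
Proof.
case: u_energy => eta' [meta' ueta'] fin [meta ueta].
move: fin; rewrite (eta_tonelli P meta') (eta_tonelli P meta) => fin; apply: le_lt_trans fin.
have msq (e : Omega -> H) : jointly_measurable e ->
    measurable_fun [set: measurableTypeR R * Omega]
    (fun z : measurableTypeR R * Omega => ((e z.2 z.1) ^+ 2)%:E).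
  by move=> me; apply/measurable_EFinP; exact: measurable_funX.
have msqF (e : Omega -> H) : jointly_measurable e ->
    measurable_fun setT (fun s => \int[P]_w ((e w s) ^+ 2)%:E)%E.
  move=> me; apply: (measurable_fun_fubini_tonelli_F _ (msq _ me)) => z.
  by rewrite lee_fin sqr_ge0.
apply: ae_ge0_le_integral => //.
- by move=> s _; apply: integral_ge0 => w _; rewrite lee_fin sqr_ge0.
- exact: msqF.
- by move=> s _; apply: integral_ge0 => w _; rewrite lee_fin sqr_ge0.
- exact: msqF.
apply: leb_aeS (leb_aeI ueta ueta') => s [h1 h2] _.
apply: ae_ge0_le_integral => //.
- by move=> w _; rewrite lee_fin sqr_ge0.
- exact: (measurableT_comp (msq _ meta) (measurable_pair1 _)).
- by move=> w _; rewrite lee_fin sqr_ge0.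
- exact: (measurableT_comp (msq _ meta') (measurable_pair1 _)).
apply: filterS2 h1 h2 => w /= <- // <- // _.
rewrite lee_fin exprMn ler_piMr ?sqr_ge0// indicE.
Qed.

(** The coefficient at [al] involves only predecessors of [al], which have smaller degree, and only
    through an integral in [s]; knowing them at almost every [s] is enough. *)
Lemma ito_coef t (I : Omega -> R) (IL : I \in Lfun P 2%:E) : ito_integral B m Ks u t I ->
  cspan dotP xi_ (Lfun_Sub (lee1n 2) IL) /\
  forall (al : multi_index), (forall a, (mi_deg a < mi_deg al)%N ->
      {ae leb T, forall s, dotL2 P (u s) (xi B m a) = sol_coef s a}) ->
    dotL2 P I (xi B m al) = sol_coef t al - mi_coef (fun=> 0) al.
Proof.
case=> eta eta_path [_ [eta_ [W [eta_E HW sW]]]].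
have efin := truncated_energy eta_path; have [meta ueta] := eta_path.
have [cI Ico] := wick_sum_coefs B_noise m_basis HW IL sW.
split=> // al Hal; rewrite Ico sol_coef_rec addrC addKr.
rewrite big_seq [RHS]big_seq; apply: eq_bigr => k kal; congr (_ * _).
set a := mi_sub al (mi_unit k); rewrite eta_E.
have -> : (fun w => dotL2 (leb T) (Ks (eta w)) (m k)) =
    (fun w => dotL2 (leb T) (eta w) (K (m k))).
  by apply/funext => w; rewrite (adjointE Ks_adjoint).
have -> := eta_dot_fubini (K (m k)) (xi_ a) meta efin; congr fine; apply: ae_eq_integral => //.
- apply/measurable_EFinP/measurable_funM; first exact: eta_coef_measurable.
  exact: (L2_measurable (LfunP _)).
- apply/measurable_EFinP/measurable_funM; first exact: measurable_chi.
  by apply: measurable_funM; [exact: measurable_sol_coef|exact: (L2_measurable (LfunP _))].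
apply: leb_aeS (leb_aeI (leb_aeI ueta u_L2) (Hal _ (mi_deg_pred kal))) => s [[us uL] uco] _.
congr EFin; rewrite mulrA; congr (_ * _); rewrite -uco /dotL2 -RintegralZl//; last first.
  exact: dotL2_integrable uL (xi_in_L2 B_noise m a).
have mu_ := L2_measurable uL; have mxi := L2_measurable (xi_in_L2 B_noise m a).
have meta_s : measurable_fun setT (fun w => eta w s).
  exact: (measurableT_comp meta (measurable_pair1 _)).
apply: Rintegral_ae_eq.
- exact: measurable_funM.
- by apply: measurable_funM => //; apply: measurable_funM.
by apply: filterS us => w /= <- // _; rewrite mulrCA mulrA mulrAC.
Qed.

Hypothesis u_ito : {ae leb T, forall s, ito_equation B m Ks u s}.

Lemma ito_integral_L2 t I : ito_integral B m Ks u t I -> I \in Lfun P 2%:E.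
Proof. by case=> eta _ [_ [eta_ [W [_ _ []]]]]. Qed.

(** The constant 1, up to a null set, in the form of an exponential, for which coefficients and
    membership in the closed span are already known. *)
Let one : L2 P := exp_vecL2 B_noise 0.

Lemma one_coef a : dotL2 P one (xi_ a) = mi_coef (fun=> 0) a.
Proof.
rewrite (exp_vec_coef B_noise m_orth); congr mi_coef; apply/funext => k.
exact: (inner0l sdH).
Qed.

Lemma one_ae : (one : Omega -> R) = cst 1 %[ae P].
Proof.
apply: filterS (noise0 B_noise) => w /= B0 _.
by rewrite /exp_vec B0// (inner0l sdH) mul0r subr0 expR0.
Qed.

(** Strong induction on the degree: at almost every [s] the equation gives the coefficient at [al]
    from those of smaller degree. *)
Lemma solution_coef (al : multi_index) :
  {ae leb T, forall s, dotL2 P (u s) (xi B m al) = sol_coef s al}.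
Proof.
have [n] := ubnP (mi_deg al); elim: n al => // n IH al aln.
apply: leb_aeS (leb_aeI u_L2 u_ito) => s [uL [I hI uI]].
have IL := ito_integral_L2 hI; have [_ Ico] := ito_coef IL hI.
transitivity (dotL2 P (one + Lfun_Sub (lee1n 2) IL) (xi_ al)).
  have mxi := L2_measurable (xi_in_L2 B_noise m al).
  apply: (dotL2_ae_eq (L2_measurable uL) (L2_measurable (LfunP _)) mxi mxi).
  - apply: filterS2 uI one_ae => w uw ow h.
    by rewrite (uw h) -[RHS]/(one w + I w) (ow h).
  - exact: ae_eq_refl.
rewrite (innerDl sdP) one_coef [X in _ + X]Ico; first by rewrite addrC subrK.
by move=> a aal; apply: IH; rewrite (leq_trans aal).
Qed.

Lemma ito_unique t : ito_equation B m Ks u t -> u t = (sol t : Omega -> R) %[ae P].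
Proof.
case=> I hI uI; have IL := ito_integral_L2 hI; have [cI Ico] := ito_coef IL hI.
pose D := one + Lfun_Sub (lee1n 2) IL - sol t.
have cD : cspan dotP xi_ D.
  apply: (cspanB sdP xi_o); last exact: exp_vec_cspan.
  by apply: (cspanD sdP xi_o); [exact: exp_vec_cspan|exact: cI].
have D0 : dotL2 P D D = 0.
  apply: (cspan_coef0 sdP xi_o cD) => al; rewrite (innerBl sdP) (innerDl sdP) one_coef.
  rewrite [X in _ + X - _]Ico ?sol_coefE; first by ring.
  by move=> a _; exact: solution_coef.
apply: filterS3 (dotL2_eq0_ae (LfunP D) D0) uI one_ae => w Dw uw ow h.
move: (Dw h); rewrite -[D w]/(one w + I w - sol t w) (ow h) (uw h) /=.
by move/eqP; rewrite subr_eq0 => /eqP.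
Qed.

End Solution.
End ItoEquation.

(** * A jointly measurable solution *)

Section MeasurableVersion.
Context {R : realType} {d : measure_display} {Omega : measurableType d}.
Variables (P : probability Omega R) (T : R).
Local Notation H := (L2 (leb T)).
Variable B : H -> {RV P >-> R}.
Hypothesis B_noise : white_noise B.
Variables K Ks : H -> H.
Hypothesis K_bounded : bounded_operator K.
Hypothesis Ks_adjoint : adjoint_of K Ks.
Let sdP := dotL2_semi_inner P.
Let sdH := dotL2_semi_inner (leb T).
Local Notation Omega_B := (g_sigma_algebraType (field_events B)).

(** The preimage is a countable union of rectangles, one per value of [N]. *)
Lemma measurable_countable_index d1 d2 (T1 : measurableType d1) (T2 : measurableType d2)
    (N : T1 -> int) (F : int -> T2 -> R) :
  (forall j, measurable (N @^-1` [set j])) -> (forall j, measurable_fun setT (F j)) ->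
  measurable_fun setT (fun z : T1 * T2 => F (N z.1) z.2).
Proof.
move=> mN mF _ A mA; rewrite setTI.
rewrite (_ : _ @^-1` A = \bigcup_(j in setT) ((N @^-1` [set j]) `*` (F j @^-1` A))).
  apply: countable_bigcupT_measurable => // j.
  apply: measurableX => //; rewrite -[X in measurable X]setTI; exact: mF.
apply/seteqP; split=> [z /= zA|z [j _ [/= <-]]//].
by exists (N z.1).
Qed.

(** At spacing [2^-n], [chi_dist] makes the square distances between indicators summable over [n],
    hence almost sure convergence at each fixed time without extracting a subsequence. *)
Definition dyadic (n : nat) (s : R) : R := (Num.floor (2 ^+ n * s))%:~R / 2 ^+ n.

Lemma dyadic_dist n s : `|s - dyadic n s| <= 2^-1 ^+ n.
Proof.
have p : 0 < 2 ^+ n :> R by rewrite exprn_gt0.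
have /andP[h1 h2] := real_floor_itv (num_real (2 ^+ n * s)).
have -> : s - dyadic n s = (2 ^+ n * s - (Num.floor (2 ^+ n * s))%:~R) / 2 ^+ n.
  by rewrite /dyadic [RHS]mulrBl [_ * s / _]mulrAC divff ?mul1r// gt_eqF.
rewrite normrM ger0_norm ?subr_ge0// ger0_norm ?invr_ge0 ?(ltW p)//.
rewrite exprVn ler_piMl ?invr_ge0 ?(ltW p)// lerBlDr.
by move: h2; rewrite intrD => /ltW; rewrite addrC.
Qed.

Lemma measurable_dyadic_floor n j :
  measurable ((fun s : measurableTypeR R => Num.floor (2 ^+ n * s)) @^-1` [set j]).
Proof.
have p : 0 < 2 ^+ n :> R by rewrite exprn_gt0.
rewrite (_ : _ @^-1` _ = [set` `[j%:~R / 2 ^+ n, (j + 1)%:~R / 2 ^+ n[%R])//.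
apply/seteqP; split=> s /=; rewrite in_itv/= ler_pdivrMr// ltr_pdivlMr// [s * _]mulrC.
  by move=> <-; exact: real_floor_itv (num_real _).
by move=> h; apply: floor_def.
Qed.

Lemma measurable_to_field : measurable_fun setT (idfun : Omega -> Omega_B).
Proof.
move=> _ A mA; rewrite setTI; move: A mA; apply: smallest_sub.
  exact: sigma_algebra_measurable.
by move=> A [f _ [C mC <-]]; exact: (measurable_funPT (B f)).
Qed.

Definition sol_approx n (z : measurableTypeR R * Omega) : R :=
  exp_vec B (Ks (chi T (dyadic n z.1))) z.2.

Lemma measurable_sol_approx n :
  measurable_fun [set: measurableTypeR R * Omega_B] (sol_approx n : measurableTypeR R * Omega_B -> R).
Proof.
apply: (@measurable_countable_index _ _ (measurableTypeR R) Omega_B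
  (fun s => Num.floor (2 ^+ n * s))
  (fun j w => exp_vec B (Ks (chi T (j%:~R / 2 ^+ n))) w)) => j.
  exact: measurable_dyadic_floor.
set f := Ks _; have mf : measurable_fun [set: Omega_B] (fun w => B f w - dotL2 (leb T) f f / 2).
  by apply: measurable_funB => //; exact: measurable_field_noise.
exact: (measurableT_comp (@measurable_expR R) mf).
Qed.

(* [sol s] is only determined up to a null set depending on [s]; the limit along dyadic
   times selects representatives that are jointly measurable in time and chance. *)
Definition sol_version (z : measurableTypeR R * Omega) : R :=
  limsupR (fun n => sol_approx n z).

Lemma measurable_sol_version : measurable_fun [set: measurableTypeR R * Omega_B]
  (sol_version : measurableTypeR R * Omega_B -> R).
Proof. exact: measurable_limsupR measurable_sol_approx. Qed.

Lemma dotL2_chi_le t : dotL2 (leb T) (chi T t) (chi T t) <= fine (leb T setT).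
Proof.
have fin : leb T setT \is a fin_num by exact: (fin_num_measure (fleb T)).
rewrite -lee_fin (dotL2_sqE (LfunP (chi T t))) fineK// -[leRHS]mul1e -integral_cst//.
apply: ge0_le_integral => //.
- by move=> x _; rewrite lee_fin sqr_ge0.
- by apply/measurable_EFinP/measurable_funX; exact: measurable_chi.
- by move=> x _; rewrite lee_fin expr_le1//; have /andP[] := chi01 T t x.
Qed.

Lemma cvg_sq0 (x : nat -> R) (C : R) : (forall n, x n ^+ 2 <= C * 2^-1 ^+ n) ->
  x @ \oo --> 0.
Proof.
move=> xC; apply/cvgrPdist_lt => eps eps0.
have e2 : 0 < eps ^+ 2 by rewrite exprn_gt0.
have : (fun n => C * 2^-1 ^+ n) @ \oo --> 0.
  rewrite -[X in _ --> X](mulr0 C); apply: cvgMr; apply: cvg_expr.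
  by rewrite ger0_norm ?invr_ge0// invf_lt1// ltr1n.
move=> /cvgrPdist_lt/(_ _ e2)[N _ HN]; exists N => // n Nn; have := HN n Nn => /=.
rewrite !sub0r !normrN => h; rewrite -(ltr_pXn2r (n := 2)) ?nnegrE ?normr_ge0 ?(ltW eps0)//.
by rewrite real_normK ?num_real//; apply: le_lt_trans (xC n) (le_lt_trans (ler_norm _) h).
Qed.

Lemma ae_cvg_fast (x : nat -> L2 P) (y : L2 P) (C : R) :
  (forall n, dotL2 P (x n - y) (x n - y) <= C * 2^-1 ^+ n) ->
  {ae P, forall w, x n w @[n --> \oo] --> y w}.
Proof.
move=> H; pose g n w := (x n w - y w) ^+ 2.
have mx n : measurable_fun setT (x n) by exact/L2_measurable/LfunP.
have my : measurable_fun setT y by exact/L2_measurable/LfunP.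
have : {ae P, forall w, cvgn (series (g ^~ w))}.
  apply: ae_summable => [n|n w|]; first by apply/measurable_funX/measurable_funB.
    exact: sqr_ge0.
  apply: (@le_lt_trans _ _ (\sum_(0 <= n <oo) (geometric C 2^-1 n)%:E)%E).
    apply: lee_nneseries => [n _ _|n _].
      by apply: integral_ge0 => w _; rewrite lee_fin sqr_ge0.
    by have := H n; rewrite -lee_fin (dotL2_sqE (LfunP _)).
  have : `|2^-1 : R| < 1 by rewrite ger0_norm ?invr_ge0// invf_lt1// ltr1n.
  move=> /(@cvg_geometric_series R C)/cvg_real_EFin/cvg_lim geo.
  rewrite (_ : (\sum_(0 <= n <oo) _)%E = (C / (1 - 2^-1))%:E) ?ltry//.
  by rewrite -geo//; congr (lim (_ @ \oo)); apply/funext => n; rewrite sumEFin.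
apply: filterS => w /cvg_series_cvg_0 /cvgrPdist_lt gw.
apply/cvgrPdist_lt => eps eps0.
have [N _ HN] := gw _ (exprn_gt0 2 eps0); exists N => // n Nn; have := HN n Nn => /=.
rewrite sub0r normrN ger0_norm ?sqr_ge0// => h.
rewrite distrC -(ltr_pXn2r (n := 2)) ?nnegrE ?normr_ge0 ?(ltW eps0)//.
by rewrite real_normK ?num_real.
Qed.

(** Both parts of the exponent converge: the noise almost surely, its square errors being bounded by
    a geometric series, and the deterministic square norm. Where they do, [limsupR] is the limit. *)
Lemma sol_version_ae s : (fun w => sol_version (s, w)) = exp_vec B (Ks (chi T s)) %[ae P].
Proof.
have [C C0 HC] := adjoint_bounded K_bounded Ks_adjoint.
pose a n := Ks (chi T (dyadic n s)); pose a0 := Ks (chi T s).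
have da n : dotL2 (leb T) (a n - a0) (a n - a0) <= C * 2^-1 ^+ n.
  have [h _] := HC (chi T (dyadic n s)) (chi T s); apply: (le_trans h).
  rewrite ler_wpM2l//; apply: le_trans (chi_dist _ _ _) _.
  by rewrite distrC dyadic_dist.
have vcv : dotL2 (leb T) (a n) (a n) @[n --> \oo] --> dotL2 (leb T) a0 a0.
  have z1 : dotL2 (leb T) (a n - a0) a0 @[n --> \oo] --> 0.
    apply: (@cvg_sq0 _ (C * dotL2 (leb T) a0 a0)) => n.
    apply: (le_trans (inner_CauchySchwarz sdH _ _)).
    by rewrite mulrAC ler_wpM2r// (inner_ge0 sdH).
  have z2 : dotL2 (leb T) (a n - a0) (a n - a0) @[n --> \oo] --> 0.
    apply: (@cvg_sq0 _ (C ^+ 2)) => n.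
    have q1 : 2^-1 ^+ n <= 1 :> R by rewrite exprn_ile1// ?invr_ge0// invf_le1// ler1n.
    have q0 : 0 <= 2^-1 ^+ n :> R by rewrite exprn_ge0// invr_ge0.
    have := da n; have := inner_ge0 sdH (a n - a0).
    move: (dotL2 _ _ _) (2^-1 ^+ n) q0 q1 => D q q0 q1 D0 Dq.
    apply: (@le_trans _ _ ((C * q) ^+ 2)); first by rewrite !expr2 ler_pM.
    by rewrite exprMn ler_wpM2l ?sqr_ge0// expr2 ler_piMl.
  have -> : (fun n => dotL2 (leb T) (a n) (a n)) = (fun n => dotL2 (leb T) (a n - a0) (a n - a0) +
      (2 * dotL2 (leb T) (a n - a0) a0 + dotL2 (leb T) a0 a0)).
    apply/funext => n; rewrite !(innerBl sdH) !(innerBr sdH) (innerC sdH a0 (a n)); ring.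
  rewrite -[X in _ --> X]add0r -{1}[X in _ --> _ + X]add0r -{2}(mulr0 2).
  by apply: cvgD => //; apply: cvgD; [exact: cvgMr|exact: cvg_cst].
have ae_cv : {ae P, forall w, B (a n) w @[n --> \oo] --> B a0 w}.
  apply: (@ae_cvg_fast (fun n => noiseL2 B_noise (a n)) (noiseL2 B_noise a0) C) => n.
  apply: le_trans (da n); rewrite (innerBl sdP) !(innerBr sdP) !(noise_dot B_noise).
  by rewrite (innerBl sdH) !(innerBr sdH).
apply: filterS ae_cv => w Bcv _; apply: cvg_limsupR.
rewrite /sol_approx/= /exp_vec.
apply: (@cvg_comp _ _ _ _ expR); last exact: continuous_expR.
apply: cvgB => //; exact: cvgMl.
Qed.

End MeasurableVersion.

Section SolutionPath.
Context {R : realType} {d : measure_display} {Omega : measurableType d}.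
Variables (P : probability Omega R) (T : R).
Local Notation H := (L2 (leb T)).
Variable B : H -> {RV P >-> R}.
Hypothesis B_noise : white_noise B.
Variables K Ks : H -> H.
Hypothesis K_bounded : bounded_operator K.
Hypothesis Ks_adjoint : adjoint_of K Ks.
Let sdP := dotL2_semi_inner P.
Let sdH := dotL2_semi_inner (leb T).
Local Notation Omega_B := (g_sigma_algebraType (field_events B)).
Local Notation version := (sol_version B Ks).

Lemma measurable_field_comp d' (S : measurableType d') (f : S * Omega -> R) :
  measurable_fun [set: S * Omega_B] (f : S * Omega_B -> R) ->
  measurable_fun [set: S * Omega] f.
Proof.
move=> mf; have mid : measurable_fun [set: S * Omega]
    (fun z : S * Omega => (z.1, z.2) : S * Omega_B).
  apply: measurable_fun_pair; first exact: measurable_fst.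
  exact: (measurableT_comp (measurable_to_field (B := B)) measurable_snd).
have := measurableT_comp mf mid.
by congr (measurable_fun _ _); apply/funext => -[].
Qed.

Definition path_energy (w : Omega) : \bar R :=
  (\int[fleb T]_s ((version (s, w)) ^+ 2)%:E)%E.

Let version_sq0 z : (0 <= ((version z) ^+ 2)%:E)%E. Proof. by rewrite lee_fin sqr_ge0. Qed.

Let mversion : measurable_fun [set: measurableTypeR R * Omega] version.
Proof. apply: measurable_field_comp; exact: measurable_sol_version. Qed.

Lemma measurable_path_energy : measurable_fun [set: Omega_B] (path_energy : Omega_B -> \bar R).
Proof.
have msq : measurable_fun [set: measurableTypeR R * Omega_B]
    (fun z : measurableTypeR R * Omega_B => ((version z) ^+ 2)%:E).
  apply/measurable_EFinP; apply: measurable_funX; exact: measurable_sol_version.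
exact: (measurable_fun_fubini_tonelli_G _ msq version_sq0).
Qed.

(** Trajectories of infinite energy, which form a null set, are replaced by 0 so that every [w]
    gives an element of [L2]. The test is measurable for the sigma-algebra of the noise, and
    therefore so is the path. *)
Definition path_value (w : Omega) (s : R) : R :=
  if (path_energy w < +oo)%E then version (s, w) else 0.

Lemma path_value_L2 w : path_value w \in Lfun (leb T) 2%:E.
Proof.
have mv : measurable_fun setT (fun s => version (s, w)).
  exact: (measurableT_comp mversion (measurable_pair2 w)).
rewrite /path_value; case: (path_energy w < +oo)%E / boolP => [fin|_]; last exact: (LfunP (0 : H)).
by apply/Lfun2P; split => //; rewrite -integral_fleb.
Qed.

Definition sol_path (w : Omega) : H := Lfun_Sub (lee1n 2) (path_value_L2 w).

Lemma measurable_sol_path : measurable_fun [set: measurableTypeR R * Omega_B]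
  (fun z : measurableTypeR R * Omega_B => sol_path z.2 z.1).
Proof.
apply: measurable_fun_ifT; last exact: measurable_cst.
  apply: measurable_fun_lte; last exact: measurable_cst.
  exact: (measurableT_comp measurable_path_energy measurable_snd).
rewrite (_ : (fun _ => _) = version); last by apply/funext => -[].
exact: measurable_sol_version.
Qed.

Lemma sol_path_joint : jointly_measurable sol_path.
Proof. exact: (measurable_field_comp measurable_sol_path). Qed.

Lemma sol_energy_bounded : exists M : R, forall s,
  (\int[P]_w ((version (s, w)) ^+ 2)%:E <= M%:E)%E.
Proof.
have [C C0 HC] := adjoint_bounded K_bounded Ks_adjoint.
exists (expR (C * fine (leb T setT))) => s.
have -> : (\int[P]_w ((version (s, w)) ^+ 2)%:E =
    \int[P]_w ((exp_vec B (Ks (chi T s)) w) ^+ 2)%:E)%E.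
  apply: ae_eq_integral => //.
  - apply/measurable_EFinP/measurable_funX.
    exact: (measurableT_comp mversion (measurable_pair1 s)).
  - apply/measurable_EFinP/measurable_funX.
    by have [] := exp_bounded_exp_vec B_noise (Ks (chi T s)).
  - apply: filterS (sol_version_ae B_noise K_bounded Ks_adjoint s) => w h h'.
    by rewrite -(h h').
rewrite -(dotL2_sqE (exp_vec_in_L2 B_noise _)) lee_fin.
have -> := exp_vec_sq B_noise (Ks (chi T s)).
rewrite ler_expR; have [_ h] := HC (chi T s) (chi T s); apply: (le_trans h).
by rewrite ler_wpM2l// dotL2_chi_le.
Qed.

Lemma path_energy_fin : {ae P, forall w, (path_energy w < +oo)%E}.
Proof.
have mE : measurable_fun setT path_energy.
  exact: (measurableT_comp measurable_path_energy (measurable_to_field (B := B))).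
have msq : measurable_fun [set: measurableTypeR R * Omega]
    (fun z : measurableTypeR R * Omega => ((version z) ^+ 2)%:E).
  exact/measurable_EFinP/measurable_funX.
have iE : P.-integrable setT path_energy.
  apply/integrableP; split=> //.
  have -> : (\int[P]_w `|path_energy w| = \int[P]_w path_energy w)%E.
    by apply: eq_integral => w _; rewrite gee0_abs// integral_ge0.
  rewrite -(@fubini_tonelli _ _ _ _ _ (fleb T) P _ msq version_sq0).
  have [M HM] := sol_energy_bounded.
  apply: (@le_lt_trans _ _ (\int[fleb T]_s M%:E)%E).
    apply: ge0_le_integral => //.
    - by move=> s _; apply: integral_ge0.
    - exact: (measurable_fun_fubini_tonelli_F _ msq version_sq0).
  by rewrite integral_fleb; apply: integrable_lty => //; exact: leb_integrable_cst.
apply: filterS (integrable_ae measurableT iE) => w /(_ I).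
by rewrite fin_numElt => /andP[].
Qed.

Lemma sol_path_ae s : (sol_path ^~ s : Omega -> R) = exp_vec B (Ks (chi T s)) %[ae P].
Proof.
apply: filterS2 path_energy_fin (sol_version_ae B_noise K_bounded Ks_adjoint s) => w fin h h'.
by rewrite -(h h') /= /path_value fin.
Qed.

Lemma sol_path_energy : (\int[P]_w (dotL2 (leb T) (sol_path w) (sol_path w))%:E < +oo)%E.
Proof.
rewrite (eta_tonelli _ sol_path_joint); have [M HM] := sol_energy_bounded.
have msq : measurable_fun [set: measurableTypeR R * Omega]
    (fun z : measurableTypeR R * Omega => ((sol_path z.2 z.1) ^+ 2)%:E).
  by apply/measurable_EFinP/measurable_funX; exact: sol_path_joint.
rewrite -integral_fleb; apply: (@le_lt_trans _ _ (\int[fleb T]_s M%:E)%E).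
  apply: ge0_le_integral => //.
  - by move=> s _; apply: integral_ge0 => w _; rewrite lee_fin sqr_ge0.
  - apply: (measurable_fun_fubini_tonelli_F _ msq) => z.
    by rewrite lee_fin sqr_ge0.
  - move=> s _; apply: le_trans (HM s); apply: ge0_le_integral => //.
    + by move=> w _; rewrite lee_fin sqr_ge0.
    + exact: (measurableT_comp msq (measurable_pair1 s)).
    + apply/measurable_EFinP/measurable_funX.
      exact: (measurableT_comp mversion (measurable_pair1 s)).
    + move=> w _; rewrite lee_fin /= /path_value; case: ifP => // _.
      by rewrite expr0n sqr_ge0.
by rewrite integral_fleb; apply: integrable_lty => //; exact: leb_integrable_cst.
Qed.

End SolutionPath.

(** * Existence *)

(** Meant for functions whose measurability is not established, such as the square norm of [Ks]
    applied to a random path: the integral of a nonnegative function is a supremum over simple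
    functions below it, hence monotone. *)
Lemma le_integral_nonneg d (S : measurableType d) (R : realType)
    (mu : {measure set S -> \bar R}) (f g : S -> \bar R) :
  (forall x, 0 <= f x)%E -> (forall x, f x <= g x)%E ->
  (\int[mu]_x f x <= \int[mu]_x g x)%E.
Proof.
move=> f0 fg; have g0 x : (0 <= g x)%E by exact: le_trans (f0 x) (fg x).
rewrite !ge0_integralTE//; apply: ereal_sup_le => _ /= [h hf <-].
by exists h => // x; exact: le_trans (hf x) (fg x).
Qed.

Lemma bounded_mul_L2 d (S : measurableType d) (R : realType)
    (mu : {measure set S -> \bar R}) (F f : S -> R) (C : R) : measurable_fun setT F ->
  (forall x, `|F x| <= C) -> f \in Lfun mu 2%:E -> (fun x => F x * f x) \in Lfun mu 2%:E.
Proof.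
move=> mF FC /Lfun2P[mf f_fin].
have msq : measurable_fun setT (fun x => (f x ^+ 2)%:E).
  by apply/measurable_EFinP; exact: measurable_funX.
have f0 x : (0 <= (f x ^+ 2)%:E)%E by rewrite lee_fin sqr_ge0.
apply/Lfun2P; split; first exact: measurable_funM.
apply: (@le_lt_trans _ _ (\int[mu]_x ((C ^+ 2)%:E * (f x ^+ 2)%:E))%E).
  apply: le_integral_nonneg => x; first by rewrite lee_fin sqr_ge0.
  rewrite -EFinM lee_fin exprMn ler_wpM2r ?sqr_ge0// -(real_normK (num_real (F x))).
  by rewrite lerXn2r ?nnegrE// (le_trans _ (FC x)).
by rewrite ge0_integralZl_EFin ?sqr_ge0// lte_mul_pinfty ?lee_fin ?sqr_ge0.
Qed.

(** The factor [T2] carries no measure, so that it can be the sample space with the sigma-algebra of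
    the noise. Positive and negative parts are treated separately, as nothing is assumed
    integrable. *)
Lemma measurable_Rintegral_fst d1 d2 (T1 : measurableType d1) (T2 : measurableType d2)
    (R : realType) (mu : {sigma_finite_measure set T1 -> \bar R}) (h : T1 * T2 -> R) :
  measurable_fun setT h -> measurable_fun setT (fun y => \int[mu]_x h (x, y)).
Proof.
move=> mh; apply: (@measurableT_comp _ _ _ _ _ _ (@fine R)) => //.
have mE : measurable_fun setT (fun z => (h z)%:E) by exact/measurable_EFinP.
have -> : (fun y => \int[mu]_x (h (x, y))%:E)%E = (fubini_G mu ((fun z => (h z)%:E)^\+) \-
    fubini_G mu ((fun z => (h z)%:E)^\-))%E.
  apply/funext => y; rewrite integralE; congr (_ - _)%E; apply: eq_integral => x _.
    by rewrite !funeposE.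
  by rewrite !funenegE.
apply: emeasurable_funB; apply: measurable_fun_fubini_tonelli_G.
- exact: measurable_funepos.
- by move=> z; exact: funepos_ge0.
- exact: measurable_funeneg.
- by move=> z; exact: funeneg_ge0.
Qed.

Lemma mi_coefZ (R : realType) (c : R) (x : nat -> R) (a : multi_index) :
  mi_coef (fun k => c * x k) a = c ^+ mi_deg a * mi_coef x a.
Proof.
rewrite /mi_coef /mi_deg expr_sum -big_split; apply: eq_bigr => k _.
by rewrite exprMn -mulrA.
Qed.

Section Existence.
Context {R : realType} {d : measure_display} {Omega : measurableType d}.
Variables (P : probability Omega R) (T : R).
Local Notation H := (L2 (leb T)).
Variable B : H -> {RV P >-> R}.
Hypothesis B_noise : white_noise B.
Variable m : nat -> H.
Hypothesis m_basis : orthonormal_basis m.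
Variables K Ks : H -> H.
Hypothesis K_bounded : bounded_operator K.
Hypothesis Ks_adjoint : adjoint_of K Ks.
Let m_orth := m_basis.1.
Let sdP := dotL2_semi_inner P.
Let sdH := dotL2_semi_inner (leb T).
Let xi_o := xi_orthonormal B_noise m_orth.
Local Notation dotP := (fun f g : L2 P => dotL2 P f g).
Local Notation xi_ := (xiL2 B_noise m).
Local Notation Omega_B := (g_sigma_algebraType (field_events B)).
Local Notation sol_coef := (sol_coef m K).
Local Notation sol := (sol B_noise Ks).
Local Notation path := (sol_path B Ks).

Definition cut (t : R) (f : H) : H :=
  Lfun_Sub (lee1n 2) (@bounded_mul_L2 _ (measurableTypeR R) R (leb T) (chi T t) f 1
    (measurable_chi T t) (abs_chi_le T t) (LfunP f)).

Lemma dotL2_cut_le t (f : H) : dotL2 (leb T) (cut t f) (cut t f) <= dotL2 (leb T) f f.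
Proof.
rewrite -lee_fin (dotL2_sqE (LfunP (cut t f))) (dotL2_sqE (LfunP f)).
apply: le_integral_nonneg => x; rewrite lee_fin ?sqr_ge0//.
have /andP[c0 c1] := chi01 T t x.
by rewrite exprMn ler_piMl ?sqr_ge0// expr_le1.
Qed.

Lemma measurable_cut_path t : measurable_fun [set: measurableTypeR R * Omega_B]
  (fun z : measurableTypeR R * Omega_B => cut t (path z.2) z.1).
Proof.
apply: (@measurable_funM _ _ _ _ (fun z : measurableTypeR R * Omega_B => chi T t z.1)).
  exact: (measurableT_comp (measurable_chi T t) measurable_fst).
exact: measurable_sol_path.
Qed.

Lemma cut_path_joint t : jointly_measurable (fun w => cut t (path w)).
Proof. exact: (measurable_field_comp (measurable_cut_path t)). Qed.

Lemma cut_path_energy t :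
  (\int[P]_w (dotL2 (leb T) (cut t (path w)) (cut t (path w)))%:E < +oo)%E.
Proof.
apply: le_lt_trans (sol_path_energy B_noise K_bounded Ks_adjoint).
by apply: le_integral_nonneg => w; rewrite lee_fin ?(inner_ge0 sdH)// dotL2_cut_le.
Qed.

Lemma field_measurable_cut_path t (f : H) :
  field_measurable B (fun w => dotL2 (leb T) (Ks (cut t (path w))) f).
Proof.
exists (fun w => dotL2 (leb T) (Ks (cut t (path w))) f); last exact: ae_eq_refl.
have -> : (fun w => dotL2 (leb T) (Ks (cut t (path w))) f) =
    (fun w => \int[fleb T]_s (cut t (path w) s * K f s)).
  by apply/funext => w; rewrite (adjointE Ks_adjoint) Rintegral_fleb.
apply: (@measurable_Rintegral_fst _ _ _ Omega_B _ (fleb T)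
  (fun z => cut t (path z.2) z.1 * K f z.1)).
apply: measurable_funM; first exact: measurable_cut_path.
exact: (measurableT_comp (L2_measurable (LfunP (K f))) measurable_fst).
Qed.

Lemma admissible_cut_path t : admissible B (fun w => Ks (cut t (path w))).
Proof.
split; first exact: field_measurable_cut_path.
have [C C0 HC] := adjoint_bounded K_bounded Ks_adjoint.
have fin := sol_path_energy B_noise K_bounded Ks_adjoint.
have mE : measurable_fun setT (fun w => (dotL2 (leb T) (path w) (path w))%:E).
  have -> : (fun w => (dotL2 (leb T) (path w) (path w))%:E) =
      (fun w => \int[fleb T]_s ((path w s) ^+ 2)%:E)%E.
    by apply/funext => w; rewrite (dotL2_sqE (LfunP (path w))) integral_fleb.
  apply: (measurable_fun_fubini_tonelli_G
    (fun z : measurableTypeR R * Omega => ((path z.2 z.1) ^+ 2)%:E)).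
    apply/measurable_EFinP; apply: measurable_funX; exact: sol_path_joint.
  by move=> z; rewrite lee_fin sqr_ge0.
apply: (@le_lt_trans _ _ (\int[P]_w (C%:E * (dotL2 (leb T) (path w) (path w))%:E))%E).
  apply: le_integral_nonneg => w; first by rewrite lee_fin (inner_ge0 sdH).
  have [_ h] := HC (cut t (path w)) (cut t (path w)).
  by rewrite -EFinM lee_fin (le_trans h)// ler_wpM2l// dotL2_cut_le.
rewrite ge0_integralZl_EFin//; last by move=> w _; rewrite lee_fin (inner_ge0 sdH).
by apply: lte_mul_pinfty.
Qed.

(** Scaling a vector by [r] multiplies its coefficient at [a] by [r ^+ mi_deg a]; taking [r] to be
    the square root of 2 produces the weights after squaring. The bound is uniform in [s], so it can
    be integrated over the interval. *)
Lemma sol_coef_energy : exists2 M : R, 0 <= M & forall s (J : {fset multi_index}),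
  \sum_(a <- J) 2 ^+ mi_deg a * sol_coef s a ^+ 2 <= M.
Proof.
have [C C0 HC] := adjoint_bounded K_bounded Ks_adjoint.
pose L := fine (leb T setT); exists (expR (2 * (C * L))) => [|s J]; first exact: expR_ge0.
pose f := Ks (chi T s); pose r : R := Num.sqrt 2.
apply: (@le_trans _ _ (dotL2 P (exp_vecL2 B_noise (r *: f)) (exp_vecL2 B_noise (r *: f)))).
  apply: le_trans (bessel sdP xi_o J _); rewrite le_eqVlt; apply/orP; left; apply/eqP.
  apply: eq_bigr => a _; rewrite (exp_vec_coef B_noise m_orth).
  have -> : (fun k => dotL2 (leb T) (r *: f : H) (m k)) = (fun k => r * prim T (K (m k)) s).
    by apply/funext => k; rewrite (innerZl sdH); congr (_ * _); exact: (adjointE Ks_adjoint).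
  by rewrite mi_coefZ exprMn -exprM mulnC exprM sqr_sqrtr.
rewrite exp_vec_sq ler_expR (innerZl sdH) (innerZr sdH) mulrA -expr2 sqr_sqrtr//.
rewrite ler_wpM2l//; have [_ h] := HC (chi T s) (chi T s); apply: (le_trans h).
by rewrite ler_wpM2l// dotL2_chi_le.
Qed.

Lemma sol_coef_in_L2 a : sol_coef ^~ a \in Lfun (leb T) 2%:E.
Proof.
have [M M0 HM] := sol_coef_energy; apply/Lfun2P; split; first exact: measurable_sol_coef.
apply: (@le_lt_trans _ _ (\int[leb T]_s M%:E)%E).
  apply: le_integral_nonneg => s; rewrite lee_fin ?sqr_ge0//.
  apply: le_trans (HM s [fset a]%fset); rewrite big_seq_fset1 ler_peMl ?sqr_ge0//.
  by rewrite exprn_ege1// ler1n.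
by apply: integrable_lty => //; exact: leb_integrable_cst.
Qed.

Definition coef_path a : H := Lfun_Sub (lee1n 2) (sol_coef_in_L2 a).

(** The chaos coefficient at [a] of the integrand, as [ito_kernelE] confirms. *)
Definition ito_kernel t a : H := Ks (cut t (coef_path a)).

Lemma ito_kernelE t a (f : H) : dotL2 (leb T) (ito_kernel t a) f =
  dotL2 P (fun w => dotL2 (leb T) (Ks (cut t (path w))) f) (xi B m a).
Proof.
have -> : (fun w => dotL2 (leb T) (Ks (cut t (path w))) f) =
    (fun w => dotL2 (leb T) (cut t (path w)) (K f)).
  by apply/funext => w; exact: (adjointE Ks_adjoint).
have -> := eta_dot_fubini (K f) (xi_ a) (cut_path_joint t) (cut_path_energy t).
rewrite (adjointE Ks_adjoint); apply: eq_Rintegral => s _.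
rewrite -[cut _ _ s]/(chi T t s * sol_coef s a) -(sol_coefE B_noise m_basis Ks_adjoint).
congr (_ * _).
have mxi := L2_measurable (LfunP (xi_ a)).
have msol := L2_measurable (LfunP (sol s)).
have mpath : measurable_fun setT (fun w => path w s).
  exact: (measurableT_comp (sol_path_joint B Ks) (measurable_pair1 s)).
rewrite /dotL2 -RintegralZl//; last exact: dotL2_integrable (LfunP _) (LfunP _).
apply: Rintegral_ae_eq.
- by apply: measurable_funM => //; apply: measurable_funM.
- by apply: measurable_funM => //; apply: measurable_funM.
apply: filterS (sol_path_ae B_noise K_bounded Ks_adjoint s) => w h _.
rewrite mulrA; congr (_ * _).
by rewrite -[cut t (path w) s]/(chi T t s * path w s) h.
Qed.

Lemma ito_kernel_energy t : exists M : R, forall J : {fset multi_index},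
  \sum_(a <- J) (mi_deg a).+1%:R * dotL2 (leb T) (ito_kernel t a) (ito_kernel t a) <= M.
Proof.
have [C C0 HC] := adjoint_bounded K_bounded Ks_adjoint.
have [M M0 HM] := sol_coef_energy; pose L := fine (leb T setT).
have fin : leb T setT \is a fin_num by exact: (fin_num_measure (fleb T)).
exists (C * (M * L)) => J.
apply: (@le_trans _ _ (C * \sum_(a <- J) 2 ^+ mi_deg a * dotL2 (leb T) (coef_path a) (coef_path a))).
  rewrite mulr_sumr; apply: ler_sum => a _; rewrite mulrCA ler_pM ?ler0n ?(inner_ge0 sdH)//.
    (* [n < 2 ^ n] absorbs the weight [(mi_deg a).+1]. *)
    by rewrite -natrX ler_nat ltn_expl.
  have [_ h] := HC (cut t (coef_path a)) (cut t (coef_path a)).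
  by rewrite (le_trans h)// ler_wpM2l// dotL2_cut_le.
have mc a : measurable_fun setT (fun s => (2 ^+ mi_deg a * sol_coef s a ^+ 2)%:E).
  apply/measurable_EFinP; apply: measurable_funM => //.
  by apply: measurable_funX; exact: measurable_sol_coef.
have c0 a s : (0 <= (2 ^+ mi_deg a * sol_coef s a ^+ 2)%:E)%E.
  by rewrite lee_fin mulr_ge0 ?sqr_ge0// exprn_ge0.
rewrite ler_wpM2l// -lee_fin EFinM fineK// -integral_cst// -sumEFin.
have -> : (\sum_(a <- J) (2 ^+ mi_deg a * dotL2 (leb T) (coef_path a) (coef_path a))%:E =
    \sum_(a <- J) \int[leb T]_s (2 ^+ mi_deg a * sol_coef s a ^+ 2)%:E)%E.
  apply: eq_bigr => a _; rewrite EFinM (dotL2_sqE (LfunP (coef_path a))).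
  rewrite -ge0_integralZl_EFin ?exprn_ge0//.
    by move=> s _; rewrite lee_fin sqr_ge0.
  by apply/measurable_EFinP; apply: measurable_funX; exact: measurable_sol_coef.
rewrite -ge0_integral_sum//; apply: le_integral_nonneg => s; first exact: sume_ge0.
by rewrite sumEFin lee_fin; exact: HM.
Qed.

Lemma sol_ito_equation (u : R -> Omega -> R) t :
  (forall s, u s = (sol s : Omega -> R) %[ae P]) -> ito_equation B m Ks u t.
Proof.
(* The constant is subtracted as the exponential of 0, almost surely 1, which keeps the integral
   visibly in the closed span. *)
move=> u_sol; exists (fun w => sol t w - exp_vecL2 B_noise 0 w); last first.
  apply: filterS2 (u_sol t) (one_ae B_noise) => w uw ow h.
  by rewrite (uw h) (ow h) addrC subrK.
exists (fun w => cut t (path w)).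
  split; first exact: cut_path_joint.
  apply: aeW => s.
  apply: filterS2 (u_sol s) (sol_path_ae B_noise K_bounded Ks_adjoint s) => w uw h h'.
  by rewrite -[cut t (path w) s]/(chi T t s * path w s) h// uw// mulrC.
split; first exact: admissible_cut_path.
have [W HW] := choice (fun a => wick_exists B_noise m_basis (ito_kernel t a) a).
exists (ito_kernel t), W; split=> [a f|//|]; first exact: ito_kernelE.
have [M HM] := ito_kernel_energy t.
refine (wick_sum_exists (B_noise := B_noise) m_basis HW (I := sol t - exp_vecL2 B_noise 0) (M := M) _ _ HM) => [|al].
  by apply: (cspanB sdP xi_o); exact: exp_vec_cspan.
rewrite (innerBl sdP) (sol_coefE B_noise m_basis Ks_adjoint) one_coef// sol_coef_rec.
rewrite addrC addKr; apply: eq_bigr => k _; congr (_ * _).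
rewrite (adjointE Ks_adjoint); apply: eq_Rintegral => s _.
by rewrite -[cut _ _ s]/(chi T t s * sol_coef s _) mulrA.
Qed.

End Existence.

Theorem theorem1 (R : realType) (d : measure_display) (Omega : measurableType d)
    (P : probability Omega R) (T : R) (T_gt0 : 0 < T)
    (X : L2 (leb T) -> {RV P >-> R}) (X_field : gaussian_field X)
    (B : L2 (leb T) -> {RV P >-> R}) (B_noise : white_noise B)
    (m : nat -> L2 (leb T)) (m_basis : orthonormal_basis m)
    (K Ks : L2 (leb T) -> L2 (leb T))
    (K_bounded : bounded_operator K) (Ks_adjoint : adjoint_of K Ks)
    (X_repr : forall f : L2 (leb T), X f = B (Ks f) %[ae P]) :
  let u0 (t : R) (w : Omega) : R :=
    expR (X (chi T t) w - 2^-1 * fine 'E_P[(fun w' => X (chi T t) w' ^+ 2)%R]%E) in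
  [/\ process_L2 X u0 /\
        (forall t, 0 <= t <= T -> ito_equation B m Ks u0 t),
      forall u : R -> Omega -> R, process_L2 X u ->
        (forall t, 0 <= t <= T -> ito_equation B m Ks u t) ->
        forall t, 0 <= t <= T -> u t = u0 t %[ae P] &
      forall u : R -> Omega -> R, process_L2 X u ->
        (\forall t \ae leb T, ito_equation B m Ks u t) ->
        \forall t \ae leb T, u t = u0 t %[ae P]].
Proof.
move=> u0; pose sol := sol B_noise Ks.
(* The representation turns the variance of [X (chi T t)] into the square norm of [Ks (chi T t)]. *)
have X2 t : fine 'E_P[(fun w => X (chi T t) w ^+ 2)%R]%E = dotL2 (leb T) (Ks (chi T t)) (Ks (chi T t)).
  have [_ B2] := B_noise.
  transitivity (fine 'E_P[(fun w => B (Ks (chi T t)) w * B (Ks (chi T t)) w)%R]%E); last by rewrite B2.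
  congr fine; rewrite unlock; apply: ae_eq_integral => //.
  - by apply/measurable_EFinP; apply: measurable_funX.
  - by apply/measurable_EFinP; apply: measurable_funM.
  - by apply: filterS (X_repr (chi T t)) => w h h'; rewrite h.
have u0_sol t : u0 t = (sol t : Omega -> R) %[ae P].
  apply: filterS (X_repr (chi T t)) => w h h'.
  by rewrite /u0 h// X2 mulrC.
have sol_u0 t : (sol t : Omega -> R) = u0 t %[ae P].
  by apply: filterS (u0_sol t) => w h /h.
have mu0 d' (S : measurableType d') (Y : S -> R) (c : R) :
    measurable_fun setT Y -> measurable_fun setT (fun w => expR (Y w - c)).
  by move=> mY; apply: (measurableT_comp (@measurable_expR R)); apply: measurable_funB.
have u0_L2 : process_L2 X u0.
  split.
    apply: aeW => s; split.
      by apply: (Lfun2_ae_eq _ (LfunP (sol s)) (sol_u0 s)); exact: mu0.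
    (* [u0 s] is an explicit function of [X (chi T s)], hence measurable for the sigma-algebra of
       [X] itself. *)
    exists (u0 s : g_sigma_algebraType (field_events X) -> R); last exact: ae_eq_refl.
    by apply: mu0; exact: measurable_field_noise.
  exists (sol_path B Ks); last exact: (sol_path_energy B_noise K_bounded Ks_adjoint).
  split; first exact: sol_path_joint.
  apply: aeW => s; apply: filterS2 (u0_sol s) (sol_path_ae B_noise K_bounded Ks_adjoint s) => w h1 h2 h.
  by rewrite h1// h2.
(* Uniqueness at one time uses the equation there and at almost every time; both uniqueness claims
   are instances. *)
have unique u t : process_L2 X u -> {ae leb T, forall s, ito_equation B m Ks u s} ->
    ito_equation B m Ks u t -> u t = u0 t %[ae P].
  move=> [uL uE] uI ut; have ut_sol : u t = (sol t : Omega -> R) %[ae P].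
    apply: (ito_unique B_noise m_basis Ks_adjoint _ uE uI ut).
    by apply: leb_aeS uL => s [].
  by apply: filterS2 ut_sol (sol_u0 t) => w h1 h2 h; rewrite h1// h2.
split.
- by split=> // t _; exact: (sol_ito_equation m_basis K_bounded Ks_adjoint).
- move=> u uL uI t tT; apply: unique => //; last exact: uI.
  by apply: leb_aeS (@leb_ae_itv _ T) => s; exact: uI.
- move=> u uL uI; have uI0 := uI; apply: leb_aeS uI0 => t ut.
  exact: unique.
Qed.
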